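(* Let $S$ be a closed oriented surface of genus at least $2$ with a hyperbolic metric $X$, let $\rho:\pi_1S\to\mathrm{SL}(3,\mathbb{R})$ be a Hitchin representation, and let $\mu\subset X$ be a (connected) geodesic lamination. Then the slithering sections define a Hölder continuous flat connection on the line bundle $\overline{E}{}_2^\rho|_\mu\to\mu$ (called the slithering connection). Its holonomy can be recorded as a representation $$\chi:\pi_1\tau\to\mathbb{R}^\times,$$ where $\tau$ is a snug train track carrying $\mu$.
   Context: $\rho$ Hitchin means: $\rho$ preserves a properly and strictly convex domain $\Omega\subset\mathbb{RP}^2$ with $C^1$ boundary and acts properly discontinuously and cocompactly with $\Omega/\rho\cong S$. Let $\xi:\partial\pi_1S\to\partial\Omega$ be the equivariant homeomorphism, and for $z\in\partial\pi_1S$ let $\mathcal F(z)$ be the full flag in $(\mathbb{R}^3)^*$ consisting of the line $\xi^*(z)$ of functionals defining the tangent line to $\partial\Omega$ at $\xi(z)$ and the plane of functionals vanishing on $\xi(z)$. For distinct points these flags are transverse. $\mathrm{GL}(3,\mathbb{R})$ acts on $(\mathbb{R}^3)^*$ by $A.\alpha=\alpha\circ A^{-1}$. The bundle. For a geodesic $\ell$ with endpoints $\ell^\pm\in\partial\pi_1S$ let $D_\ell\subset(\mathbb{R}^3)^*$ be the line of functionals vanishing on $\xi(\ell^+)$ and $\xi(\ell^-)$. Let $\tilde\mu\subset\widetilde X$ be the preimage of $\mu$. $\overline E{}_2^\rho|_\mu$ (also written $F_2^\rho(\mu)$) is the quotient by the diagonal $\pi_1S$-action of the line bundle over $\tilde\mu$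 whose fiber at a point of a leaf $\ell$ is $D_\ell$. The flat $(\mathbb{R}^3)^*$-bundle with holonomy $\rho$ induces a flat connection $\nabla^\rho$ on it along each leaf (constant vectors in $D_\ell$ are parallel). Train tracks. A train track neighborhood $\mathcal N$ of $\mu$ is a small neighborhood of $\mu$ foliated by $C^1$ arcs (ties) transverse to $\mu$; collapsing ties gives a train track $\tau$ carrying $\mu$. It (and $\tau$) is snug if every component of $X\setminus\mathcal N$ is a deformation retract of the component of $X\setminus\mu$ containing it. Slithering. For leaves $g,h$ of $\tilde\mu$ crossed by a common lift of a tie of a snug neighborhood there is the Bonahon–Dreyer slithering map $\Sigma_{hg}\in\mathrm{SL}((\mathbb{R}^3)^* )$; it is the unique family, locally Hölder continuous in $(h,g)$, with $\Sigma_{gg}=\mathrm{Id}$, $\Sigma_{gh}=\Sigma_{hg}^{-1}$, $\Sigma_{g''g}=\Sigma_{g''g'}\Sigma_{g'g}$ if $g'$ separates $g$ from $g''$, and such that if $g,h$ share an endpoint $z$ and have other endpoints $x,y$, then $\Sigma_{hg}$ is the unique unipotent map stabilizing $\mathcal F(z)$ and taking $\mathcal F(x)$ to $\mathcal F(y)$. It maps $D_g$ to $D_h$. A slithering section over a tie $t$ is a non-zero section $\omega$ of $F_2^\rho(\mu)$ over $t\cap\mu$ with $\omega(q)=\Sigma_{\ell(q)\ell(p)}\omega(p)$ for all $p,q\in t\cap\mu$ (computed in a lift), where $\ell(x)$ is the leaf through $x$. Flat connection. A flat connection on a line bundle $E\to\mu$ with a given flat connection $\nabla^0$ along leaves (here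 $\nabla^0=\nabla^\rho$) is an assignment to each embedded transversal $\alpha$ to $\mu$ in $\mathcal N$ of a continuous nowhere-zero section $\nabla_\alpha$ of $E$ over $\alpha\cap\mu$, up to a non-zero scalar, compatible with restriction to subarcs, and such that if $\alpha,\beta$ are isotopic through transversals by $H$, then $\nabla^0$-parallel transport along leaves following $H$ takes $\nabla_\alpha$ to $\nabla_\beta$. It is Hölder if these sections are Hölder continuous. The holonomy of a loop in $\tau$ is computed by lifting the loop to a closed concatenation of leaf segments and tie segments in $\mathcal N$ and taking parallel transport around the reversed path (well-definedness being part of the assertion). *)

(* Defs.v *)
From HB Require Import structures.
From mathcomp Require Import all_boot all_order all_algebra.
From mathcomp Require Import all_classical all_reals all_analysis.
Import numFieldNormedType.Exports.

Set Implicit Arguments.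
Unset Strict Implicit.
Unset Printing Implicit Defensive.

Import Order.TTheory GRing.Theory Num.Theory.
Local Open Scope classical_set_scope.
Local Open Scope ring_scope.

(* [f], restricted to [A], is a topological quotient map onto the whole of
   [Y]; the values of [f] outside [A] are irrelevant. *)
Definition quotient_map_on (T Y : topologicalType) (A : set T) (f : T -> Y) :=
  f @` A = setT /\
  forall U : set Y, open U <->
    exists2 V : set T, open V & A `&` f @^-1` U = A `&` V.

(* Strong deformation retraction of [B] onto its subset [A]. *)
Definition deformation_retract (R : realType) (T : topologicalType)
    (A B : set T) :=
  A `<=` B /\
  exists F : R -> T -> T,
    [/\ {within `[0, 1] `*` B, continuous (fun z => F z.1 z.2)},
        (forall t x, t \in `[0, 1] -> B x -> B (F t x)),
        (forall x, B x -> F 0 x = x),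
        (forall x, B x -> A (F 1 x)) &
        (forall t x, t \in `[0, 1] -> A x -> F t x = x)].

Section FundamentalGroup.
Context {R : realType} {T : topologicalType}.
Implicit Types (f g : R -> T) (b : T).

(* Paths are functions on [R] of which only the restriction to [[0, 1]]
   matters. *)
Definition loop b f :=
  [/\ {within `[0, 1], continuous f}, f 0 = b & f 1 = b].

Definition loop_homotopic b f g :=
  exists H : R -> R -> T,
    [/\ {within `[0, 1] `*` `[0, 1], continuous (fun z => H z.1 z.2)},
        (forall u, u \in `[0, 1] -> H u 0 = b /\ H u 1 = b),
        (forall t, t \in `[0, 1] -> H 0 t = f t) &
        (forall t, t \in `[0, 1] -> H 1 t = g t)].

Definition loop_cat f g : R -> T :=
  fun t => if t <= 2^-1 then f (2 * t) else g (2 * t - 1).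

Definition loop_class b f : set (R -> T) :=
  [set g | loop b g /\ loop_homotopic b f g].

(* [chi] is a homomorphism from [pi_1(T, b)], whose elements are the classes
   [loop_class b f], to the multiplicative group of nonzero reals. *)
Definition pi1_character b (chi : set (R -> T) -> R) :=
  (forall f, loop b f -> chi (loop_class b f) != 0) /\
  (forall f g, loop b f -> loop b g ->
     chi (loop_class b (loop_cat f g))
     = chi (loop_class b f) * chi (loop_class b g)).

End FundamentalGroup.

Section Hyperbolic.
Context {R : realType}.
Local Notation V := 'cV[R]_3.

Definition lorentz (x y : V) : R :=
  \sum_(i < 3) (if i == ord_max then -1 else 1) * x i 0 * y i 0.

Definition Hyp : set V := [set x | lorentz x x = -1 /\ 0 < x ord_max 0].

(* The circle at infinity: every null ray meets the slice of height 1 once. *)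
Definition bdHyp : set V := [set p | lorentz p p = 0 /\ p ord_max 0 = 1].

Definition bd_act (A : 'M[R]_3) (p : V) : V :=
  ((A *m p) ord_max 0)^-1 *: (A *m p).

(* An oriented geodesic is the ordered pair of its endpoints in [bdHyp];
   [geod g] is its support, [grev g] the same geodesic reversed. *)
Definition geod (g : V * V) : set V :=
  Hyp `&` [set x | exists a b : R,
                     [/\ 0 < a, 0 < b & x = a *: g.1 + b *: g.2]].

Definition grev (g : V * V) : V * V := (g.2, g.1).

Definition geod_act (A : 'M[R]_3) (g : V * V) : V * V :=
  (bd_act A g.1, bd_act A g.2).

Definition vol3 (x y z : V) : R :=
  \det (row_mx x (row_mx y z) : 'M[R]_3).

(* The geodesic [g'] is the zero set on [Hyp] of [vol3 g'.1 g'.2]; the sign of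
   this functional tells the two half-planes bounded by [g'] apart. *)
Definition separates (g' g h : V * V) :=
  forall x y, geod g x -> geod h y ->
    vol3 g'.1 g'.2 x * vol3 g'.1 g'.2 y < 0.

(* A group of orientation-preserving isometries of [Hyp] acting freely,
   properly discontinuously and cocompactly.  By uniformization and
   Gauss-Bonnet these are exactly the groups [pi_1 S] of the closed oriented
   hyperbolic surfaces [Hyp / Gamma], all of genus at least 2. *)
Definition surface_group (Gamma : set 'M[R]_3) :=
  [/\ Gamma 1%:M /\
      (forall A B, Gamma A -> Gamma B -> Gamma (A *m B) /\ Gamma (invmx A)),
      (forall A, Gamma A ->
         [/\ forall x y, lorentz (A *m x) (A *m y) = lorentz x y,
             \det A = 1 &
             forall x, Hyp x -> Hyp (A *m x)]),
      (forall A x, Gamma A -> Hyp x -> A *m x = x -> A = 1%:M),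
      (forall K : set V, compact K -> K `<=` Hyp ->
         finite_set [set A | Gamma A /\ exists2 x, K x & K (A *m x)]) &
      (exists K : set V, [/\ compact K, K `<=` Hyp &
         forall x, Hyp x -> exists2 A, Gamma A & K (A *m x)])].

(* [X] is the quotient surface [Hyp / Gamma] and [pr] the universal cover. *)
Definition universal_cover (Gamma : set 'M[R]_3) (X : topologicalType)
    (pr : V -> X) :=
  quotient_map_on Hyp pr /\
  (forall x y, Hyp x -> Hyp y ->
     (pr x = pr y <-> exists2 A, Gamma A & y = A *m x)).

End Hyperbolic.

Section Hitchin.
Context {R : realType}.
Local Notation V := 'cV[R]_3.

(* Equality of the points of the projective plane represented by [x], [y]. *)
Definition proj_eq (x y : V) := exists2 c : R, c != 0 & y = c *: x.

(* A domain of the projective plane is given by an open convex cone [Om] lying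
   over it; the boundary of the domain is the projectivization of [cone_bd]. *)
Definition cone_bd (Om : set V) : set V :=
  [set x | [/\ closure Om x, ~ Om x & x != 0]].

Definition properly_convex (Om : set V) :=
  [/\ open Om, Om !=set0,
      (forall x y (a b : R), Om x -> Om y -> 0 < a -> 0 < b ->
         Om (a *: x + b *: y)) &
      (forall x, closure Om x -> closure Om (- x) -> x = 0)].

Definition strictly_convex (Om : set V) :=
  forall x y, cone_bd Om x -> cone_bd Om y -> ~ proj_eq x y -> Om (x + y).

(* Near [x], [f] is a C^1 function with nonzero differential whose zero set is
   the boundary of the cone. *)
Definition C1_defining (Om : set V) (x : V) (f : V -> R) :=
  (\forall y \near x,
     [/\ differentiable f y,
         (forall v, {for y, continuous (fun z => 'd f z v : R)}) &
         f y = 0 <-> (closure Om y /\ ~ Om y)]) /\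
  (exists v, ('d f x v : R) != 0).

Definition C1_boundary (Om : set V) :=
  forall x, cone_bd Om x -> exists f, C1_defining Om x f.

(* Functionals are row vectors.  The functionals vanishing on the tangent line
   at [x] to the boundary of the domain: *)
Definition tangent_line (Om : set V) (x : V) : set 'rV[R]_3 :=
  [set phi | exists f (c : R), C1_defining Om x f /\
               forall v, (phi *m v) 0 0 = c * 'd f x v].

Definition annihilator (x : V) : set 'rV[R]_3 := [set phi | phi *m x = 0].

Definition hom_SL3 (Gamma : set 'M[R]_3) (rho : 'M[R]_3 -> 'M[R]_3) :=
  (forall A, Gamma A -> \det (rho A) = 1) /\
  (forall A B, Gamma A -> Gamma B -> rho (A *m B) = rho A *m rho B).

(* [rho] preserves the properly and strictly convex domain with cone [Om],
   whose boundary is C^1, and acts on it properly discontinuously and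
   cocompactly; the last clause is the identification of the quotient with [S]
   that induces [rho] on fundamental groups, i.e. a [rho]-equivariant
   homeomorphism from [Hyp] to the domain. *)
Definition hitchin (Gamma : set 'M[R]_3) (rho : 'M[R]_3 -> 'M[R]_3)
    (Om : set V) :=
  [/\ hom_SL3 Gamma rho,
      [/\ properly_convex Om, strictly_convex Om & C1_boundary Om],
      (forall A x, Gamma A -> Om x -> exists2 y, Om y & proj_eq (rho A *m x) y),
      (forall K : set V, compact K -> K `<=` Om ->
         finite_set [set A | Gamma A /\
           exists x y, [/\ K x, K y & proj_eq (rho A *m x) y]]) /\
      (exists K : set V, [/\ compact K, K `<=` Om &
         forall x, Om x -> exists2 A, Gamma A &
           exists2 y, K y & proj_eq (rho A *m x) y]) &
      exists (dev : V -> V) (ved : V -> V),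
        [/\ {within Hyp, continuous dev} /\ {within Om, continuous ved},
            (forall x, Hyp x -> Om (dev x) /\ ved (dev x) = x),
            (forall y, Om y -> Hyp (ved y) /\ proj_eq y (dev (ved y))),
            (forall y (c : R), Om y -> 0 < c -> ved (c *: y) = ved y) &
            (forall A x, Gamma A -> Hyp x ->
               proj_eq (rho A *m dev x) (dev (A *m x)))]].

(* The equivariant homeomorphism from the boundary of [pi_1 S], which is the
   circle [bdHyp], to the boundary of the domain, lifted to vectors.  (A
   continuous bijection from a compact space to a Hausdorff one.) *)
Definition boundary_homeo (Gamma : set 'M[R]_3) (rho : 'M[R]_3 -> 'M[R]_3)
    (Om : set V) (xi : V -> V) :=
  [/\ {within bdHyp, continuous xi},
      (forall p, bdHyp p -> cone_bd Om (xi p)),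
      (forall p q, bdHyp p -> bdHyp q -> proj_eq (xi p) (xi q) -> p = q),
      (forall x, cone_bd Om x -> exists2 p, bdHyp p & proj_eq (xi p) x) &
      (forall A p, Gamma A -> bdHyp p ->
         proj_eq (rho A *m xi p) (xi (bd_act A p)))].

(* The line [D_l] of functionals vanishing at both endpoints of a geodesic. *)
Definition Dline (xi : V -> V) (g : V * V) : set 'rV[R]_3 :=
  annihilator (xi g.1) `&` annihilator (xi g.2).

(* A matrix [M] stands for the automorphism [phi |-> phi *m M] of the space of
   functionals, so that composition reverses the order of matrix products.
   This one maps the flag over [p] onto the flag over [q]. *)
Definition maps_flag (Om : set V) (xi : V -> V) (M : 'M[R]_3) (p q : V) :=
  [set phi *m M | phi in tangent_line Om (xi p)] = tangent_line Om (xi q) /\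
  [set phi *m M | phi in annihilator (xi p)] = annihilator (xi q).

Definition unipotent (M : 'M[R]_3) := (M - 1) ^+ 3 = 0.

End Hitchin.

Section Lamination.
Context {R : realType}.
Local Notation V := 'cV[R]_3.
Context (Gamma : set 'M[R]_3) {X : topologicalType} (pr : V -> X).

(* A lamination is given by the set [L] of the lifts of its leaves, each with
   both orientations.  [lift_supp] is the preimage of the lamination in [Hyp]
   and [supp] the lamination itself. *)
Definition lift_supp (L : set (V * V)) : set V :=
  [set x | exists2 g, L g & geod g x].

Definition supp (L : set (V * V)) : set X := pr @` lift_supp L.

Definition geodesic_lamination (L : set (V * V)) :=
  [/\ L !=set0 /\ closed (supp L),
      (forall g, L g -> [/\ bdHyp g.1, bdHyp g.2, g.1 != g.2 & L (grev g)]),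
      (forall A g, Gamma A -> L g -> L (geod_act A g)) &
      (forall g h x, L g -> L h -> geod g x -> geod h x ->
         h = g \/ h = grev g)].

Context (L : set (V * V)).

(* A C^1 arc in [Hyp] parametrized by [[0, 1]], transverse to the leaves it
   meets and embedded in the surface; two-sided differentiability at 0 and 1
   is the usual requirement that the arc extends. *)
Definition lifted_transversal (a : R -> V) :=
  [/\ (forall t, t \in `[0, 1] ->
         [/\ Hyp (a t), derivable a t 1 & derive1 a t != 0]),
      {within `[0, 1], continuous (derive1 a)},
      (forall s t, s \in `[0, 1] -> t \in `[0, 1] ->
         pr (a s) = pr (a t) -> s = t) &
      (forall t g, t \in `[0, 1] -> L g -> geod g (a t) ->
         vol3 g.1 g.2 (derive1 a t) != 0)].

Definition arc_of (a : R -> V) : set X := [set pr (a t) | t in `[0, 1]].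

Definition lifts (a : R -> V) (A : set X) :=
  lifted_transversal a /\ arc_of a = A.

(* Embedded transversals contained in [N]. *)
Definition transversal_in (N A : set X) :=
  A `<=` N /\ exists a, lifts a A.

(* The neighborhood is a union of finitely many rectangles meeting only along
   their short sides; [Q i] is a lift of the i-th one, with ties
   [{s} x [0, 1]] and short sides at [s = 0, 1].  The ties of the neighborhood
   are those of the open rectangles and the components of the union of the
   short sides; the latter become the switches of the train track. *)
Context (n : nat) (Q : 'I_n -> R -> R -> V).

Definition nbhd_of : set X :=
  [set x | exists i s t, [/\ s \in `[0, 1], t \in `[0, 1] & x = pr (Q i s t)]].

Definition rect_tie (i : 'I_n) (s : R) : set X :=
  [set pr (Q i s t) | t in `[0, 1]].

Definition short_sides : set X :=
  [set x | exists i, rect_tie i 0 x \/ rect_tie i 1 x].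

Definition tie (A : set X) :=
  (exists i, exists2 s, s \in `]0, 1[ & A = rect_tie i s) \/
  (exists2 x, short_sides x & A = connected_component short_sides x).

(* The clause on lifted ties crossing a leaf at most once expresses that the
   neighborhood is small. *)
Definition train_track_nbhd :=
  [/\ (forall i, {within `[0, 1] `*` `[0, 1],
                    continuous (fun z => Q i z.1 z.2)} /\
         forall s t, s \in `[0, 1] -> t \in `[0, 1] -> Hyp (Q i s t)),
      (forall i j s t s' t', s \in `]0, 1[ -> t \in `[0, 1] ->
         s' \in `[0, 1] -> t' \in `[0, 1] -> pr (Q i s t) = pr (Q j s' t') ->
         [/\ i = j, s = s' & t = t']) /\
      (forall i s t t', s = 0 \/ s = 1 -> t \in `[0, 1] -> t' \in `[0, 1] ->
         pr (Q i s t) = pr (Q i s t') -> t = t'),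
      supp L `<=` interior nbhd_of,
      (forall A, tie A -> transversal_in nbhd_of A /\ A `&` supp L !=set0) &
      (forall A a g s t, tie A -> lifts a A -> L g ->
         s \in `[0, 1] -> t \in `[0, 1] -> geod g (a s) -> geod g (a t) ->
         s = t)].

(* Each component [C] of the complement of the neighborhood is all that the
   neighborhood leaves of the component [U] of the complement of the
   lamination containing it, and is a deformation retract of [U].  As the
   neighborhood is closed, [C] is open and the retraction is onto its
   closure. *)
Definition snug :=
  forall x, ~ nbhd_of x ->
    let C := connected_component (~` nbhd_of) x in
    let U := connected_component (~` supp L) x in
    U `\` nbhd_of = C /\ deformation_retract R (closure C) U.

(* [tau] is the train track obtained by collapsing the ties. *)
Definition collapse (tau : topologicalType) (coll : X -> tau) :=
  quotient_map_on nbhd_of coll /\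
  (forall x y, nbhd_of x -> nbhd_of y ->
     (coll x = coll y <-> exists A, [/\ tie A, A x & A y])).

(* The leaves [g] and [h] are crossed by a common lift of a tie. *)
Definition crossed (h g : V * V) :=
  [/\ L h, L g &
      exists A a s t, [/\ tie A, lifts a A, s \in `[0, 1], t \in `[0, 1] &
                          geod g (a s) /\ geod h (a t)]].

Context (rho : 'M[R]_3 -> 'M[R]_3) (Om : set V) (xi : V -> V).

(* [S h g] stands for [Sigma_{hg}], acting by [phi |-> phi *m S h g]; it does
   not depend on the orientations chosen on the leaves. *)
Definition slithering_axioms (S : V * V -> V * V -> 'M[R]_3) :=
  [/\ (forall h g, crossed h g ->
         [/\ \det (S h g) = 1, S (grev h) g = S h g & S h (grev g) = S h g]),
      (forall h g, crossed h g ->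
         exists e K theta : R, [/\ 0 < e, 0 < theta &
           forall h1 g1 h2 g2, crossed h1 g1 -> crossed h2 g2 ->
             `|(h1, g1) - (h, g)| < e -> `|(h2, g2) - (h, g)| < e ->
             `|S h1 g1 - S h2 g2|
             <= K * (`|(h1, g1) - (h2, g2)| `^ theta)]),
      (forall h g, crossed h g -> S g g = 1%:M /\ S g h = invmx (S h g)),
      (forall g g' g'', crossed g'' g -> L g' -> separates g' g g'' ->
         S g'' g = S g' g *m S g'' g') &
      (forall z x y, crossed (z, y) (z, x) ->
         [/\ unipotent (S (z, y) (z, x)),
             maps_flag Om xi (S (z, y) (z, x)) z z &
             maps_flag Om xi (S (z, y) (z, x)) x y])].

(* The Bonahon-Dreyer slithering map: the unique family with the properties
   above; it maps [D_g] to [D_h]. *)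
Definition slithering_map (S : V * V -> V * V -> 'M[R]_3) :=
  [/\ slithering_axioms S,
      (forall S', slithering_axioms S' ->
         forall h g, crossed h g -> S' h g = S h g) &
      (forall h g, crossed h g ->
         [set phi *m S h g | phi in Dline xi g] = Dline xi h)].

Definition lift_of (A : set X) : set V := lift_supp L `&` pr @^-1` A.

(* A section over [A `&` supp L] of the quotient line bundle is an equivariant
   section, over the preimage of this set, of the bundle with fiber [D_l] over
   the points of [l]; [Gamma] acts on functionals by
   [phi |-> phi *m (rho B)^-1].  Values outside the preimage are irrelevant. *)
Definition bundle_section (A : set X) (s : V -> 'rV[R]_3) :=
  (forall x g, lift_of A x -> L g -> geod g x -> Dline xi g (s x)) /\
  (forall B x, Gamma B -> lift_of A x -> s (B *m x) = s x *m invmx (rho B)).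

Definition nowhere_zero (A : set X) (s : V -> 'rV[R]_3) :=
  forall x, lift_of A x -> s x != 0.

Definition slithering_section (S : V * V -> V * V -> 'M[R]_3) (A : set X)
    (s : V -> 'rV[R]_3) :=
  [/\ bundle_section A s, nowhere_zero A s &
      forall a, lifts a A -> forall t u g h, t \in `[0, 1] -> u \in `[0, 1] ->
        L g -> L h -> geod g (a t) -> geod h (a u) ->
        s (a u) = s (a t) *m S h g].

(* An isotopy through transversals in [N], lifted to [Hyp]: the arcs sweep
   along the leaves. *)
Definition transversal_isotopy (N : set X) (H : R -> R -> V) :=
  [/\ {within `[0, 1] `*` `[0, 1], continuous (fun z => H z.1 z.2)},
      (forall u, u \in `[0, 1] ->
         lifted_transversal (H u) /\ arc_of (H u) `<=` N) &
      (forall u t g, u \in `[0, 1] -> t \in `[0, 1] -> L g ->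
         (geod g (H u t) <-> geod g (H 0 t)))].

(* [nabla A] represents the section attached to the transversal [A], which
   matters only up to a nonzero scalar.  Parallel transport along leaves is
   constant in the universal cover. *)
Definition flat_connection (N : set X) (nabla : set X -> V -> 'rV[R]_3) :=
  [/\ (forall A, transversal_in N A ->
         [/\ bundle_section A (nabla A), nowhere_zero A (nabla A) &
             {within lift_of A, continuous (nabla A)}]),
      (forall A B, transversal_in N A -> transversal_in N B -> A `<=` B ->
         exists2 c : R, c != 0 &
           forall x, lift_of A x -> nabla A x = c *: nabla B x) &
      (forall H, transversal_isotopy N H ->
         exists2 c : R, c != 0 &
           forall t, t \in `[0, 1] -> lift_supp L (H 0 t) ->
             nabla (arc_of (H 1)) (H 1 t) = c *: nabla (arc_of (H 0)) (H 0 t))].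

(* Distances are measured in the ambient space of the hyperboloid; along a
   compact arc they are comparable to hyperbolic ones. *)
Definition hoelder_connection (N : set X) (nabla : set X -> V -> 'rV[R]_3) :=
  forall A a, transversal_in N A -> lifts a A ->
    exists K theta : R, 0 < theta /\
      forall t u, t \in `[0, 1] -> u \in `[0, 1] ->
        lift_supp L (a t) -> lift_supp L (a u) ->
        `|nabla A (a t) - nabla A (a u)| <= K * (`|a t - a u| `^ theta).

(* [c] is the lift to [Hyp] of a concatenation of leaf segments and tie
   segments, subdivided at [0 = u 0 <= ... <= u m = 1], and [v] is the
   parallel transport along it of the vector [v 0] of the fiber at [c 0]. *)
Definition leaf_tie_transport (nabla : set X -> V -> 'rV[R]_3)
    (c : R -> V) (m : nat) (u : nat -> R) (v : nat -> 'rV[R]_3) :=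
  [/\ {within `[0, 1], continuous c},
      [/\ u 0%N = 0, u m = 1 & forall k, (k < m)%N -> u k <= u k.+1],
      (forall k, (k <= m)%N -> lift_supp L (c (u k))),
      (forall g, L g -> geod g (c 0) -> Dline xi g (v 0%N)) &
      forall k, (k < m)%N ->
        (exists g, [/\ L g, forall t, t \in `[u k, u k.+1] -> geod g (c t) &
                       v k.+1 = v k]) \/
        (exists A a (r : R),
           [/\ tie A, lifts a A,
               (forall t, t \in `[u k, u k.+1] ->
                  exists2 w, w \in `[0, 1] & c t = a w),
               v k = r *: nabla A (c (u k)) &
               v k.+1 = r *: nabla A (c (u k.+1))])].

(* [c] projects to a closed curve in the neighborhood, its lift being closed up
   by [B], and this curve collapses to a loop in [tau] homotopic to [f]. *)
Definition lifts_loop (tau : topologicalType) (coll : X -> tau) (b : tau)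
    (f : R -> tau) (c : R -> V) (B : 'M[R]_3) :=
  [/\ Gamma B, c 1 = B *m c 0, loop b (fun t => coll (pr (c t))) &
      loop_homotopic b f (fun t => coll (pr (c t)))].

(* [chi] records the holonomy.  In the quotient bundle, the fiber at the end
   of [c] is identified with the fiber at its beginning by [B]; the reversed
   path carries [v m] to [v 0], hence [v 0 *m (rho B)^-1 = x *: v m] to
   [x *: v 0]. *)
Definition records_holonomy (nabla : set X -> V -> 'rV[R]_3)
    (tau : topologicalType) (coll : X -> tau) (b : tau)
    (chi : set (R -> tau) -> R) :=
  forall f, loop b f ->
    (exists c B m u v, [/\ leaf_tie_transport nabla c m u v, v 0%N != 0 &
                           lifts_loop coll b f c B]) /\
    (forall c B m u v, leaf_tie_transport nabla c m u v -> v 0%N != 0 ->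
       lifts_loop coll b f c B ->
       v 0%N *m invmx (rho B) = chi (loop_class b f) *: v m).

End Lamination.

(* Main.v *)
Require Import Defs.
From mathcomp Require Import all_boot all_order all_algebra.
From mathcomp Require Import all_classical all_reals all_analysis.
From mathcomp Require Import ring lra.
Import numFieldNormedType.Exports.
Set Implicit Arguments.
Unset Strict Implicit.
Unset Printing Implicit Defensive.
Import Order.TTheory GRing.Theory Num.Theory.
Local Open Scope classical_set_scope.
Local Open Scope ring_scope.

(* The slithering maps form a cocycle along each tie, so a tie carries a
   slithering section, unique up to a scalar. Choose one over every switch and
   extend it along the leaves to the adjacent halves of the rectangles: this
   gives an equivariant section [track_section] of the whole bundle, which near
   any point of the lamination is invariant under slithering up to [transition],
   a locally constant cocycle on the train track recording the jumps across the
   midpoints of the edges. On a transversal, a primitive of this cocycle turns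
   [track_section] into a slithering section; these are the values of the
   connection. It is Hoelder because the slithering map is and because disjoint
   geodesics depend in a Lipschitz way on a point of them.

   The holonomy is that of the cocycle [transition], hence invariant under
   homotopy. A loop in the train track lifts to a chain of leaf and tie segments
   because every point has a star neighbourhood, in which paths can be pushed
   along the radii; a radius lifts to a slide along a tie, onto a leaf crossing
   the rectangle, followed by a segment of this leaf. *)

(** The slithering map depends only on the two leaves, not on the tie that both cross. Two leaves
    through one rectangle are therefore related by the same map at both of its ends, and the
    sections chosen independently over the two end switches differ along all leaves of the rectangle
    by one scalar. These edge scalars are the only obstruction to a global slithering section, so
    questions on parallel transport reduce to questions on a real cocycle of the track. A
    transversal that is not a tie may cross a leaf several times, and two of its leaves need not be
    crossed by a common tie, so the slithering map prescribes nothing between them. The values on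
    such an arc can be compared only locally and must be glued. This is why the cocycle identity is
    kept local and primitives are built on a subdivided interval or square; the square serves
    isotopies of transversals and homotopies of loops alike. Equivariance of the slithering map is
    not among its axioms: it comes from the uniqueness of the family. *)

Lemma within_continuousP (T U : topologicalType) (A : set T) (f : T -> U) :
  {within A, continuous f} <->
  (forall x, A x -> forall O, nbhs (f x) O -> \forall y \near x, A y -> O (f y)).
Proof. exact: subspace_continuousP. Qed.

(** * Continuous induction and primitives of local cocycles *)

Section Unit.
Context {R : realType}.
Implicit Types (a b p q t : R).

(** Compactness of the segment in additive form, proved by a supremum argument. It gives the
    constancy of locally constant functions and, later, the lifting of a path piece by piece. *)
Lemma cousin (a b : R) (P : R -> R -> Prop) : a <= b ->
  (forall t, t \in `[a, b] -> exists2 e : R, 0 < e & forall p q,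
     p \in `[a, b] -> q \in `[a, b] -> p <= q ->
     `|p - t| < e -> `|q - t| < e -> P p q) ->
  (forall p q r, a <= p -> p <= q -> q <= r -> r <= b -> P p q -> P q r -> P p r) ->
  P a b.
Proof.
move=> ab loc add.
pose E := [set t | t \in `[a, b] /\ P a t].
have Ea : E a.
  have aab : a \in `[a, b] by rewrite in_itv /= lexx ab.
  split=> //; have [e e0 he] := loc a aab.
  by apply: he; rewrite // ?subrr ?normr0.
have Eub : ubound E b by move=> t [/[!in_itv]/andP[]].
have hsE : has_sup E by split; [exists a | exists b].
pose s := sup E.
have as_ : a <= s by apply: (ub_le_sup hsE.2).
have sb : s <= b by apply: ge_sup; [exists a|].
have sab : s \in `[a, b] by rewrite in_itv /= as_ sb.
have [e e0 he] := loc s sab.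
have [t [tab Pt] ts] := sup_adherent e0 hsE.
have tles : t <= s by apply: (ub_le_sup hsE.2); split.
have tse : `|t - s| < e by rewrite ler0_norm; [rewrite opprB ltrBlDl -ltrBlDr|rewrite subr_le0].
pose u := Num.min b (s + e / 2).
have su : s <= u by rewrite le_min sb lerDl divr_ge0 // ltW.
have ub : u <= b by rewrite ge_min lexx.
have uab : u \in `[a, b] by rewrite in_itv /= (le_trans as_ su) ub.
have use : `|u - s| < e.
  rewrite ger0_norm ?subr_ge0 // ltrBlDl gt_min; apply/orP; right.
  by rewrite ltrD2l ltr_pdivrMr // ltr_pMr // ltr1n.
have Pu : P a u.
  apply: (add a t u) => //; first by move: tab; rewrite in_itv => /andP[].
    exact: le_trans tles su.
  by apply: he => //; exact: le_trans tles su.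
have us : u <= s by apply: (ub_le_sup hsE.2); split.
have : u = b.
  move: us; rewrite /u; case: (leP b (s + e / 2)) => // _.
  by rewrite gerDl leNgt divr_gt0.
by move=> <-.
Qed.

Lemma locally_constant (T : Type) (a b : R) (f : R -> T) : a <= b ->
  (forall t, t \in `[a, b] -> exists2 e : R, 0 < e & forall p q,
     p \in `[a, b] -> q \in `[a, b] -> 
     `|p - t| < e -> `|q - t| < e -> f p = f q) ->
  forall p q, p \in `[a, b] -> q \in `[a, b] -> f p = f q.
Proof.
move=> ab loc.
suff H : forall q, q \in `[a, b] -> f a = f q.
  by move=> p q pab qab; rewrite -H // -H.
move=> q; rewrite in_itv /= => /andP[aq qb].
apply: (@cousin a q (fun p q => f p = f q)) => //; last first.
  by move=> p r s _ _ _ _ -> ->.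
have sub t : t \in `[a, q] -> t \in `[a, b].
  by rewrite !in_itv /= => /andP[-> tq]; rewrite (le_trans tq qb).
move=> t tab; have [e e0 he] := loc t (sub _ tab).
by exists e => // p r pa ra _; apply: he; apply: sub.
Qed.
End Unit.

Section Primitive.
Context {R : realType} (Y : topologicalType) (th : Y -> Y -> R).
Hypothesis th_neq0 : forall x y, th x y != 0.
Hypothesis th_cocycle : forall y0 : Y, exists2 W : set Y, nbhs y0 W &
  forall x y z, W x -> W y -> W z -> th x y * th y z = th x z.

(** Lebesgue number argument: one [d] makes the cocycle identity valid on every [d]-small part of
    the square, where [th_cocycle] gives only a neighborhood of each point of [Y]. *)
Lemma uniform_cocycle (F : R -> R -> Y) :
  {within `[0, 1] `*` `[0, 1], continuous (fun z => F z.1 z.2)} ->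
  exists2 d : R, 0 < d & forall s t : R, s \in `[0, 1] -> t \in `[0, 1] ->
    forall s1 t1 s2 t2 s3 t3 : R,
    s1 \in `[0, 1] -> t1 \in `[0, 1] -> s2 \in `[0, 1] -> t2 \in `[0, 1] ->
    s3 \in `[0, 1] -> t3 \in `[0, 1] ->
    `|s1 - s| < d -> `|t1 - t| < d -> `|s2 - s| < d -> `|t2 - t| < d ->
    `|s3 - s| < d -> `|t3 - t| < d ->
    th (F s1 t1) (F s2 t2) * th (F s2 t2) (F s3 t3) = th (F s1 t1) (F s3 t3).
Proof.
move=> /within_continuousP cF.
pose K : set (R * R) := `[0, 1]%classic `*` `[0, 1]%classic.
have cK : compact K by apply: compact_setX; exact: segment_compact.
pose P (d : R) (z : R * R) := forall s1 t1 s2 t2 s3 t3 : R,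
    s1 \in `[0, 1] -> t1 \in `[0, 1] -> s2 \in `[0, 1] -> t2 \in `[0, 1] ->
    s3 \in `[0, 1] -> t3 \in `[0, 1] ->
    `|s1 - z.1| < d -> `|t1 - z.2| < d -> `|s2 - z.1| < d -> `|t2 - z.2| < d ->
    `|s3 - z.1| < d -> `|t3 - z.2| < d ->
    th (F s1 t1) (F s2 t2) * th (F s2 t2) (F s3 t3) = th (F s1 t1) (F s3 t3).
have /compact_near_coveringP/(_ R (0^'+) P) := cK.
case.
  move=> [s0 t0] Kz0.
  have [W Wz0 hW] := th_cocycle (F s0 t0).
  have /nbhs_ballP[e /= e0 he] := cF (s0, t0) Kz0 W Wz0.
  have e2 : 0 < e / 2 by rewrite divr_gt0.
  exists (ball (s0, t0) (e / 2), [set d | d < e / 2]).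
    split; first by apply: nbhsx_ballx.
    exact: nbhs_right_lt.
  move=> [[s t] d] /= [[bs bt] de] s1 t1 s2 t2 s3 t3 a1 b1 a2 b2 a3 b3 /= c1 d1 c2 d2 c3 d3.
  have close s' t' : s' \in `[0, 1] -> t' \in `[0, 1] -> `|s' - s| < d ->
      `|t' - t| < d -> W (F s' t').
    move=> s'01 t'01 hs ht; apply: (he (s', t')) => //.
    rewrite [e]splitr; split => /=.
      apply: (ball_triangle bs); rewrite /ball /= distrC; exact: lt_trans de.
    apply: (ball_triangle bt); rewrite /ball /= distrC; exact: lt_trans de.
  by apply: hW; apply: close.
move=> d /= d0 hd.
have d2 : 0 < d / 2 by rewrite divr_gt0.
exists (d / 2) => // s t s01 t01.
apply: (hd (d / 2) _ d2 (s, t)) => //.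
rewrite /ball /= sub0r normrN gtr0_norm //.
by rewrite ltr_pdivrMr // ltr_pMr // ltr1n.
Qed.

(** The square is star-shaped about its corner: the value at [(s, t)] is the product of [th] along
    the straight segment from the corner, cut into [N] equal steps. *)
Lemma square_primitive (F : R -> R -> Y) :
  {within `[0, 1] `*` `[0, 1], continuous (fun z => F z.1 z.2)} ->
  exists (phi : R -> R -> R) (d : R), [/\ 0 < d, (forall s t, phi s t != 0) &
    forall s t s' t' : R, s \in `[0, 1] -> t \in `[0, 1] -> s' \in `[0, 1] ->
      t' \in `[0, 1] -> `|s' - s| < d -> `|t' - t| < d ->
      phi s' t' = phi s t * th (F s t) (F s' t')].
Proof.
move=> /uniform_cocycle[d d0 coc].
have d2 : 0 < d / 2 by rewrite divr_gt0.
(* A step along a radius and a sideways displacement are each shorter than [d / 2], so together they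
   stay within the range of [coc]. *)
pose N := (Num.truncn (d / 2)^-1).+1.
have Npos : 0 < N%:R :> R by rewrite ltr0n.
have N1 : (N%:R)^-1 < d / 2.
  rewrite -[ltRHS]invrK ltf_pV2 ?posrE ?invr_gt0 //.
  by rewrite truncnS_gt.
pose f k (s : R) := k%:R / N%:R * s.
pose G s t k := F (f k s) (f k t).
have kN k : (k <= N)%N -> 0 <= (k%:R : R) / N%:R <= 1.
  move=> kN; rewrite divr_ge0 ?ler0n //=.
  by rewrite ler_pdivrMr // mul1r ler_nat.
have f01 k s : (k <= N)%N -> s \in `[0, 1] -> f k s \in `[0, 1].
  rewrite !in_itv /= => /kN/andP[k0 k1] /andP[s0 s1].
  by rewrite /f mulr_ge0 // mulr_ile1.
have f1 k s s' : (k <= N)%N -> `|s' - s| < d / 2 -> `|f k s' - f k s| < d / 2.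
  move=> /kN/andP[k0 k1]; rewrite /f -mulrBr normrM ger0_norm //.
  by apply: le_lt_trans; rewrite ler_piMl.
have f2 k s s' : (k.+1 <= N)%N -> s' \in `[0, 1] -> `|s' - s| < d / 2 ->
    `|f k.+1 s' - f k s| < d.
  move=> kN1 s01 ss; rewrite [d]splitr.
  have -> : f k.+1 s' - f k s = (f k.+1 s' - f k s') + (f k s' - f k s) by ring.
  apply: (le_lt_trans (ler_normD _ _)); apply: ltrD; last by apply: f1 => //; exact: ltnW.
  rewrite /f -mulrBl -mulrBl -natrB // subSnn mul1r normrM ger0_norm ?invr_ge0 ?ler0n //.
  move: s01; rewrite in_itv /= => /andP[s0 s1].
  by apply: le_lt_trans N1; rewrite ger0_norm // ler_piMr // invr_ge0 ler0n.
have thxx s t : s \in `[0, 1] -> t \in `[0, 1] -> th (F s t) (F s t) = 1.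
  move=> s01 t01; apply: (mulfI (th_neq0 (F s t) (F s t))).
  by rewrite mulr1; apply: (coc s t); rewrite ?subrr ?normr0.
exists (fun s t => \prod_(k < N) th (G s t k) (G s t k.+1)), (d / 2); split => //.
  by move=> s t; apply/prodf_neq0 => k _.
move=> s t s' t' s01 t01 s'01 t'01 ss tt.
(* Ladder argument: the two subdivided radii are joined by rungs, and each quadrilateral between
   consecutive rungs contributes two uses of the local cocycle identity. *)
have ind m : (m <= N)%N ->
    (\prod_(k < m) th (G s t k) (G s t k.+1)) * th (G s t m) (G s' t' m)
    = \prod_(k < m) th (G s' t' k) (G s' t' k.+1).
  elim: m => [_|m IH mN].
    by rewrite !big_ord0 mul1r /G /f !(mul0r) thxx // in_itv /= lexx ler01.
  have mN' := ltnW mN.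
  rewrite !big_ord_recr /= -IH // -!mulrA; congr (_ * _).
  have dd : d / 2 < d by rewrite ltr_pdivrMr // ltr_pMr // ltr1n.
  have e0 x : `|x - x| < d / 2 by rewrite subrr normr0.
  rewrite (coc (f m s) (f m t)) ?(coc (f m s) (f m t)) //; try exact: f01; try exact: f2;
   by rewrite ?subrr ?normr0 //; apply: lt_trans dd; exact: f1.
have fN x : f N x = x by rewrite /f divff ?mul1r // gt_eqF.
by rewrite -(ind N) // /G !fN.
Qed.

Lemma path_primitive (F : R -> Y) : {within `[0, 1], continuous F} ->
  exists (phi : R -> R) (d : R), [/\ 0 < d, (forall t, phi t != 0) &
    forall t t' : R, t \in `[0, 1] -> t' \in `[0, 1] -> `|t' - t| < d ->
      phi t' = phi t * th (F t) (F t')].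
Proof.
move=> /within_continuousP cF.
have : {within `[0, 1] `*` `[0, 1], continuous (fun z : R * R => (fun=> F) z.1 z.2)}.
  apply/within_continuousP => -[s t] /= [s01 t01] O Ot.
  have /nbhs_ballP[e /= e0 he] := cF t t01 O Ot.
  apply/nbhs_ballP; exists e => //= -[s' t'] [_ /= bt] [_ /= t'01].
  exact: he.
move=> cF2; have [phi [d [d0 phi0 hphi]]] := @square_primitive (fun=> F) cF2.
have z01 : (0 : R) \in `[0, 1] by rewrite in_itv /= lexx ler01.
exists (phi 0), d; split => // t t' t01 t'01 tt.
by apply: hphi => //; rewrite subrr normr0.
Qed.
End Primitive.

(** * The hyperboloid model and disjoint geodesics *)

Notation i0 := (@Ordinal 3 0 isT).
Notation i1 := (@Ordinal 3 1 isT).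
Notation i2 := (@Ordinal 3 2 isT).

Lemma ord3P (i : 'I_3) : [\/ i = i0, i = i1 | i = i2].
Proof.
by case: i => -[|[|[|//]]] p; [apply: Or31|apply: Or32|apply: Or33]; exact: val_inj.
Qed.

Lemma ord_max3 : ord_max = i2 :> 'I_3. Proof. exact: val_inj. Qed.

Section Coordinates.
Context {R : realType}.
Local Notation V := 'cV[R]_3.
Implicit Types (x y z p q : V) (A B : 'M[R]_3).

Lemma sum3E (F : 'I_3 -> R) : \sum_(i < 3) F i = F i0 + F i1 + F i2.
Proof.
rewrite !big_ord_recr big_ord0 /= add0r.
by congr (F _ + F _ + F _); exact: val_inj.
Qed.

Lemma colP3 x y : x i0 0 = y i0 0 -> x i1 0 = y i1 0 -> x i2 0 = y i2 0 -> x = y.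
Proof. by move=> h0 h1 h2; apply/colP => i; case: (ord3P i) => ->. Qed.

Lemma lorentzE x y :
  lorentz x y = x i0 0 * y i0 0 + x i1 0 * y i1 0 - x i2 0 * y i2 0.
Proof.
rewrite /lorentz sum3E ord_max3 /= !(mul1r, mulN1r) /=.
by rewrite mulNr.
Qed.

Lemma det2E (N : 'M[R]_2) : \det N = N 0 0 * N 1 1 - N 0 1 * N 1 0.
Proof.
rewrite (expand_det_row _ 0) big_ord_recr big_ord1 /= /cofactor !det_mx11 !mxE.
have e0 : widen_ord (leqnSn 1) 0 = 0 by exact: val_inj.
have e1 : ord_max = 1 :> 'I_2 by exact: val_inj.
rewrite e0 e1.
have e2 : lift 0 (0 : 'I_1) = 1 :> 'I_2 by exact: val_inj.
have e3 : lift 1 (0 : 'I_1) = 0 :> 'I_2 by exact: val_inj.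
rewrite e2 e3 /= !(addn0, add0n) expr0 expr1.
by ring.
Qed.

Lemma vol3E x y z : vol3 x y z =
  x i0 0 * (y i1 0 * z i2 0 - y i2 0 * z i1 0)
  - y i0 0 * (x i1 0 * z i2 0 - x i2 0 * z i1 0)
  + z i0 0 * (x i1 0 * y i2 0 - x i2 0 * y i1 0).
Proof.
pose M : 'M[R]_3 := row_mx x (row_mx y z).
have e0 : i0 = lshift (1 + 1) (0 : 'I_1) :> 'I_(1 + (1 + 1)) by exact: val_inj.
have e1 : i1 = rshift 1 (lshift 1 (0 : 'I_1)) :> 'I_(1 + (1 + 1)) by exact: val_inj.
have e2 : i2 = rshift 1 (rshift 1 (0 : 'I_1)) :> 'I_(1 + (1 + 1)) by exact: val_inj.
have M0 i : M i i0 = x i 0 by rewrite e0; exact: row_mxEl.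
have M1 i : M i i1 = y i 0 
  by rewrite e1; apply: etrans (row_mxEr _ _ _ _) _; exact: row_mxEl.
have M2 i : M i i2 = z i 0 
  by rewrite e2; apply: etrans (row_mxEr _ _ _ _) _; exact: row_mxEr.
clear e0 e1 e2; rewrite /vol3 -/M; clearbody M.
rewrite (expand_det_row _ i0) sum3E /cofactor !det2E.
rewrite !(M0, M1, M2) !mxE.
have e00 : lift i0 (0 : 'I_2) = i1 by exact: val_inj.
have e01 : lift i0 (1 : 'I_2) = i2 by exact: val_inj.
have e10 : lift i1 (0 : 'I_2) = i0 by exact: val_inj.
have e11 : lift i1 (1 : 'I_2) = i2 by exact: val_inj.
have e20 : lift i2 (0 : 'I_2) = i0 by exact: val_inj.
have e21 : lift i2 (1 : 'I_2) = i1 by exact: val_inj.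
rewrite !(e00, e01, e10, e11, e20, e21) !(M0, M1, M2) /=.
rewrite !(addn0, add0n) !expr2 expr1 expr0.
by ring.
Qed.

Lemma vol3_lin x y p q (a b : R) :
  vol3 x y (a *: p + b *: q) = a * vol3 x y p + b * vol3 x y q.
Proof. by rewrite !vol3E !mxE; ring. Qed.

Lemma vol3_scale x y z (a b c : R) :
  vol3 (a *: x) (b *: y) (c *: z) = a * b * c * vol3 x y z.
Proof. by rewrite !vol3E !mxE; ring. Qed.

Lemma vol3_mulmx A x y z : vol3 (A *m x) (A *m y) (A *m z) = \det A * vol3 x y z.
Proof. by rewrite /vol3 -!mul_mx_row det_mulmx. Qed.

Lemma normc_le x i : `|x i 0| <= `|x|.
Proof.
rewrite [leRHS]/Num.norm /= mx_normrE.
by apply: le_trans (@le_bigmax _ _ _ _ (fun ij => `|x ij.1 ij.2|) (i, 0)).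
Qed.

Lemma norm_le3 x (e : R) : `|x i0 0| <= e -> `|x i1 0| <= e -> `|x i2 0| <= e ->
  `|x| <= e.
Proof.
move=> h0 h1 h2; rewrite [leLHS]/Num.norm /= mx_normrE; apply: bigmax_le.
  exact: le_trans h0.
move=> [i j] _ /=; rewrite (ord1 j).
by case: (ord3P i) => ->.
Qed.

Lemma bdHypP p : bdHyp p <-> p i2 0 = 1 /\ p i0 0 ^+ 2 + p i1 0 ^+ 2 = 1.
Proof.
rewrite /bdHyp /= ord_max3 lorentzE; split => -[h1 h2].
  split=> //; move: h1; rewrite h2; lra.
by split => //; rewrite h1; lra.
Qed.

Lemma HypP x : Hyp x <->
  0 < x i2 0 /\ x i0 0 ^+ 2 + x i1 0 ^+ 2 + 1 = x i2 0 ^+ 2.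
Proof.
rewrite /Hyp /= ord_max3 lorentzE; split => -[h1 h2]; split => //; lra.
Qed.

Lemma lorentz_bdHyp p q : bdHyp p -> bdHyp q ->
  - 2 * lorentz p q = (p i0 0 - q i0 0) ^+ 2 + (p i1 0 - q i1 0) ^+ 2.
Proof.
move=> /bdHypP[p2 hp] /bdHypP[q2 hq]; rewrite lorentzE p2 q2.
by rewrite !sqrrB; lra.
Qed.

Lemma lorentz_bdHyp_lt0 p q : bdHyp p -> bdHyp q -> p != q -> lorentz p q < 0.
Proof.
move=> bp bq pq.
have := lorentz_bdHyp bp bq.
have [e0|n0] := eqVneq (p i0 0) (q i0 0).
  have [e1|n1] := eqVneq (p i1 0) (q i1 0).
    have /bdHypP[p2 _] := bp; have /bdHypP[q2 _] := bq.
    by case/eqP: pq; apply: colP3; rewrite ?p2 ?q2.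
  have : 0 < (p i1 0 - q i1 0) ^+ 2 by rewrite exprn_even_gt0 // subr_eq0.
  have := sqr_ge0 (p i0 0 - q i0 0); lra.
have : 0 < (p i0 0 - q i0 0) ^+ 2 by rewrite exprn_even_gt0 // subr_eq0.
have := sqr_ge0 (p i1 0 - q i1 0); lra.
Qed.

Lemma lorentz_comb p q (a b : R) : bdHyp p -> bdHyp q ->
  lorentz (a *: p + b *: q) (a *: p + b *: q) = 2 * a * b * lorentz p q.
Proof.
move=> /bdHypP[p2 hp] /bdHypP[q2 hq]; rewrite !lorentzE !mxE p2 q2.
transitivity (a ^+ 2 * (p i0 0 ^+ 2 + p i1 0 ^+ 2 - 1)
  + b ^+ 2 * (q i0 0 ^+ 2 + q i1 0 ^+ 2 - 1)
  + 2 * a * b * (p i0 0 * q i0 0 + p i1 0 * q i1 0 - 1 * 1)); first by ring.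
by rewrite hp hq; ring.
Qed.

(** A point of the plane spanned by [p] and [q] is a combination with coefficients [a] and [b]. Its
    Lorentz norm [2ab<p,q>] is -1 with [<p,q>] negative, so [ab > 0], and the positive height
    [a + b] then makes both coefficients positive. *)
Lemma geodP p q x : bdHyp p -> bdHyp q -> p != q -> Hyp x ->
  geod (p, q) x <-> vol3 p q x = 0.
Proof.
move=> bp bq pq Hx; split.
  by move=> [_ [a [b [_ _ ->]]]]; rewrite /= !vol3E !mxE; ring.
move=> v0; split=> //=.
have lt0 := lorentz_bdHyp_lt0 bp bq pq.
have lE := lorentz_bdHyp bp bq.
have /bdHypP[p2 hp] := bp; have /bdHypP[q2 hq] := bq.
pose d := (p i0 0 - q i0 0) ^+ 2 + (p i1 0 - q i1 0) ^+ 2.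
have d0 : 0 < d by rewrite /d -lE; lra.
(* At the height of [x] the plane is cut in a line parallel to the chord; [a] is the coordinate
   along it, read off by Euclidean projection onto [p - q]. *)
pose a := ((x i0 0 - x i2 0 * q i0 0) * (p i0 0 - q i0 0)
   + (x i1 0 - x i2 0 * q i1 0) * (p i1 0 - q i1 0)) / d.
have v0' : (x i0 0 - x i2 0 * q i0 0) * (p i1 0 - q i1 0)
   = (x i1 0 - x i2 0 * q i1 0) * (p i0 0 - q i0 0).
  by move: v0; rewrite vol3E p2 q2 => v0; lra.
have ad : a * d = ((x i0 0 - x i2 0 * q i0 0) * (p i0 0 - q i0 0)
   + (x i1 0 - x i2 0 * q i1 0) * (p i1 0 - q i1 0)) by rewrite /a divfK // gt_eqF.
have xE : x = a *: p + (x i2 0 - a) *: q.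
  apply: colP3; rewrite !mxE ?p2 ?q2; last by ring.
    apply: (mulIf (lt0r_neq0 d0)).
    transitivity (x i2 0 * q i0 0 * d + (a * d) * (p i0 0 - q i0 0)); last by ring.
    rewrite ad /d.
    transitivity (x i2 0 * q i0 0 * ((p i0 0 - q i0 0) ^+ 2 + (p i1 0 - q i1 0) ^+ 2) +
      (x i0 0 - x i2 0 * q i0 0) * (p i0 0 - q i0 0) ^+ 2 
      + ((x i0 0 - x i2 0 * q i0 0) * (p i1 0 - q i1 0)) * (p i1 0 - q i1 0)); first by ring.
    by rewrite v0'; ring.
  apply: (mulIf (lt0r_neq0 d0)).
  transitivity (x i2 0 * q i1 0 * d + (a * d) * (p i1 0 - q i1 0)); last by ring.
  rewrite ad /d.
  transitivity (x i2 0 * q i1 0 * ((p i0 0 - q i0 0) ^+ 2 + (p i1 0 - q i1 0) ^+ 2) +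
      (x i1 0 - x i2 0 * q i1 0) * (p i1 0 - q i1 0) ^+ 2 
      + ((x i1 0 - x i2 0 * q i1 0) * (p i0 0 - q i0 0)) * (p i0 0 - q i0 0)); first by ring.
  by rewrite -v0'; ring.
have := lorentz_comb a (x i2 0 - a) bp bq; rewrite -xE.
have [-> x2] : lorentz x x = -1 /\ 0 < x i2 0 by case: Hx; rewrite ord_max3.
set b := x i2 0 - a in xE * => h.
have ab : 0 < a * b by nra.
have abx : a + b = x i2 0 by rewrite /b; ring.
by exists a, b; split=> //; nra.
Qed.

Lemma geod_grev (g : V * V) : geod (grev g) = geod g.
Proof.
apply/seteqP; split => x [Hx [a [b [a0 b0 xE]]]]; (split; first exact: Hx);
by exists b, a; split; rewrite // xE addrC.
Qed.

Lemma grevK (g : V * V) : grev (grev g) = g. Proof. by case: g. Qed.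
End Coordinates.

Lemma mulmx_norm_le (R : realType) m n p (A : 'M[R]_(m, n)) (B : 'M[R]_(n, p)) :
  `|A *m B| <= n%:R * `|A| * `|B|.
Proof.
have nle m' n' (M : 'M[R]_(m', n')) i j : `|M i j| <= `|M|.
  rewrite [leRHS]/Num.norm /= mx_normrE.
  exact: (@le_bigmax _ _ _ _ (fun ij => `|M ij.1 ij.2|) (i, j)).
rewrite [leLHS]/Num.norm /= mx_normrE; apply: bigmax_le => [|[i j] _ /=].
  by rewrite !mulr_ge0.
rewrite mxE (le_trans (ler_norm_sum _ _ _)) //.
apply: (@le_trans _ _ (\sum_(k < n) `|A| * `|B|)).
  by apply: ler_sum => k _; rewrite normrM ler_pM.
by rewrite sumr_const card_ord -[leLHS]mulr_natl -mulrA.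
Qed.

Section Isometry.
Context {R : realType}.
Local Notation V := 'cV[R]_3.
Implicit Types (x y z p q : V) (A B : 'M[R]_3) (g h : V * V).

Definition hyp_isom A :=
  [/\ forall x y, lorentz (A *m x) (A *m y) = lorentz x y,
             \det A = 1 &
             forall x, Hyp x -> Hyp (A *m x)].

Lemma hyp_isom_unit A : hyp_isom A -> A \in unitmx.
Proof. by case=> _ d _; rewrite unitmxE d unitr1. Qed.

(** An isometry of the upper sheet preserves the future light cone. The image of [p] has pairing -1
    with the image of the base point [o], and by Cauchy-Schwarz a null vector of nonpositive height
    cannot pair negatively with a point of the upper sheet. *)
Lemma bd_height A p : hyp_isom A -> bdHyp p -> 0 < (A *m p) i2 0.
Proof.
move=> [iA _ HA] bp.
pose o : V := \col_i (if i == i2 then 1 else 0).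
have Ho : Hyp o by apply/HypP; rewrite !mxE /=; split=> //; ring.
have := iA p o; have /HypP[] := HA o Ho.
move: (A *m o) => z z0 hz.
have := iA p p; have -> : lorentz p p = 0 by case: bp.
have /bdHypP[p2 _] := bp.
have [ho0 ho1 ho2] : [/\ o i0 0 = 0, o i1 0 = 0 & o i2 0 = 1] by rewrite !mxE.
rewrite !lorentzE ho0 ho1 ho2 p2 !mulr0 !addr0 mulr1 sub0r.
move: (A *m p) => n; move: (n i0 0) (n i1 0) (n i2 0) => n0 n1 n2 hn hz'.
rewrite ltNge; apply/negP => n2le.
set u := n0 * z i0 0 + n1 * z i1 0 in hz'.
(* Lagrange's identity, with the two squared Euclidean lengths replaced using the null cone and the
   hyperboloid. *)
have hu : u ^+ 2 = n2 ^+ 2 * (z i2 0 ^+ 2 - 1) - (n0 * z i1 0 - n1 * z i0 0) ^+ 2.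
  have -> : n2 ^+ 2 = n0 ^+ 2 + n1 ^+ 2 by rewrite !expr2; lra.
  by rewrite -hz /u; ring.
have h1 : u < n2 * z i2 0 by lra.
have h2 : n2 * z i2 0 <= 0 by rewrite mulr_le0_ge0 // ltW.
have : (n2 * z i2 0) ^+ 2 < u ^+ 2.
  by rewrite -(sqrrN u) -(sqrrN (n2 * _)) ltr_pXn2r // ?nnegrE; lra.
rewrite hu exprMn.
have := sqr_ge0 n2; have := sqr_ge0 (n0 * z i1 0 - n1 * z i0 0); lra.
Qed.

Lemma bd_actE A p : A *m p = (A *m p) i2 0 *: bd_act A p \/ (A *m p) i2 0 = 0.
Proof.
have [->|n0] := eqVneq ((A *m p) i2 0) 0; first by right.
by left; rewrite /bd_act ord_max3 scalerA divff // scale1r.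
Qed.

Lemma bd_act_scale A p : hyp_isom A -> bdHyp p ->
  exists2 c : R, 0 < c & A *m p = c *: bd_act A p.
Proof.
move=> iA bp; have h := bd_height iA bp; exists ((A *m p) i2 0) => //.
by case: (bd_actE A p) => // e; rewrite e ltxx in h.
Qed.

Lemma bd_act_bd A p : hyp_isom A -> bdHyp p -> bdHyp (bd_act A p).
Proof.
move=> iA bp; have h := bd_height iA bp.
have [l _ _] := iA; have lp := l p p; have lpp : lorentz p p = 0 by case: bp.
rewrite lpp lorentzE in lp; apply/bdHypP; rewrite /bd_act ord_max3.
move: (A *m p) h lp => y h lp; rewrite !mxE mulVf ?gt_eqF //; split=> //.
rewrite !exprMn -mulrDr.
have -> : y i0 0 ^+ 2 + y i1 0 ^+ 2 = y i2 0 ^+ 2 by rewrite !expr2; lra.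
by rewrite -exprMn mulVf ?expr1n // gt_eqF.
Qed.

Lemma bd_actM A B p : hyp_isom B -> bdHyp p ->
  bd_act A (bd_act B p) = bd_act (A *m B) p.
Proof.
move=> iB bp; have := bd_height iB bp.
rewrite /bd_act ord_max3 -mulmxA; set y := B *m p => h.
rewrite -scalemxAr [in X in X^-1]mxE scalerA; congr (_ *: _).
by rewrite invfM invrK mulrAC divff ?mul1r // gt_eqF.
Qed.

Lemma bd_act1 p : bdHyp p -> bd_act 1%:M p = p.
Proof. by move=> /bdHypP[p2 _]; rewrite /bd_act ord_max3 mul1mx p2 invr1 scale1r. Qed.

Lemma geod_actP A g x : hyp_isom A -> bdHyp g.1 -> bdHyp g.2 ->
  geod g x -> geod (geod_act A g) (A *m x).
Proof.
move=> iA b1 b2 [Hx [a [b [a0 b0 xE]]]].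
have [c1 c10 e1] := bd_act_scale iA b1; have [c2 c20 e2] := bd_act_scale iA b2.
split; first by case: iA => _ _; exact.
exists (a * c1), (b * c2); rewrite !mulr_gt0 //; split=> //.
by rewrite xE mulmxDr -!scalemxAr e1 e2 !scalerA.
Qed.

Lemma geod_act_grev A g : geod_act A (grev g) = grev (geod_act A g).
Proof. by []. Qed.

Lemma vol3_act A p q x : hyp_isom A -> bdHyp p -> bdHyp q ->
  exists2 c : R, 0 < c & forall x,
    vol3 (bd_act A p) (bd_act A q) (A *m x) = c * vol3 p q x.
Proof.
move=> iA bp bq; have hp := bd_height iA bp; have hq := bd_height iA bq.
exists (((A *m p) i2 0)^-1 * ((A *m q) i2 0)^-1).
  by rewrite mulr_gt0 ?invr_gt0.
move=> y; rewrite /bd_act ord_max3 -[A *m y]scale1r vol3_scale mulr1.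
by rewrite vol3_mulmx; case: iA => _ -> _; rewrite mul1r.
Qed.

Lemma bdHyp_norm p : bdHyp p -> `|p| <= 1.
Proof.
move=> /bdHypP[p2 h]; apply: norm_le3; last by rewrite p2 normr1.
  by rewrite -(@expr_le1 _ 2) // real_normK ?num_real //; have := sqr_ge0 (p i1 0); lra.
by rewrite -(@expr_le1 _ 2) // real_normK ?num_real //; have := sqr_ge0 (p i0 0); lra.
Qed.

(** Normalizing by the height is Lipschitz because the heights of the images are bounded below: [p]
    has height 1 and is recovered from its normalized image by [invmx A] and this height. *)
Lemma bd_act_lipschitz A : hyp_isom A -> hyp_isom (invmx A) ->
  exists2 C : R, 0 < C & forall p q, bdHyp p -> bdHyp q ->
    `|bd_act A p - bd_act A q| <= C * `|p - q|.
Proof.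
move=> iA iA'.
pose M : R := 3 * `|invmx A|; pose N : R := 3 * `|A|.
have M0 : 0 <= M by rewrite mulr_ge0.
have N0 : 0 <= N by rewrite mulr_ge0.
have hM p : bdHyp p -> ((A *m p) i2 0)^-1 <= M.
  move=> bp; have h := bd_height iA bp.
  have [c c0 e] := bd_act_scale iA bp.
  have ce : (A *m p) i2 0 = c.
    by rewrite e mxE; have /bdHypP[-> _] := bd_act_bd iA bp; rewrite mulr1.
  rewrite ce -(mul1r (c^-1)) ler_pdivrMr //.
  have -> : 1 = `|p i2 0| by have /bdHypP[-> _] := bp; rewrite normr1.
  apply: le_trans (normc_le _ _) _.
  rewrite -[p](mulKmx (hyp_isom_unit iA)) e -scalemxAr normrZ gtr0_norm // mulrC.
  apply: ler_wpM2r; first exact: ltW.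
  apply: le_trans (mulmx_norm_le _ _) _; rewrite -/M ler_piMr //.
  exact: bdHyp_norm (bd_act_bd iA bp).
exists (2 * M * N + 1); first by rewrite ltr_wpDl // !mulr_ge0.
move=> p q bp bq.
have hp := bd_height iA bp; have hq := bd_height iA bq.
have -> : bd_act A p - bd_act A q = ((A *m p) i2 0)^-1 *: (A *m (p - q))
   - (((A *m p) i2 0)^-1 * (A *m (p - q)) i2 0) *: bd_act A q.
  have -> : (A *m (p - q)) i2 0 = (A *m p) i2 0 - (A *m q) i2 0.
    by rewrite mulmxBr !mxE.
  rewrite mulrBr mulVf ?gt_eqF // /bd_act ord_max3 mulmxBr scalerBr scalerBl scale1r.
  rewrite scalerA -mulrA divff ?gt_eqF // mulr1.
  by rewrite opprB addrA subrK.
have pq0 : `|A *m (p - q)| <= N * `|p - q| by exact: mulmx_norm_le.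
apply: le_trans (ler_normB _ _) _; rewrite normrZ [X in _ + X]normrZ.
have i0' : 0 < ((A *m p) i2 0)^-1 by rewrite invr_gt0.
have k1 : `|((A *m p) i2 0)^-1| * `|A *m (p - q)| <= M * (N * `|p - q|).
  by rewrite ler_pM //  gtr0_norm // hM.
have k2 : `|((A *m p) i2 0)^-1 * (A *m (p - q)) i2 0| * `|bd_act A q| <= M * (N * `|p - q|).
  rewrite -[leRHS]mulr1; apply: ler_pM => //; last exact: bdHyp_norm (bd_act_bd iA bq).
  rewrite normrM; apply: ler_pM => //; first by rewrite gtr0_norm // hM.
  exact: le_trans (normc_le _ _) pq0.
apply: (le_trans (lerD k1 k2)).
rewrite mulrDl mul1r -[leLHS]addr0; apply: lerD => //.
by rewrite le_eqVlt; apply/orP; left; apply/eqP; ring.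
Qed.
End Isometry.

Section Leaves.
Context {R : realType}.
Local Notation V := 'cV[R]_3.
Implicit Types (x y z p q : V) (g h : V * V).

Definition ideal g := [/\ bdHyp g.1, bdHyp g.2 & g.1 != g.2].

Lemma vol3Z x y z (c : R) : vol3 x y (c *: z) = c * vol3 x y z.
Proof. by rewrite !vol3E !mxE; ring. Qed.

Lemma geod_coef g x : ideal g -> geod g x -> exists a b : R,
  [/\ 0 < a, 0 < b, x = a *: g.1 + b *: g.2, a + b = x i2 0 &
      a * b * ((g.1 i0 0 - g.2 i0 0) ^+ 2 + (g.1 i1 0 - g.2 i1 0) ^+ 2) = 1].
Proof.
move=> [b1 b2 n] [Hx [a [b [a0 b0 xE]]]].
exists a, b; split => //.
  by rewrite xE !mxE; have /bdHypP[-> _] := b1; have /bdHypP[-> _] := b2; rewrite !mulr1.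
rewrite -lorentz_bdHyp //.
have := lorentz_comb a b b1 b2; rewrite -xE.
have [-> _] : lorentz x x = -1 /\ 0 < x ord_max 0 by exact: Hx.
lra.
Qed.

(** If the endpoints of [g] were strictly on opposite sides of [h], the combination weighted by the
    distances to the plane of [h] would be timelike; rescaled to the hyperboloid, it would be a
    common point. *)
Lemma geod_disjoint_sides g h : ideal g -> ideal h ->
  (forall z, geod g z -> geod h z -> False) ->
  0 <= vol3 h.1 h.2 g.1 * vol3 h.1 h.2 g.2.
Proof.
move=> ig [h1 h2 hn] dis; rewrite leNgt; apply/negP.
set A := vol3 _ _ g.1; set B := vol3 _ _ g.2 => AB.
have A0 : A != 0 by apply: contraTneq AB => ->; rewrite mul0r ltxx.
have B0 : B != 0 by apply: contraTneq AB => ->; rewrite mulr0 ltxx.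
pose w := `|B| *: g.1 + `|A| *: g.2.
have [b1 b2 n] := ig.
have lw : lorentz w w < 0.
  rewrite lorentz_comb // pmulr_rlt0 ?lorentz_bdHyp_lt0 //.
  by rewrite !mulr_gt0 ?normr_gt0.
pose c := (Num.sqrt (- lorentz w w))^-1.
have c0 : 0 < c by rewrite invr_gt0 sqrtr_gt0 oppr_gt0.
have Hz : Hyp (c *: w).
  apply/HypP; have /bdHypP[p2 _] := b1; have /bdHypP[q2 _] := b2.
  have c2 : c ^+ 2 * lorentz w w = -1.
    rewrite /c exprVn sqr_sqrtr ?oppr_ge0 ?ltW //.
    by rewrite invrN mulNr mulVf // lt_eqF.
  split.
    by rewrite !mxE p2 q2 !mulr1 mulr_gt0 // addr_gt0 ?normr_gt0.
  rewrite lorentzE in c2; rewrite !mxE in c2 *; rewrite !exprMn; lra.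
apply: (dis (c *: w)).
  split=> //; exists (c * `|B|), (c * `|A|).
  by rewrite !mulr_gt0 ?normr_gt0 // /w scalerDr !scalerA; split.
rewrite (surjective_pairing h); apply/geodP => //.
rewrite vol3Z /w vol3_lin -/A -/B.
have [A1|A1] := ltP 0 A.
  have B1 : B < 0 by rewrite pmulr_rlt0 in AB.
  by rewrite (gtr0_norm A1) (ltr0_norm B1); ring.
have {}A1 : A < 0 by rewrite lt_neqAle A0.
have B1 : 0 < B by rewrite nmulr_rlt0 in AB.
by rewrite (ltr0_norm A1) (gtr0_norm B1); ring.
Qed.

Lemma geod_same_side g h x x' : ideal g -> ideal h ->
  (forall z, geod g z -> geod h z -> False) -> geod g x -> geod g x' ->
  0 < vol3 h.1 h.2 x * vol3 h.1 h.2 x'.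
Proof.
move=> ig ih dis gx gx'.
have nz z : geod g z -> vol3 h.1 h.2 z != 0.
  move=> gz; apply/eqP => v0; apply: (dis z gz).
  case: ih => h1 h2 hn; rewrite (surjective_pairing h); apply/geodP => //.
  by case: gz.
rewrite lt_neqAle eq_sym mulf_neq0 ?nz //=.
have := geod_disjoint_sides ig ih dis.
have [a [b [a0 b0 -> _ _]]] := geod_coef ig gx.
have [a' [b' [a'0 b'0 -> _ _]]] := geod_coef ig gx'.
rewrite !vol3_lin; set A := vol3 _ _ g.1; set B := vol3 _ _ g.2 => AB.
have -> : (a * A + b * B) * (a' * A + b' * B)
   = a * a' * A ^+ 2 + b * b' * B ^+ 2 + (a * b' + b * a') * (A * B) by ring.
have pm (u v : R) : 0 < u -> 0 < v -> 0 <= u * v by move=> *; rewrite mulr_ge0 ?ltW.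
apply: addr_ge0; first apply: addr_ge0.
- by apply: mulr_ge0; [exact: pm|exact: sqr_ge0].
- by apply: mulr_ge0; [exact: pm|exact: sqr_ge0].
- by apply: mulr_ge0 => //; apply: addr_ge0; exact: pm.
Qed.

Lemma gram_bdHyp p q r : bdHyp p -> bdHyp q -> bdHyp r ->
  4 * vol3 p q r ^+ 2 =
  ((p i0 0 - q i0 0) ^+ 2 + (p i1 0 - q i1 0) ^+ 2) *
  (((p i0 0 - r i0 0) ^+ 2 + (p i1 0 - r i1 0) ^+ 2) *
   ((q i0 0 - r i0 0) ^+ 2 + (q i1 0 - r i1 0) ^+ 2)).
Proof.
move=> /bdHypP[p2 hp] /bdHypP[q2 hq] /bdHypP[r2 hr].
have e (x y x' y' : R) : x ^+ 2 + y ^+ 2 = 1 -> x' ^+ 2 + y' ^+ 2 = 1 ->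
    (x - x') ^+ 2 + (y - y') ^+ 2 = 2 * (1 - (x * x' + y * y')).
  by move=> h h'; rewrite !sqrrB; lra.
rewrite (e _ _ _ _ hp hq) (e _ _ _ _ hp hr) (e _ _ _ _ hq hr).
rewrite vol3E p2 q2 r2 !mulr1 !mul1r.
move: (p i0 0) (p i1 0) (q i0 0) (q i1 0) (r i0 0) (r i1 0) hp hq hr.
move=> a b c d u v hp hq hr.
(* the Gram determinant of the Lorentz form *)
have -> : (a * (d - v) - c * (b - v) + u * (b - d)) ^+ 2 =
  - 2 * (a * c + b * d - 1) * (a * u + b * v - 1) * (c * u + d * v - 1)
  - (a ^+ 2 + b ^+ 2 - 1) * (c ^+ 2 + d ^+ 2 - 1) * (u ^+ 2 + v ^+ 2 - 1)
  + (a ^+ 2 + b ^+ 2 - 1) * (c * u + d * v - 1) ^+ 2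
  + (c ^+ 2 + d ^+ 2 - 1) * (a * u + b * v - 1) ^+ 2
  + (u ^+ 2 + v ^+ 2 - 1) * (a * c + b * d - 1) ^+ 2 by ring.
rewrite hp hq hr subrr; ring.
Qed.

Lemma vol3_bound p q x : bdHyp p -> bdHyp q -> `|vol3 p q x| <= 6 * `|x|.
Proof.
move=> bp bq.
have le1 y i : bdHyp y -> `|y i 0| <= 1.
  by move=> /bdHyp_norm; apply: le_trans; exact: normc_le.
have m (a b c : R) : `|a| <= 1 -> `|b| <= 1 -> `|c| <= `|x| -> `|a * b * c| <= `|x|.
  by move=> ha hb hc; rewrite !normrM -[leRHS]mul1r ler_pM // ?mulr_ge0 // mulr_ile1.
have -> : vol3 p q x = p i0 0 * q i1 0 * x i2 0 - p i0 0 * q i2 0 * x i1 0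
  - q i0 0 * p i1 0 * x i2 0 + q i0 0 * p i2 0 * x i1 0
  + p i1 0 * q i2 0 * x i0 0 - p i2 0 * q i1 0 * x i0 0 by rewrite vol3E; ring.
have -> : 6 * `|x| = `|x| + `|x| + `|x| + `|x| + `|x| + `|x| by ring.
do 5? (apply: le_trans (ler_normD _ _) _; rewrite ?normrN; apply: lerD).
all: by apply: m; rewrite ?le1 ?normc_le.
Qed.

(* The two ideal endpoints of [h] are close to the plane spanned by [g], hence,
   by the Gram identity, to the endpoints of [g]. *)
Lemma leaf_endpoint_close (M : R) g h x y : ideal g -> ideal h ->
  (forall z, geod g z -> geod h z -> False) ->
  geod g x -> geod h y -> x i2 0 <= M -> y i2 0 <= M -> 1 <= M ->
  forall p, p = h.1 \/ p = h.2 ->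
   `|p - g.1| <= 24 * M ^+ 3 * `|x - y| \/ `|p - g.2| <= 24 * M ^+ 3 * `|x - y|.
Proof.
move=> ig ih dis gx hy xM yM M1.
have dis' z : geod h z -> geod g z -> False by move=> hz gz; exact: dis gz hz.
have AB := geod_disjoint_sides ih ig dis'.
have [a [b [a0 b0 xE abM abd]]] := geod_coef ig gx.
have [c [d [c0 d0 yE cdM cdd]]] := geod_coef ih hy.
have [g1 g2 gn] := ig; have [h1 h2 hn] := ih.
set D := `|x - y|; have D0 : 0 <= D by exact: normr_ge0.
have M0 : 0 < M by exact: lt_le_trans M1.
have vy : `|vol3 g.1 g.2 y| <= 6 * D.
  have -> : vol3 g.1 g.2 y = vol3 g.1 g.2 (y - x).
    have v0 : vol3 g.1 g.2 x = 0.
      by apply/geodP => //; rewrite -?surjective_pairing //; case: gx.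
    have -> : y - x = 1 *: y + (-1) *: x by rewrite scale1r scaleN1r.
    by rewrite vol3_lin v0; ring.
  by rewrite /D distrC; exact: vol3_bound.
have le4 q q' : bdHyp q -> bdHyp q' ->
    (q i0 0 - q' i0 0) ^+ 2 + (q i1 0 - q' i1 0) ^+ 2 <= 4.
  move=> /bdHypP[_ hq] /bdHypP[_ hq'].
  have := sqr_ge0 (q i0 0 + q' i0 0); have := sqr_ge0 (q i1 0 + q' i1 0).
  rewrite !sqrrB !sqrrD; lra.
(* The chord joining two ideal points has squared length at most 4, and its product with [c * d] is
   1. As [c] and [d] are at most [M], neither is below [1 / (4 * M)]. *)
have cd4 : 1 <= 4 * (c * d).
  have cd0 : 0 <= c * d by rewrite mulr_ge0 // ltW.
  by have := ler_wpM2l cd0 (le4 _ _ h1 h2); rewrite cdd mulrC.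
have c4 : 1 <= 4 * M * c.
  by apply: (le_trans cd4); rewrite -mulrA (mulrC c) ler_wpM2l // ler_wpM2r ?ltW //; lra.
have d4 : 1 <= 4 * M * d.
  by apply: (le_trans cd4); rewrite -mulrA ler_wpM2l // ler_wpM2r ?ltW //; lra.
have vh : `|vol3 g.1 g.2 h.1| <= 24 * M * D /\ `|vol3 g.1 g.2 h.2| <= 24 * M * D.
  move: vy; rewrite yE vol3_lin.
  set A := vol3 _ _ h.1 in AB *; set B := vol3 _ _ h.2 in AB *.
  (* Since the endpoints of [h] are not on opposite sides of [g], nothing cancels, and the smallness
     of the sum bounds each term. *)
  have -> : `|c * A + d * B| = c * `|A| + d * `|B|.
    have [A1|A1] := lerP 0 A.
      have [->|An] := eqVneq A 0; first by rewrite !mulr0 !add0r normr0 mulr0 add0r normrM (gtr0_norm d0).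
      have B1 : 0 <= B by rewrite pmulr_rge0 ?lt_neqAle 1?eq_sym ?An in AB.
      by rewrite ger0_norm ?addr_ge0 ?mulr_ge0 // ?(ger0_norm A1) ?(ger0_norm B1) // ltW.
    have B1 : B <= 0 by rewrite nmulr_rge0 in AB.
    rewrite ler0_norm ?(ltr0_norm A1) ?(ler0_norm B1); first by ring.
    have n1 : c * A <= 0 by apply: mulr_ge0_le0; exact: ltW.
    have n2 : d * B <= 0 by apply: mulr_ge0_le0 => //; exact: ltW.
    by lra.
  move=> h6.
  have cA : c * `|A| <= 6 * D by apply: le_trans h6; rewrite lerDl mulr_ge0 // ltW.
  have dB : d * `|B| <= 6 * D by apply: le_trans h6; rewrite lerDr mulr_ge0 // ltW.
  have k (e E : R) : 0 < e -> 1 <= 4 * M * e -> e * `|E| <= 6 * D -> `|E| <= 24 * M * D.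
    move=> e0 e4 eE; apply: (@le_trans _ _ (4 * M * e * `|E|)).
      by rewrite ler_peMl.
    have M4 : 0 <= 4 * M by rewrite mulr_ge0 // ltW.
    by have := ler_wpM2l M4 eE; lra.
  by split; [exact: (k c)|exact: (k d)].
move=> p pE.
have bp : bdHyp p by case: pE => ->.
have vp : `|vol3 g.1 g.2 p| <= 24 * M * D by case: pE => ->; case: vh.
have := gram_bdHyp g1 g2 bp.
set dg := (_ + _) in abd *.
set d1 := (X in _ * (X * _)); set d2 := (X in _ * (_ * X)) => gram.
have d10 : 0 <= d1 by rewrite addr_ge0 ?sqr_ge0.
have d20 : 0 <= d2 by rewrite addr_ge0 ?sqr_ge0.
have dgM : 4 <= M ^+ 2 * dg.
  have ab : 4 * (a * b) <= M ^+ 2.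
    have abx : a + b <= M by rewrite abM.
  have ab0 : 0 <= a + b by rewrite addr_ge0 // ltW.
  apply: (@le_trans _ _ ((a + b) ^+ 2)); last by rewrite ler_pXn2r ?nnegrE // ltW.
    by have := sqr_ge0 (a - b); rewrite sqrrB sqrrD; lra.
  have dg0 : 0 <= dg by rewrite addr_ge0 ?sqr_ge0.
  have := ler_wpM2r dg0 ab; rewrite -mulrA abd; lra.
have dgle : dg <= 2 * (d1 + d2).
  rewrite /dg /d1 /d2.
  have q (u v w : R) : (u - v) ^+ 2 <= 2 * ((u - w) ^+ 2 + (v - w) ^+ 2).
    by have := sqr_ge0 ((u - w) + (v - w)); rewrite !expr2; lra.
  have := q (g.1 i0 0) (g.2 i0 0) (p i0 0); have := q (g.1 i1 0) (g.2 i1 0) (p i1 0).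
  lra.
have d12 : dg * (d1 * d2) <= 4 * (24 * M * D) ^+ 2.
  rewrite -gram ler_wpM2l // -[leLHS]real_normK ?num_real //.
  by rewrite ler_pXn2r ?nnegrE //; apply: le_trans vp.
have M2 : 0 < M ^+ 2 by rewrite exprn_gt0.
have d12' : d1 * d2 <= M ^+ 2 * (24 * M * D) ^+ 2.
  have e1 : 4 * (d1 * d2) <= M ^+ 2 * (dg * (d1 * d2)).
    by have := ler_wpM2r (mulr_ge0 d10 d20) dgM; rewrite -mulrA.
  have e2 : M ^+ 2 * (dg * (d1 * d2)) <= M ^+ 2 * (4 * (24 * M * D) ^+ 2).
    by rewrite ler_wpM2l // ltW.
  have := le_trans e1 e2; lra.
(* whichever endpoint of [g] is far from [p], the other one is close *)
have fin (e e' : R) (q : V) : bdHyp q -> 0 <= e -> 1 <= M ^+ 2 * e' ->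
   e * e' <= M ^+ 2 * (24 * M * D) ^+ 2 ->
   e = (q i0 0 - p i0 0) ^+ 2 + (q i1 0 - p i1 0) ^+ 2 ->
   `|p - q| <= 24 * M ^+ 3 * D.
  move=> /bdHypP[q2 _] e_ge0 e'1 ee' eE.
  have le_e : e <= (24 * M ^+ 3 * D) ^+ 2.
    apply: (@le_trans _ _ (M ^+ 2 * (e * e'))).
      by rewrite mulrCA ler_peMr.
    apply: (le_trans (ler_wpM2l (ltW M2) ee')).
    by rewrite le_eqVlt; apply/orP; left; apply/eqP; ring.
  have K0 : 0 <= 24 * M ^+ 3 * D by rewrite !mulr_ge0 // ltW.
  have sq (u : R) : u ^+ 2 <= e -> `|u| <= 24 * M ^+ 3 * D.
    move=> ue; rewrite -(@ler_pXn2r _ 2) ?nnegrE // real_normK ?num_real //.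
    exact: le_trans le_e.
  have /bdHypP[p2 _] := bp.
  apply: norm_le3; rewrite !mxE.
  - by rewrite distrC sq // eE lerDl sqr_ge0.
  - by rewrite distrC sq // eE lerDr sqr_ge0.
  - by rewrite p2 q2 subrr normr0.
have : 2 <= M ^+ 2 * (d1 + d2).
  by have := ler_wpM2l (ltW M2) dgle; lra.
have [l|l] := lerP 1 (M ^+ 2 * d2).
  by move=> _; left; apply: (fin d1 d2).
move=> l2; right; apply: (fin d2 d1) => //; last by rewrite mulrC.
by move: l2; rewrite mulrDr; lra.
Qed.

(** The product of the coefficients and the squared chord is 1, while by the arithmetic-geometric
    inequality the product of the coefficients is at most [M ^+ 2 / 4]. *)
Lemma ideal_gap (M : R) g x : ideal g -> geod g x -> x i2 0 <= M -> 1 <= M ->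
  1 <= M * `|g.1 - g.2|.
Proof.
move=> ig gx xM M1.
have [a [b [a0 b0 _ abM abd]]] := geod_coef ig gx.
have M0 : 0 < M by exact: lt_le_trans M1.
set D := `|g.1 - g.2|; have D0 : 0 <= D by exact: normr_ge0.
have ab : 4 * (a * b) <= M ^+ 2.
  have abx : a + b <= M by rewrite abM.
  have ab0 : 0 <= a + b by rewrite addr_ge0 // ltW.
  apply: (@le_trans _ _ ((a + b) ^+ 2)); last by rewrite ler_pXn2r ?nnegrE // ltW.
  by have := sqr_ge0 (a - b); rewrite sqrrB sqrrD; lra.
have sq i : (g.1 i 0 - g.2 i 0) ^+ 2 <= D ^+ 2.
  rewrite -[leLHS]real_normK ?num_real // ler_pXn2r ?nnegrE //.
  by have := normc_le (g.1 - g.2) i; rewrite !mxE.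
have : 4 <= M ^+ 2 * (2 * D ^+ 2).
  set dg := (_ + _) in abd.
  have dg0 : 0 <= dg by rewrite addr_ge0 ?sqr_ge0.
  have e1 := ler_wpM2r dg0 ab.
  have e2 : M ^+ 2 * dg <= M ^+ 2 * (2 * D ^+ 2).
    apply: ler_wpM2l; first by rewrite sqr_ge0.
    by rewrite /dg; have := sq i0; have := sq i1; lra.
  rewrite -mulrA abd in e1; lra.
move=> h; rewrite -(@ler_pXn2r _ 2) ?nnegrE ?mulr_ge0 // ?(ltW M0) // expr1n exprMn.
lra.
Qed.

(** The alternative in the conclusion is the choice of orientation of [h]. Each endpoint of [h] is
    close to one of [g]; when the two are close to different ones, this is the estimate itself. *)
Lemma leaves_lipschitz (M : R) : 1 <= M -> exists2 C : R, 0 < C &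
  forall g h x y, ideal g -> ideal h ->
  (forall z, geod g z -> geod h z -> h = g \/ h = grev g) ->
  geod g x -> geod h y -> x i2 0 <= M -> y i2 0 <= M ->
  `|h - g| <= C * `|x - y| \/ `|grev h - g| <= C * `|x - y|.
Proof.
move=> M1; pose C : R := 24 * M ^+ 3.
have M0 : 0 < M by exact: lt_le_trans M1.
have M3 : 0 < M ^+ 3 by rewrite exprn_gt0.
have C0 : 0 < C by rewrite mulr_gt0.
exists (4 * M * C); first by rewrite !mulr_gt0.
move=> g h x y ig ih meet gx hy xM yM.
set D := `|x - y|; have D0 : 0 <= D by exact: normr_ge0.
have [[z [gz hz]]|dis] := pselect (exists z, geod g z /\ geod h z).
  have nn : 0 <= 4 * M * C * D by rewrite !mulr_ge0 // ltW.
  case: (meet z gz hz) => ->; [left|right]; by rewrite ?grevK subrr normr0.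
have dis' z : geod g z -> geod h z -> False by move=> gz hz; apply: dis; exists z.
have close := leaf_endpoint_close ig ih dis' gx hy xM yM M1; rewrite -/C -/D in close.
have CC : C * D <= 4 * M * C * D.
  have CD0 : 0 <= C * D by rewrite mulr_ge0 // ltW.
  have M41 : 1 <= 4 * M by lra.
  by have := ler_wpM2r CD0 M41; rewrite mul1r !mulrA.
have prodn (u v : V * V) (e : R) : `|u.1 - v.1| <= e -> `|u.2 - v.2| <= e -> `|u - v| <= e.
  by move=> h1 h2; rewrite prod_normE ge_max h1 h2.
have gap := ideal_gap ih hy yM M1.
have [g1 g2 _] := ig; have [h1 h2 _] := ih.
(* Both endpoints of [h] near the same [q]: by [gap] the points [x] and [y] are then far apart, and
   the bound holds because ideal points have norm at most 1. *)
have far q : `|h.1 - q| <= C * D -> `|h.2 - q| <= C * D -> `|h - g| <= 4 * M * C * D.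
  move=> l1 l2.
  have l3 : `|h.1 - h.2| <= 2 * (C * D).
    by have := ler_distD q h.1 h.2; rewrite (distrC q); lra.
  have l4 : 2 <= 4 * M * C * D.
    by have := ler_wpM2l (ltW M0) l3; lra.
  apply: prodn; apply: (le_trans _ l4); apply: (le_trans (ler_normB _ _));
  have := bdHyp_norm g1; have := bdHyp_norm g2; have := bdHyp_norm h1; have := bdHyp_norm h2; lra.
case: (close h.1 (or_introl erefl)) => l1; case: (close h.2 (or_intror erefl)) => l2.
- by left; apply: (far g.1).
- by left; apply: prodn; apply: le_trans CC.
- by right; apply: prodn; apply: le_trans CC.
- by left; apply: (far g.2).
Qed.
End Leaves.

Lemma nbhs_distP (R : realType) (V : normedModType R) (x : V) (P : set V) :
  nbhs x P <-> exists2 e : R, 0 < e & forall y, `|y - x| < e -> P y.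
Proof.
split=> [/nbhs_ballP[e /= e0 h]|[e e0 h]].
  by exists e => // y hy; apply: h; rewrite -ball_normE /= distrC.
apply/nbhs_ballP; exists e => // y; rewrite -ball_normE /= distrC; exact: h.
Qed.

Lemma within_continuous_distP (R : realType) (T V : normedModType R)
    (A : set T) (f : T -> V) :
  {within A, continuous f} <->
  (forall x, A x -> forall e : R, 0 < e -> exists2 d : R, 0 < d &
    forall y, A y -> `|y - x| < d -> `|f y - f x| < e).
Proof.
split=> [/within_continuousP cf x Ax e e0|h].
  have /nbhs_distP[d d0 hd] : \forall y \near x, A y -> `|f y - f x| < e.
    apply: (cf x Ax [set z | `|z - f x| < e]).
    by apply/nbhs_distP; exists e.
  by exists d => // y Ay hy; apply: hd.
apply/within_continuousP => x Ax O /nbhs_distP[e e0 he].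
have [d d0 hd] := h x Ax e e0.
by apply/nbhs_distP; exists d => // y hy Ay; apply: he; apply: hd.
Qed.

(** * Transverse arcs and separation of geodesics *)

Section Crossing.
Context {R : realType}.
Local Notation V := 'cV[R]_3.
Implicit Types (x y z p q : V) (g h : V * V).

Lemma derivable_dist (a : R -> V) t : derivable a t 1 ->
  forall e : R, 0 < e -> exists2 d : R, 0 < d &
    forall s, `|s - t| < d -> `|a s - a t| < e.
Proof.
move=> da.
have ca : {for t, continuous a} by exact/differentiable_continuous/derivable1_diffP.
move=> e e0.
have /nbhs_distP[d d0 hd] : nbhs t (fun s => `|a t - a s| < e).
  exact: (@cvgr_dist_lt _ _ _ _ _ _ _ ca).
by exists d => // s hs; rewrite distrC; apply: hd.
Qed.

Lemma derivable_within (a : R -> V) (A : set R) :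
  (forall t, A t -> derivable a t 1) -> {within A, continuous a}.
Proof.
move=> da; apply/within_continuous_distP => t At e e0.
have [d d0 hd] := derivable_dist (da t At) e0.
by exists d => // y _; exact: hd.
Qed.

Lemma derive1_dist (a : R -> V) t : derivable a t 1 ->
  forall e : R, 0 < e -> exists2 d : R, 0 < d &
    forall r, r != 0 -> `|r| < d -> `|r^-1 *: (a (r + t) - a t) - derive1 a t| < e.
Proof.
move=> da e e0.
have : (fun r => r^-1 *: (a (r + t) - a t)) @ (0 : R)^' --> derive1 a t.
  apply/cvg_ex; move: da => /cvg_ex[l hl]; exists l.
  apply: cvg_trans hl; apply: near_eq_cvg.
  by apply: nearW => r /=; rewrite [_%:A]mulr1.
move=> /cvgr_dist_lt/(_ e e0) ca.
have /nbhs_distP[d d0 hd] : nbhs (0 : R)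
    (fun r => r != 0 -> `|derive1 a t - r^-1 *: (a (r + t) - a t)| < e) by exact: ca.
exists d => // r r0 rd; rewrite distrC; apply: hd => //.
by rewrite subr0.
Qed.

Lemma vol3B p q x y : vol3 p q (x - y) = vol3 p q x - vol3 p q y.
Proof. by rewrite !vol3E !mxE; ring. Qed.

Lemma sign_IVT (F : R -> R) (a b : R) : a <= b -> {within `[a, b], continuous F} ->
  (forall t, t \in `[a, b] -> F t != 0) -> 0 < F a * F b.
Proof.
move=> ab cF nz.
have Fa : F a != 0 by apply: nz; rewrite in_itv /= lexx ab.
have Fb : F b != 0 by apply: nz; rewrite in_itv /= lexx ab.
rewrite ltNge; apply/negP => le0.
have [c cab Fc] : exists2 c, c \in `[a, b] & F c = 0.
  apply: IVT => //; rewrite ge_min le_max.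
  have [h|h] := lerP 0 (F a).
    have {}h : 0 < F a by rewrite lt_neqAle eq_sym Fa.
    by rewrite pmulr_rle0 // in le0; rewrite le0 orbT.
  by rewrite nmulr_rle0 // in le0; rewrite (ltW h) le0 orbT.
by move: (nz c cab); rewrite Fc eqxx.
Qed.

(** The nonzero derivative gives opposite signs just before and just after [t2], and the
    intermediate value theorem carries them to [t1] and [t3], as there is no other zero. *)
Lemma crossing_changes_side (a : R -> V) p q t1 t2 t3 : bdHyp p -> bdHyp q ->
  t1 < t2 -> t2 < t3 ->
  (forall t, t \in `[t1, t3] -> derivable a t 1) ->
  vol3 p q (derive1 a t2) != 0 -> vol3 p q (a t2) = 0 ->
  (forall t, t \in `[t1, t3] -> vol3 p q (a t) = 0 -> t = t2) ->
  vol3 p q (a t1) * vol3 p q (a t3) < 0.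
Proof.
move=> bp bq t12 t23 da dn v2 uniq.
pose F t := vol3 p q (a t).
set D := vol3 p q (derive1 a t2) in dn.
have D0 : 0 < `|D| by rewrite normr_gt0.
have cF s t : {subset `[s, t] <= `[t1, t3]} -> {within `[s, t], continuous F}.
  move=> sub; apply/within_continuous_distP => u ust e e0.
  have e6 : 0 < e / 6 by rewrite divr_gt0.
  have [d d0 hd] := derivable_dist (da u (sub u ust)) e6.
  exists d => // y _ /hd h; rewrite /F -vol3B.
  apply: le_lt_trans (vol3_bound _ bp bq) _; lra.
have t2in : t2 \in `[t1, t3] by rewrite in_itv /= !ltW.
(* 6 is the constant of [vol3_bound]: with this radius the difference quotient of [F] is within
   [|D|] of [D], hence has the sign of [D]. *)
have D6 : 0 < `|D| / 6 by rewrite divr_gt0.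
have [d d0 hd] := derive1_dist (da t2 t2in) D6.
have quot r : r != 0 -> `|r| < d -> `|r^-1 * F (r + t2) - D| < `|D|.
  move=> r0 rd; have := hd r r0 rd => {}hd.
  have -> : r^-1 * F (r + t2) - D =
      vol3 p q (r^-1 *: (a (r + t2) - a t2) - derive1 a t2).
    by rewrite vol3B vol3Z vol3B v2 subr0.
  apply: le_lt_trans (vol3_bound _ bp bq) _; lra.
pose r := Num.min (d / 2) (Num.min (t2 - t1) (t3 - t2)).
have r0 : 0 < r by rewrite !lt_min divr_gt0 ?subr_gt0 // t12 t23.
have rd : r < d by rewrite gt_min ltr_pdivrMr // ltr_pMr // ltr1n.
have r1 : r <= t2 - t1 by rewrite /r !ge_min lexx !orbT.
have r3 : r <= t3 - t2 by rewrite /r !ge_min lexx !orbT.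
have s1 : 0 < F t1 * F (- r + t2).
  apply: sign_IVT; first by lra.
    by apply: cF => u; rewrite !in_itv /= => /andP[h1 h2]; apply/andP; split=> //; lra.
  move=> u; rewrite in_itv /= => /andP[h1 h2]; apply/eqP => Fu.
  have : u = t2 by apply: uniq => //; rewrite in_itv /=; apply/andP; split => //; lra.
  lra.
have s3 : 0 < F (r + t2) * F t3.
  apply: sign_IVT; first by lra.
    by apply: cF => u; rewrite !in_itv /= => /andP[h1 h2]; apply/andP; split=> //; lra.
  move=> u; rewrite in_itv /= => /andP[h1 h2]; apply/eqP => Fu.
  have : u = t2 by apply: uniq => //; rewrite in_itv /=; apply/andP; split => //; lra.
  lra.
have rn0 : r != 0 by rewrite gt_eqF.
have q1 := quot r rn0; rewrite gtr0_norm // in q1; have {q1}q1 := q1 rd.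
have q2 : `|(- r)^-1 * F (- r + t2) - D| < `|D|.
  by apply: quot; rewrite ?oppr_eq0 // normrN gtr0_norm.
have sgn (u : R) : `|u - D| < `|D| -> 0 < u * D.
  move=> h; have [D1|D1] := ltP 0 D.
    by rewrite pmulr_lgt0 //; move: h; rewrite (gtr0_norm D1) ltr_norml => /andP[h _]; lra.
  have D2 : D < 0 by rewrite lt_neqAle dn.
  by rewrite nmulr_lgt0 //; move: h; rewrite (ltr0_norm D2) ltr_norml => /andP[_ h]; lra.
have := mulr_gt0 (sgn _ q1) (sgn _ q2).
rewrite invrN mulNr.
have -> : r^-1 * F (r + t2) * D * (- (r^-1 * F (- r + t2)) * D)
   = - (F (r + t2) * F (- r + t2)) * (r^-1 * D) ^+ 2 by ring.
have sq : 0 < (r^-1 * D) ^+ 2 by rewrite exprn_even_gt0 // mulf_neq0 // invr_eq0.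
rewrite pmulr_lgt0 // oppr_gt0 => s2.
rewrite -/(F t1) -/(F t3).
have := mulr_gt0 s1 s3.
have -> : F t1 * F (- r + t2) * (F (r + t2) * F t3)
  = (F (r + t2) * F (- r + t2)) * (F t1 * F t3) by ring.
by rewrite nmulr_rgt0.
Qed.

(** [separates] speaks of all points of the two outer leaves; since these are disjoint from [h],
    each stays on one side and its point on the arc decides which. *)
Lemma crossing_separates (a : R -> V) g h k t1 t2 t3 :
  ideal g -> ideal h -> ideal k ->
  (forall z, geod g z -> geod h z -> False) ->
  (forall z, geod k z -> geod h z -> False) ->
  t1 < t2 -> t2 < t3 ->
  (forall t, t \in `[t1, t3] -> Hyp (a t) /\ derivable a t 1) ->
  vol3 h.1 h.2 (derive1 a t2) != 0 ->
  geod g (a t1) -> geod h (a t2) -> geod k (a t3) ->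
  (forall t, t \in `[t1, t3] -> geod h (a t) -> t = t2) ->
  separates h g k.
Proof.
move=> ig ih ik dg dk t12 t23 da dn ga ha ka uniq x y gx ky.
have [h1 h2 hn] := ih.
have cs : vol3 h.1 h.2 (a t1) * vol3 h.1 h.2 (a t3) < 0.
  apply: (@crossing_changes_side a _ _ t1 t2 t3) => //.
  - by move=> t /da[].
  - by apply/geodP => //; rewrite -?surjective_pairing //; case: (ha).
  - move=> t tt v0; apply: uniq => //; rewrite (surjective_pairing h).
    by apply/geodP => //; case: (da t tt).
have sx := geod_same_side ig ih dg ga gx.
have sy := geod_same_side ik ih dk ka ky.
have := mulr_gt0 sx sy.
have -> : vol3 h.1 h.2 (a t1) * vol3 h.1 h.2 x * (vol3 h.1 h.2 (a t3) * vol3 h.1 h.2 y)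
  = vol3 h.1 h.2 (a t1) * vol3 h.1 h.2 (a t3) * (vol3 h.1 h.2 x * vol3 h.1 h.2 y) by ring.
by rewrite nmulr_rgt0.
Qed.

Lemma separatesC h g k : separates h g k -> separates h k g.
Proof. by move=> s x y kx gy; rewrite mulrC; exact: s. Qed.
End Crossing.

Lemma near_finite_set (T : topologicalType) (I : eqType) (x : T) (F : set I)
    (P : I -> set T) : finite_set F ->
  (forall i, F i -> \forall y \near x, P i y) ->
  \forall y \near x, forall i, F i -> P i y.
Proof.
move=> /finite_seqP[s ->]; elim: s => [_|i s IH h].
  by apply: nearW => y i.
have hi : \forall y \near x, P i y by apply: h; rewrite /= inE eqxx.
have hs : \forall y \near x, forall i, [set` s] i -> P i y.
  by apply: IH => j js; apply: h; rewrite /= inE; apply/orP; right.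
apply: filterS2 hi hs => y yi ys j /=; rewrite inE => /orP[/eqP->//|].
exact: ys.
Qed.

Lemma entry_norm_le (R : realType) m n (M : 'M[R]_(m, n)) i j : `|M i j| <= `|M|.
Proof.
rewrite [leRHS]/Num.norm /= mx_normrE.
exact: (@le_bigmax _ _ _ _ (fun ij => `|M ij.1 ij.2|) (i, j)).
Qed.

Section Topology.
Context {R : realType}.
Local Notation V := 'cV[R]_3.

Lemma continuous_dist (U W : normedModType R) (f : U -> W) (C : R) :
  (forall x y, `|f x - f y| <= C * `|x - y|) -> continuous f.
Proof.
move=> lip x; apply/cvgrPdist_lt => e e0.
apply/nbhs_distP; exists (e / (`|C| + 1)); first by rewrite divr_gt0 // ltr_wpDl.
move=> y hy; rewrite distrC; apply: le_lt_trans (lip y x) _.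
have C1 : 0 < `|C| + 1 by rewrite ltr_wpDl.
move: hy; rewrite ltr_pdivlMr // mulrC; apply: le_lt_trans.
by rewrite ler_wpM2r // (le_trans (ler_norm _)) // lerDl.
Qed.

Lemma continuous_mulmx m n p (A : 'M[R]_(m, n)) :
  continuous (mulmx A : 'M[R]_(n, p) -> 'M[R]_(m, p)).
Proof.
apply: (@continuous_dist _ _ _ (n%:R * `|A|)) => x y.
by rewrite -mulmxBr mulmx_norm_le.
Qed.

Lemma compact_ball (x0 : V) (r : R) : compact [set y | `|y - x0| <= r].
Proof.
pose K := [set v : 'rV[R]_3 | forall i, v ord0 i \in `[x0 i 0 - r, x0 i 0 + r]].
have c1 : compact K.
  by apply: (@rV_compact R 3 (fun i => [set` `[x0 i 0 - r, x0 i 0 + r]])) => i; exact: segment_compact.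
have c2 : compact ((trmx : 'rV[R]_3 -> V) @` K).
  apply: continuous_compact c1; apply: continuous_subspaceT.
  apply: (@continuous_dist _ _ _ 1) => u v; rewrite mul1r.
  have -> : u^T - v^T = (u - v)^T by rewrite linearB.
  by apply: norm_le3; rewrite mxE entry_norm_le.
apply: (subclosed_compact _ c2).
  have cn : continuous (fun y : V => `|y - x0|).
    apply: (@continuous_dist V R^o _ 1) => u v; rewrite mul1r.
    have -> : u - v = (u - x0) - (v - x0) by rewrite opprB addrA subrK.
    exact: ler_dist_dist.
  exact: ((continuous_closedP _).1 cn _ (@closed_le R r)).
move=> y /= yr; exists y^T; last by rewrite trmxK.
move=> i; rewrite mxE in_itv /= -ler_distl.
by have := entry_norm_le (y - x0) i 0; rewrite !mxE => h; exact: le_trans h yr.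
Qed.

Lemma closed_Hyp : closed (Hyp : set V).
Proof.
have cc i : continuous (fun x : V => x i 0) by exact: coord_continuous.
(* On the hyperboloid a positive height is at least 1, which turns the open condition into a closed
   one. *)
have -> : (Hyp : set V) =
    (fun x : V => x i0 0 * x i0 0 + x i1 0 * x i1 0 - x i2 0 * x i2 0) @^-1` [set -1] `&`
    (fun x : V => x i2 0) @^-1` [set t | 1 <= t].
  apply/seteqP; split => x /=.
    move=> /HypP[x0 xE]; split; first by rewrite -!expr2; lra.
    rewrite -(@ler_pXn2r _ 2) ?nnegrE ?ler01 ?(ltW x0) // expr1n -xE lerDr.
    by rewrite addr_ge0 ?sqr_ge0.
  move=> [xE x1]; apply/HypP; split; first exact: lt_le_trans x1.
  rewrite !expr2; lra.
apply: closedI.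
  have /continuous_closedP cn : continuous
      (fun x : V => x i0 0 * x i0 0 + x i1 0 * x i1 0 - x i2 0 * x i2 0).
    move=> x; exact: (cvgB (cvgD (cvgM (cc i0 x) (cc i0 x)) (cvgM (cc i1 x) (cc i1 x))) (cvgM (cc i2 x) (cc i2 x))).
  exact: (cn _ (@closed_eq R _)).
have /continuous_closedP cn := cc i2.
exact: (cn _ (@closed_ge R _)).
Qed.

Lemma compact_closedV (K : set V) : compact K -> closed K.
Proof. by apply: compact_closed; exact: norm_hausdorff. Qed.
End Topology.

(** * The universal cover *)

Section Surface.
Context {R : realType}.
Local Notation V := 'cV[R]_3.
Context {Gamma : set 'M[R]_3} {X : topologicalType} {pr : V -> X}.
Hypotheses (hGamma : surface_group Gamma) (hX : universal_cover Gamma pr).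
Implicit Types (A B : 'M[R]_3) (x y z : V).

Lemma Gamma_isom A : Gamma A -> hyp_isom A.
Proof. by case: hGamma => _ h _ _ _ /h. Qed.

Lemma GammaM A B : Gamma A -> Gamma B -> Gamma (A *m B).
Proof. by case: hGamma => -[_ h] _ _ _ _ gA gB; case: (h A B gA gB). Qed.

Lemma GammaV A : Gamma A -> Gamma (invmx A).
Proof. by case: hGamma => -[_ h] _ _ _ _ gA; case: (h A A gA gA). Qed.

Lemma Gamma1 : Gamma 1%:M. Proof. by case: hGamma => -[]. Qed.

Lemma Gamma_unit A : Gamma A -> A \in unitmx.
Proof. by move=> /Gamma_isom/hyp_isom_unit. Qed.

Lemma GammaK m A (y : 'M[R]_(3, m)) : Gamma A -> invmx A *m (A *m y) = y.
Proof. by move=> gA; rewrite mulKmx // Gamma_unit. Qed.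

Lemma GammaVK m A (y : 'M[R]_(3, m)) : Gamma A -> A *m (invmx A *m y) = y.
Proof. by move=> gA; rewrite mulKVmx // Gamma_unit. Qed.

Lemma Gamma_Hyp A x : Gamma A -> Hyp x -> Hyp (A *m x).
Proof. by move=> /Gamma_isom[_ _]; exact. Qed.

Lemma Gamma_free A B x : Gamma A -> Gamma B -> Hyp x -> A *m x = B *m x -> A = B.
Proof.
move=> gA gB Hx e.
have /(congr1 (mulmx B)) : invmx B *m A = 1%:M.
  case: hGamma => _ _ h _ _; apply: (h _ x) => //.
    by apply: GammaM => //; exact: GammaV.
  by rewrite -mulmxA e GammaK.
by rewrite GammaVK // mulmx1.
Qed.

Lemma pr_eq x y : Hyp x -> Hyp y -> pr x = pr y <-> exists2 A, Gamma A & y = A *m x.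
Proof. by case: hX => _; exact. Qed.

Lemma pr_Gamma A x : Gamma A -> Hyp x -> pr (A *m x) = pr x.
Proof.
move=> gA Hx; apply/esym/pr_eq => //; first exact: Gamma_Hyp.
by exists A.
Qed.

Lemma pr_continuous : {within Hyp, continuous pr}.
Proof.
case: hX => -[_ q] _; apply/within_continuousP => x Hx O.
rewrite nbhsE => -[U [oU Ux] UO].
have [W oW e] := (q U).1 oU.
have Wx : W x.
  have : (Hyp `&` pr @^-1` U) x by [].
  by rewrite e => -[].
apply: filterS (open_nbhs_nbhs (conj oW Wx)) => y Wy Hy; apply: UO.
have : (Hyp `&` W) y by [].
by rewrite -e => -[].
Qed.

(** By proper discontinuity only finitely many translates of [K] meet the unit ball about [x0]. They
    are closed, so a small ball avoids those that miss [x0]. *)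
Lemma translates_near (K : set V) x0 : compact K -> K `<=` Hyp -> Hyp x0 ->
  \forall y \near x0, forall B k, Gamma B -> K k -> y = B *m k ->
    exists2 k', K k' & x0 = B *m k'.
Proof.
move=> cK KH Hx0.
pose D := [set y : V | `|y - x0| <= 1] `&` Hyp.
have cD : compact D.
  apply: (subclosed_compact _ (@compact_ball R x0 1)); last by move=> y [].
  apply: closedI; first exact: (compact_closedV (@compact_ball R x0 1)).
  exact: closed_Hyp.
(* Proper discontinuity is stated for a single compact set; the union accounts for translates of [K]
   that meet [D]. *)
pose F := [set A | Gamma A /\ exists2 x, (K `|` D) x & (K `|` D) (A *m x)].
have fF : finite_set F.
  case: hGamma => _ _ _ h _; apply: h; first exact: compactU.
  by move=> y [/KH|[]].
have near1 : \forall y \near x0, forall B, F B ->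
    (exists2 k, K k & y = B *m k) -> (exists2 k, K k & x0 = B *m k).
  apply: (near_finite_set fF) => B _.
  have [h|h] := pselect (exists2 k, K k & x0 = B *m k).
    by apply: (filterS _ (@filterT _ (nbhs x0) _)) => y _ _.
  have cBK : closed (mulmx B @` K).
    apply: compact_closedV; apply: continuous_compact cK.
    by apply: continuous_subspaceT; exact: continuous_mulmx.
  have : nbhs x0 (~` (mulmx B @` K)).
    apply: open_nbhs_nbhs; split; first exact: closed_openC.
    by move=> [k Kk kE]; apply: h; exists k.
  by apply: filterS => y nKy [k Kk kE]; case: nKy; exists k.
have near2 : \forall y \near x0, `|y - x0| <= 1.
  by apply/nbhs_distP; exists 1 => // y /ltW.
apply: filterS2 near1 near2 => y h yD B k gB Kk yE.
apply: h => //; last by exists k.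
split=> //; exists k; first by left.
right; split; first by rewrite -yE.
by apply: Gamma_Hyp => //; exact: KH.
Qed.

Lemma closed_pr (K : set V) : compact K -> K `<=` Hyp -> closed (pr @` K).
Proof.
move=> cK KH; rewrite -openC; case: hX => -[_ q] _; apply/q.
pose W := (~` [set y | exists B k, [/\ Gamma B, K k & y = B *m k]])°.
exists W; first exact: open_interior.
apply/seteqP; split => x [Hx h]; split => //.
  apply: filterS (translates_near cK KH Hx) => y hy [B [k [gB Kk yE]]].
  have [k' Kk' xE] := hy B k gB Kk yE.
  by apply: h; exists k' => //; rewrite xE pr_Gamma //; exact: KH.
move=> [k Kk kE]; have [B gB xE] := (pr_eq (KH k Kk) Hx).1 kE.
by apply: (nbhs_singleton h); exists B, k.
Qed.

(* The translates of an arc embedded in the surface are disjoint. *)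
Lemma path_in_translate (a c : R -> V) (p q : R) : p <= q ->
  {within `[0, 1], continuous a} -> (forall t, t \in `[0, 1] -> Hyp (a t)) ->
  (forall s t, s \in `[0, 1] -> t \in `[0, 1] -> pr (a s) = pr (a t) -> s = t) ->
  {within `[p, q], continuous c} -> (forall t, t \in `[p, q] -> Hyp (c t)) ->
  (forall t, t \in `[p, q] -> exists2 u, u \in `[0, 1] & pr (c t) = pr (a u)) ->
  exists2 B, Gamma B & forall t, t \in `[p, q] ->
    exists2 u, u \in `[0, 1] & c t = B *m a u.
Proof.
move=> pq ca Ha inja cc Hc ha.
have lift t : t \in `[p, q] -> exists B u, [/\ Gamma B, u \in `[0, 1] & c t = B *m a u].
  move=> tpq; have [u u01 e] := ha t tpq.
  have [B gB cE] := (pr_eq (Ha u u01) (Hc t tpq)).1 (esym e).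
  by exists B, u.
have uniq B B' u u' t : Gamma B -> Gamma B' -> u \in `[0, 1] -> u' \in `[0, 1] ->
    c t = B *m a u -> c t = B' *m a u' -> B = B'.
  move=> gB gB' u01 u'01 e e'.
  have uu : u = u'.
    apply: inja => //; rewrite -(pr_Gamma gB) -?(pr_Gamma gB' (Ha _ u'01)) -?e -?e' //.
    exact: Ha.
  subst u'; apply: (Gamma_free gB gB' (Ha u u01)); by rewrite -e.
have cK : compact (a @` `[0, 1]%classic) by apply: continuous_compact ca _; exact: segment_compact.
have KH : a @` `[0, 1]%classic `<=` Hyp by move=> _ [t t01 <-]; exact: Ha.
pose T t := [set B | Gamma B /\ exists2 u, u \in `[0, 1] & c t = B *m a u].
pose f t := xget 0 (T t).
have fP t : t \in `[p, q] -> T t (f t).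
  move=> tpq; have [B [u [gB u01 e]]] := lift t tpq.
  by apply: (@xgetI _ 0 (T t) B); split=> //; exists u.
have const : forall t t', t \in `[p, q] -> t' \in `[p, q] -> f t = f t'.
  apply: (locally_constant pq) => t0 t0pq.
  have near0 := translates_near cK KH (Hc t0 t0pq).
  have /nbhs_distP[e e0 he] := (within_continuousP _ _).1 cc t0 t0pq _ near0.
  exists e => // s t spq tpq hs ht.
  suff H r : r \in `[p, q] -> `|r - t0| < e -> f r = f t0 by rewrite !H.
  move=> rpq hr; have [gB [u u01 E]] := fP r rpq.
  have [k [u' u'01 <-] E'] := he r hr rpq (f r) (a u) gB (ex_intro2 _ _ u u01 erefl) E.
  have [gB0 [u0 u001 E0]] := fP t0 t0pq.
  exact: (uniq _ _ u' u0 t0).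
have ppq : p \in `[p, q] by rewrite in_itv /= lexx.
exists (f p); first by case: (fP p ppq).
by move=> t tpq; rewrite (const p t) //; case: (fP t tpq).
Qed.
End Surface.

Lemma derive1_mulmx (R : realType) (B : 'M[R]_3) (a : R -> 'cV[R]_3) t :
  derivable a t 1 ->
  derivable (fun s => B *m a s) t 1 /\ derive1 (fun s => B *m a s) t = B *m derive1 a t.
Proof.
move=> da.
have lim : (fun r => r^-1 *: (B *m a (r + t) - B *m a t)) @ (0 : R)^' --> B *m derive1 a t.
  have -> : (fun r : R => r^-1 *: (B *m a (r + t) - B *m a t)) =
      (mulmx B \o (fun r => r^-1 *: (a (r + t) - a t))).
    by apply/funext => r /=; rewrite -mulmxBr scalemxAr.
  have ca : (fun r => r^-1 *: (a (r + t) - a t)) @ (0 : R)^' --> derive1 a t.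
    apply/cvg_ex; move: da => /cvg_ex[l hl]; exists l.
    apply: cvg_trans hl; apply: near_eq_cvg.
    by apply: nearW => r /=; rewrite [_%:A]mulr1.
  apply: (cvg_comp _ _ ca).
  by have := @continuous_mulmx R _ _ _ B (derive1 a t).
split; last by apply: cvg_lim lim; exact: norm_hausdorff.
apply/cvg_ex; exists (B *m derive1 a t).
apply: cvg_trans lim; apply: near_eq_cvg.
by apply: nearW => r /=; rewrite [_%:A]mulr1.
Qed.

Record setup (R : realType) (Gamma : set 'M[R]_3) (X : topologicalType)
    (pr : 'cV[R]_3 -> X) (rho : 'M[R]_3 -> 'M[R]_3) (Om : set 'cV[R]_3)
    (xi : 'cV[R]_3 -> 'cV[R]_3) (L : set ('cV[R]_3 * 'cV[R]_3))
    (n : nat) (Q : 'I_n -> R -> R -> 'cV[R]_3)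
    (S : 'cV[R]_3 * 'cV[R]_3 -> 'cV[R]_3 * 'cV[R]_3 -> 'M[R]_3) : Prop := Setup {
  setup_group : surface_group Gamma;
  setup_cover : universal_cover Gamma pr;
  setup_hitchin : hitchin Gamma rho Om;
  setup_boundary : boundary_homeo Gamma rho Om xi;
  setup_lamination : geodesic_lamination Gamma pr L;
  setup_track : train_track_nbhd pr L Q;
  setup_slithering : slithering_map pr L Q Om xi S }.

(** * Convex cones *)

Section Cone.
Context {R : realType}.
Local Notation V := 'cV[R]_3.
Context (Om : set V).
Hypothesis conv : properly_convex Om.
Implicit Types (x y : V) (M : 'M[R]_3).

Lemma cone_scale x (t : R) : Om x -> 0 < t -> Om (t *: x).
Proof.
case: conv => _ _ h _ Ox t0.
have t2 : 0 < t / 2 by rewrite divr_gt0.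
by have := h x x _ _ Ox Ox t2 t2; rewrite -scalerDl -splitr.
Qed.

(** Proper convexity leaves only [x = 0] to exclude: an open cone containing 0 would contain a
    nonzero vector together with its opposite. *)
Lemma cone_salient x : Om x -> ~ Om (- x).
Proof.
case: conv => oO _ h hcl Ox Onx.
have x0 : x = 0 by apply: hcl; exact: subset_closure.
subst x.
have /nbhs_distP[e e0 he] : nbhs (0 : V) Om by apply: open_nbhs_nbhs.
pose v : V := const_mx (e / 2).
have e2 : 0 < e / 2 by rewrite divr_gt0.
have nv : `|v| < e.
  apply: (@le_lt_trans _ _ (e / 2)); last by rewrite ltr_pdivrMr // ltr_pMr // ltr1n.
  by apply: norm_le3; rewrite !mxE gtr0_norm.
have v0 : v = 0.
  apply: hcl; apply: subset_closure; apply: he; first by rewrite subr0.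
  by rewrite subr0 normrN.
by have := congr1 (fun w : V => w i0 0) v0; rewrite !mxE => e20; rewrite e20 ltxx in e2.
Qed.

(* The image of the convex set [Om] is connected, so it lies on one side. *)
Lemma cone_image_side M : (forall x, Om x -> Om (M *m x) \/ Om (- (M *m x))) ->
  (forall x, Om x -> Om (M *m x)) \/ (forall x, Om x -> Om (- (M *m x))).
Proof.
move=> h; have [oO _ hc _] := conv.
apply: contrapT => /not_orP[/existsNP[x /not_implyP[Ox nx]] /existsNP[y /not_implyP[Oy ny]]].
have My : Om (M *m y) by case: (h y Oy).
pose z (t : R) : V := (1 - t) *: x + t *: y.
have Oz t : t \in `[0, 1] -> Om (z t).
  rewrite in_itv /= => /andP[t0 t1]; rewrite /z.
  have [->|tn0] := eqVneq t 0; first by rewrite subr0 scale1r scale0r addr0.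
  have [->|tn1] := eqVneq t 1; first by rewrite subrr scale1r scale0r add0r.
  by apply: hc => //; rewrite ?subr_gt0 lt_neqAle 1?eq_sym ?tn0 // eq_sym tn1.
have cz : continuous (fun t => M *m z t).
  have -> : (fun t => M *m z t) = (fun t => M *m x + t *: (M *m (y - x))).
    apply/funext => t; have -> : z t = x + t *: (y - x).
      by rewrite /z scalerBl scale1r scalerBr addrA addrAC.
    by rewrite mulmxDr -scalemxAr.
  apply: (@continuous_dist _ _ _ _ `|M *m (y - x)|) => s t.
  by rewrite opprD addrACA subrr add0r -scalerBl normrZ mulrC.
have loc : forall t : R, t \in `[0, 1] -> exists2 e : R, 0 < e & forall p q : R,
    p \in `[0, 1] -> q \in `[0, 1] -> `|p - t| < e -> `|q - t| < e ->
    `[< Om (M *m z p) >] = `[< Om (M *m z q) >].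
  move=> t t01.
  suff [b /nbhs_distP[e e0 he]] : exists b, nbhs t (fun s : R => s \in `[0, 1] -> `[< Om (M *m z s) >] = b).
    by exists e => // p q p01 q01 hp hq; rewrite !he.
  case: (h _ (Oz t t01)) => Mz.
    have : nbhs t (fun s => Om (M *m z s)) by exact: (cz t Om (open_nbhs_nbhs (conj oO Mz))).
    move=> /nbhs_distP[e e0 he]; exists true; apply/nbhs_distP; exists e => // s hs _.
    by apply/asboolP; exact: he.
  have nN : nbhs (M *m z t) (fun w : V => Om (- w)).
    have cN : continuous (fun w : V => - w) by exact: opp_continuous.
    exact: (cN _ Om (open_nbhs_nbhs (conj oO Mz))).
  have /nbhs_distP[e e0 he] : nbhs t (fun s => Om (- (M *m z s))) by exact: (cz t _ nN).
  exists false; apply/nbhs_distP; exists e => // s hs _.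
  apply/asboolPn => Os; exact: (cone_salient Os (he s hs)).
have := @locally_constant R bool 0 1 _ ler01 loc 0 1.
rewrite !in_itv /= !lexx !ler01 => /(_ isT isT) => e.
have z0 : z 0 = x by rewrite /z subr0 scale1r scale0r addr0.
have z1 : z 1 = y by rewrite /z subrr scale1r scale0r add0r.
apply: nx; apply/asboolP; move: e; rewrite z0 z1 => ->; exact/asboolP.
Qed.

Lemma closure_mulmx M x : (forall y, Om y -> Om (M *m y)) ->
  closure Om x -> closure Om (M *m x).
Proof.
move=> hM cx B nB.
have hB : nbhs x (fun y => B (M *m y)) by exact: (@continuous_mulmx R _ _ _ M x B nB).
have [y [Oy By]] := cx _ hB.
by exists (M *m y); split => //; exact: hM.
Qed.

(** The tangent line is given by functions that cut out the boundary, so its equivariance comes from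
    composing such a function with the inverse of an automorphism of the cone. *)
Lemma C1_defining_mulmx M x f : M \in unitmx ->
  (forall y, Om y -> Om (M *m y)) -> (forall y, Om y -> Om (invmx M *m y)) ->
  C1_defining Om x f ->
  C1_defining Om (M *m x) (f \o mulmx (invmx M)) /\
  forall v, 'd (f \o mulmx (invmx M)) (M *m x) v = 'd f x (invmx M *m v) :> R.
Proof.
move=> uM hM hM' [near_f [v0 dv0]].
have cM' : continuous (mulmx (invmx M) : V -> V) by exact: continuous_mulmx.
have dM' y : differentiable (mulmx (invmx M) : V -> V) y.
  exact: linear_differentiable.
have dE y : differentiable f (invmx M *m y) -> forall v,
    'd (f \o mulmx (invmx M)) y v = 'd f (invmx M *m y) (invmx M *m v) :> R.
  move=> df v.
  have e1 : 'd (mulmx (invmx M) : V -> V) y = mulmx (invmx M) :> (V -> V).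
    exact: diff_lin cM'.
  have e2 := diff_comp (dM' y) df.
  have e3 := congr1 (fun F : V -> R => F v) e2.
  have e4 := congr1 (fun F : V -> V => F v) e1.
  have e5 := congr1 (fun w : V => 'd f (invmx M *m y) w : R) e4.
  exact: etrans e3 e5.
have MK : invmx M *m (M *m x) = x by rewrite mulKmx.
have dfx : differentiable f x by case: (nbhs_singleton near_f).
have dEx v : 'd (f \o mulmx (invmx M)) (M *m x) v = 'd f x (invmx M *m v) :> R.
  have df' : differentiable f (invmx M *m (M *m x)) by rewrite MK.
  by have := dE _ df' v; rewrite MK.
split; last exact: dEx.
split; last first.
  exists (M *m v0); have e := dEx (M *m v0); rewrite mulKmx // in e.
  by apply: contra_neq dv0 => e0; exact: etrans (esym e) e0.
pose P y := [/\ differentiable f y,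
         (forall v, {for y, continuous (fun z => 'd f z v : R)}) &
         f y = 0 <-> (closure Om y /\ ~ Om y)].
have nn : nbhs (invmx M *m (M *m x)) (fun y => nbhs y P).
  by rewrite MK; exact: near_join near_f.
have : nbhs (M *m x) (fun z => nbhs (invmx M *m z) P) by exact: (cM' _ _ nn).
apply: filterS => z nz; have [df cd bd] := nbhs_singleton nz.
split.
- by apply: differentiable_comp.
- move=> v; have cdv := cd (invmx M *m v).
  have e : \forall w \near z, 'd f (invmx M *m w) (invmx M *m v) =
      'd (f \o mulmx (invmx M)) w v :> R.
    have n1 : nbhs z (fun w => P (invmx M *m w)) by exact: (cM' z _ nz).
    by apply: filterS n1 => w [dw _ _]; exact: esym (dE w dw v).
  have cc : (fun w : V => 'd f (invmx M *m w) (invmx M *m v) : R) @ z -->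
      ('d f (invmx M *m z) (invmx M *m v) : R).
    exact: (cvg_comp _ _ (cM' z) cdv).
  have e' : ('d (f \o mulmx (invmx M)) z v : R) = 'd f (invmx M *m z) (invmx M *m v).
    exact: dE.
  have goal2 : (fun w : V => 'd (f \o mulmx (invmx M)) w v : R) @ z -->
      ('d f (invmx M *m z) (invmx M *m v) : R).
    exact: cvg_trans (near_eq_cvg e) cc.
  refine (eq_ind_r (fun l : R =>
    (fun w : V => 'd (f \o mulmx (invmx M)) w v : R) @ z --> l) goal2 e').
- rewrite /= bd; split=> -[cl no]; split.
  + by rewrite -[z](mulKVmx uM); exact: closure_mulmx.
  + by move=> Oz; apply: no; exact: hM'.
  + exact: closure_mulmx.
  + by move=> Oz; apply: no; rewrite -[z](mulKVmx uM); exact: hM.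
Qed.

Lemma tangent_line_mulmx M x (phi : 'rV[R]_3) : M \in unitmx ->
  (forall y, Om y -> Om (M *m y)) -> (forall y, Om y -> Om (invmx M *m y)) ->
  tangent_line Om x phi -> tangent_line Om (M *m x) (phi *m invmx M).
Proof.
move=> uM hM hM' [f [c [df e]]].
have [df' dE] := C1_defining_mulmx uM hM hM' df.
exists (f \o mulmx (invmx M)), c; split; first exact: df'.
move=> v; rewrite -mulmxA; apply: etrans (e _) _.
have e' := congr1 (fun d : R => c * d) (esym (dE v)).
exact: etrans e'.
Qed.

Lemma tangent_line_scale x (phi : 'rV[R]_3) (c : R) :
  tangent_line Om x phi -> tangent_line Om x (c *: phi).
Proof.
move=> [f [d [df e]]]; exists f, (c * d); split => // v.
by rewrite -scalemxAl mxE e mulrA.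
Qed.
End Cone.

(** Transfer of a Hölder bound through a Lipschitz change of variable. The constant [K] comes
    without a sign, hence its absolute value in the result. *)
Lemma hoelder_scale (R : realType) (N K C th a b d t : R) : 0 <= N -> 0 <= C ->
  0 <= th -> 0 <= b -> 0 <= d -> t <= N * a -> a <= K * b `^ th -> b <= C * d ->
  t <= N * (`|K| * C `^ th) * d `^ th.
Proof.
move=> N0 C0 th0 b0 d0 ta ab bd; apply: (le_trans ta).
rewrite -mulrA; apply: ler_wpM2l => //; apply: (le_trans ab).
apply: (@le_trans _ _ (`|K| * b `^ th)).
  by rewrite ler_wpM2r ?powR_ge0 // ler_norm.
rewrite -mulrA; apply: ler_wpM2l => //; rewrite -powRM //.
by apply: ge0_ler_powR; rewrite ?nnegrE ?mulr_ge0.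
Qed.

Lemma closed_nbhsP (T : topologicalType) (A : set T) :
  (forall x, ~ A x -> nbhs x (~` A)) -> closed A.
Proof.
move=> h; rewrite -openC openE => x Ax; exact: h.
Qed.

Lemma within_preimage_compact (T U : topologicalType) (K : set T) (f : T -> U)
    (D : set U) : closed K -> compact K -> {within K, continuous f} -> closed D ->
  compact (K `&` f @^-1` D).
Proof.
move=> clK cK /within_continuousP cf clD.
apply: (subclosed_compact _ cK); last by move=> x [].
apply: closed_nbhsP => x nx.
have [Kx|nKx] := pselect (K x); last first.
  have : nbhs x (~` K) by apply: open_nbhs_nbhs; split=> //; exact: closed_openC.
  by apply: filterS => y nKy [].
have nD : nbhs (f x) (~` D).
  apply: open_nbhs_nbhs; split; first exact: closed_openC.
  by move=> Dx; apply: nx.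
by apply: filterS (cf x Kx _ nD) => y h [/h].
Qed.

(** * Interval topology and paths along geodesics *)

Section RealLine.
Context {R : realType}.

Lemma square_compact : compact (`[0, 1]%classic `*` `[0, 1]%classic : set (R * R)).
Proof. by apply: compact_setX; exact: segment_compact. Qed.

Lemma compact_closedRR (K : set (R * R)) : compact K -> closed K.
Proof. by apply: compact_closed; exact: norm_hausdorff. Qed.

Lemma compact_closedR (K : set R) : compact K -> closed K.
Proof. by apply: compact_closed; exact: norm_hausdorff. Qed.

(** By injectivity [f c] lies strictly between [f a] and [f b], so all values near it are
    attained. *)
Lemma injective_interval_open (f : R -> R) (a b c : R) : a < c -> c < b ->
  {within `[a, b], continuous f} ->
  (forall r s, r \in `[a, b] -> s \in `[a, b] -> f r = f s -> r = s) ->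
  exists2 d : R, 0 < d & forall v, `|v - f c| < d -> exists2 r, r \in `[a, b] & f r = v.
Proof.
move=> ac cb cf injf.
have sub1 r : r \in `[a, c] -> r \in `[a, b].
  by rewrite !in_itv /= => /andP[-> h]; rewrite (le_trans h) // ltW.
have sub2 r : r \in `[c, b] -> r \in `[a, b].
  by rewrite !in_itv /= => /andP[h ->]; rewrite (le_trans _ h) // ltW.
have cf1 : {within `[a, c], continuous f} by apply: continuous_subspaceW cf => r /sub1.
have cf2 : {within `[c, b], continuous f} by apply: continuous_subspaceW cf => r /sub2.
have aab : a \in `[a, b] by rewrite in_itv /= lexx ltW // (lt_trans ac).
have bab : b \in `[a, b] by rewrite in_itv /= lexx ltW // (lt_trans ac).
have cab : c \in `[a, b] by rewrite in_itv /= !ltW.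
have fac : f a != f c.
  by apply: contraTneq ac => /(injf _ _ aab cab) ->; rewrite ltxx.
have fbc : f b != f c.
  by apply: contraTneq cb => /(injf _ _ bab cab) ->; rewrite ltxx.
(* A value taken on both sides of [c] is taken at the same parameter, which can only be [c]. This
   rules out a local extremum at [c]. *)
have two v : Num.min (f a) (f c) <= v <= Num.max (f a) (f c) ->
    Num.min (f c) (f b) <= v <= Num.max (f c) (f b) -> v = f c.
  move=> h1 h2.
  have [r rac fr] := IVT (ltW ac) cf1 h1; have [s sab fs] := IVT (ltW cb) cf2 h2.
  have rs : r = s by apply: injf; [exact: sub1|exact: sub2|rewrite fr fs].
  move: rac sab; rewrite -rs !in_itv /= => /andP[_ rc] /andP[cr _].
  by rewrite -fr; congr f; apply/eqP; rewrite eq_le rc cr.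
have main v : Num.min (f a) (f b) <= v <= Num.max (f a) (f b) ->
    exists2 r, r \in `[a, b] & f r = v.
  by apply: IVT => //; rewrite ltW // (lt_trans ac).
have [la|la] := ltP (f a) (f c).
  have [lb|lb] := ltP (f b) (f c).
    exfalso; have := two (Num.max (f a) (f b)).
    rewrite (min_l (ltW la)) (max_r (ltW la)) (min_r (ltW lb)) (max_l (ltW lb)).
    rewrite !ge_max !le_max !lexx (ltW la) (ltW lb) !orbT => /(_ isT isT) e.
    have : Num.max (f a) (f b) < f c by rewrite gt_max la lb.
    by rewrite e ltxx.
  have {}lb : f c < f b by rewrite lt_neqAle eq_sym fbc.
  exists (Num.min (f c - f a) (f b - f c)); first by rewrite lt_min !subr_gt0 la lb.
  move=> v; rewrite lt_min !ltr_norml => /andP[/andP[h1 h2] /andP[h3 h4]].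
  apply: main; rewrite (min_l (ltW (lt_trans la lb))) (max_r (ltW (lt_trans la lb))).
  by apply/andP; split; lra.
have {}la : f c < f a by rewrite lt_neqAle eq_sym fac.
have [lb|lb] := ltP (f b) (f c); last first.
  have {}lb : f c < f b by rewrite lt_neqAle eq_sym fbc.
  exfalso; have := two (Num.min (f a) (f b)).
  rewrite (min_r (ltW la)) (max_l (ltW la)) (min_l (ltW lb)) (max_r (ltW lb)).
  rewrite !le_min !ge_min !lexx (ltW la) (ltW lb) !orbT => /(_ isT isT) e.
  have : f c < Num.min (f a) (f b) by rewrite lt_min la lb.
  by rewrite e ltxx.
exists (Num.min (f a - f c) (f c - f b)); first by rewrite lt_min !subr_gt0 la lb.
move=> v; rewrite lt_min !ltr_norml => /andP[/andP[h1 h2] /andP[h3 h4]].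
apply: main; rewrite (min_r (ltW (lt_trans lb la))) (max_l (ltW (lt_trans lb la))).
by apply/andP; split; lra.
Qed.
End RealLine.

Section GeodesicPath.
Context {R : realType}.
Local Notation V := 'cV[R]_3.
Implicit Types (x : V) (g : V * V).

Lemma continuous_vol3 (p q : V) : bdHyp p -> bdHyp q -> continuous (vol3 p q).
Proof.
move=> bp bq; apply: (@continuous_dist R V R^o _ 6) => x y.
by rewrite -vol3B; exact: vol3_bound.
Qed.

Lemma closed_geod g : ideal g -> closed (geod g).
Proof.
move=> [b1 b2 n12].
have -> : geod g = Hyp `&` vol3 g.1 g.2 @^-1` [set 0].
  apply/seteqP; split => x; rewrite (surjective_pairing g) /=.
    by move=> gx; have Hx : Hyp x := gx.1; split=> //; exact: (geodP b1 b2 n12 Hx).1.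
  by move=> [Hx v0]; exact: (geodP b1 b2 n12 Hx).2.
apply: closedI; first exact: closed_Hyp.
exact: ((continuous_closedP _).1 (continuous_vol3 b1 b2) _ (@closed_eq R 0)).
Qed.

(** Multiplicative parametrization: multiplying one coefficient by [r] and the other by its inverse
    keeps their product, hence the Lorentz norm; [r = 1] is the given point. *)
Lemma geod_path g x : ideal g -> geod g x -> exists c : R -> V,
  [/\ c 1 = x, forall r, 0 < r -> geod g (c r), forall r, 0 < r -> {for r, continuous c} &
      forall r s, 0 < r -> 0 < s -> c r = c s -> r = s].
Proof.
move=> ig gx; have [b1 b2 n12] := ig.
have [a [b [a0 b0 xE ab abd]]] := geod_coef ig gx.
pose c (r : R) : V := r *: (a *: g.1) + r^-1 *: (b *: g.2).
have /bdHypP[h1 _] := b1; have /bdHypP[h2 _] := b2.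
exists c; split.
- by rewrite /c invr1 !scale1r.
- move=> r r0; have r0' : 0 < r^-1 by rewrite invr_gt0.
  split; last by exists (r * a), (r^-1 * b); rewrite !mulr_gt0 //; split; rewrite // /c !scalerA.
  apply/HypP; split.
    by rewrite !mxE h1 h2 !mulr1 addr_gt0 // mulr_gt0 // mulr_gt0.
  have e1 := lorentz_comb (r * a) (r^-1 * b) b1 b2.
  have e2 := lorentz_comb a b b1 b2.
  have lx : lorentz x x = -1 by case: gx => -[].
  have e : lorentz (c r) (c r) = -1.
    rewrite -lx xE e2 /c !scalerA e1.
    by field; rewrite gt_eqF.
  rewrite lorentzE in e; rewrite !expr2; lra.
- move=> r r0; apply: cvgD; apply: cvgZ; try exact: cvg_cst; first exact: cvg_id.
  by apply: inv_continuous; rewrite gt_eqF.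
- suff lt r s : 0 < r -> 0 < s -> r < s -> c r <> c s.
    move=> r s r0 s0 e; apply/eqP; rewrite eq_le !leNgt; apply/andP.
    by split; apply/negP => /lt h; [apply: (h s0 r0)|apply: (h r0 s0)].
  move=> r0 s0 rs e; case/eqP: n12.
  have u0 : 0 < (s - r) * a by rewrite mulr_gt0 // subr_gt0.
  have e' : ((s - r) * a) *: g.1 = ((r^-1 - s^-1) * b) *: g.2.
    rewrite !mulrBl !scalerBl -!scalerA; apply/eqP.
    rewrite subr_eq addrAC eq_sym subr_eq addrC; apply/eqP; move: e; rewrite /c.
    by rewrite [X in X = _]addrC.
  have := congr1 (fun w : V => w i2 0) e'; rewrite !mxE h1 h2 !mulr1 => ee.
  rewrite -ee in e'.
  by apply: (scalerI (lt0r_neq0 u0)).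
Qed.
End GeodesicPath.

(** * Primitives, homotopies and holonomy *)

Section Primitives.
Context {R : realType} {Y : topologicalType} (th : Y -> Y -> R).
Implicit Types (F : R -> Y) (f : R -> R) (p q s t : R).

(** A multiplicative primitive of [th] along the path. The equation is required only between nearby
    parameters, because the cocycle identity holds only locally. *)
Definition primitive_along F f p q := forall t0, t0 \in `[p, q] ->
  exists2 e : R, 0 < e & forall s t, s \in `[p, q] -> t \in `[p, q] ->
    `|s - t0| < e -> `|t - t0| < e -> f t = f s * th (F s) (F t).

Lemma primitive_unique F f1 f2 p q : p <= q -> (forall x y, th x y != 0) ->
  (forall t, f1 t != 0) -> (forall t, f2 t != 0) ->
  primitive_along F f1 p q -> primitive_along F f2 p q ->
  exists2 c : R, c != 0 & forall t, t \in `[p, q] -> f1 t = c * f2 t.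
Proof.
move=> pq th0 n1 n2 h1 h2.
have const : forall s t, s \in `[p, q] -> t \in `[p, q] -> f1 s / f2 s = f1 t / f2 t.
  apply: (locally_constant pq) => t0 t0i.
  have [e1 e10 k1] := h1 t0 t0i; have [e2 e20 k2] := h2 t0 t0i.
  exists (Num.min e1 e2); first by rewrite lt_min e10 e20.
  move=> s t si ti; rewrite !lt_min => /andP[s1 s2] /andP[t1 t2].
  rewrite (k1 s t) // (k2 s t) // invfM mulrACA divff ?mulr1 //.
exists (f1 p / f2 p); first by rewrite mulf_neq0 // invr_eq0.
have ppq : p \in `[p, q] by rewrite in_itv /= lexx.
by move=> t ti; rewrite (const p t) // divfK.
Qed.

Lemma primitive_sub F f p q p' q' : {subset `[p', q'] <= `[p, q]} ->
  primitive_along F f p q -> primitive_along F f p' q'.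
Proof.
move=> sub h t0 /sub t0i; have [e e0 he] := h t0 t0i.
by exists e => // s t /sub si /sub ti; apply: he.
Qed.

Lemma primitive_ext F F' f p q : {in `[p, q], F =1 F'} ->
  primitive_along F f p q -> primitive_along F' f p q.
Proof.
move=> FF h t0 t0i; have [e e0 he] := h t0 t0i.
by exists e => // s t si ti se te; rewrite -!FF //; apply: he.
Qed.

Lemma primitive_const F f p q y : p <= q -> th y y = 1 ->
  {in `[p, q], F =1 fun=> y} -> primitive_along F f p q ->
  forall s t, s \in `[p, q] -> t \in `[p, q] -> f s = f t.
Proof.
move=> pq thy Fy h; apply: (locally_constant pq) => t0 t0i.
have [e e0 he] := h t0 t0i.
by exists e => // s t si ti se te; rewrite (he s t) // !Fy // thy mulr1.
Qed.
End Primitives.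

(** * Hölder estimates on compact arcs *)

Section Hoelder.
Context {R : realType}.

Lemma powR_small (x r th : R) : 0 <= x -> x <= 1 -> 0 < r -> r <= th -> x `^ th <= x `^ r.
Proof.
move=> x0 x1 r0 rth; have [->|xn0] := eqVneq x 0.
  by rewrite !powR0 ?gt_eqF // (lt_le_trans r0).
by apply: ger_powR => //; rewrite x1 lt_neqAle eq_sym xn0 x0.
Qed.

Lemma powR_ge_small (x m r : R) : 0 < m -> m <= 1 -> m <= x -> 0 < r -> r <= 1 ->
  m <= x `^ r.
Proof.
move=> m0 m1 mx r0 r1; have x0 : 0 < x by exact: lt_le_trans mx.
have [x1|x1] := leP x 1.
  by apply: le_trans mx _; rewrite -[leLHS]powRr1 ?(ltW x0) //; apply: powR_small => //; exact: ltW.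
apply: le_trans m1 _; rewrite -(powRr0 x); apply: ler_powR; exact: ltW.
Qed.

(** From local to global Hölder continuity by compactness of the square of pairs of parameters: the
    hypothesis applies near the diagonal; elsewhere [f] is locally bounded while the points stay a
    definite distance apart. *)
Lemma hoelder_compact (V W : normedModType R) (a : R -> V) (f : V -> W) (Z : set V) :
  {within `[0, 1], continuous a} ->
  (forall s t, s \in `[0, 1] -> t \in `[0, 1] -> a s = a t -> s = t) ->
  (forall t0, t0 \in `[0, 1] -> exists d K th : R, [/\ 0 < d, 0 <= K, 0 < th &
     forall y z, Z y -> Z z -> `|y - a t0| < d -> `|z - a t0| < d ->
       `|f y - f z| <= K * `|y - z| `^ th]) ->
  exists K th : R, 0 < th /\ forall t u, t \in `[0, 1] -> u \in `[0, 1] ->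
    Z (a t) -> Z (a u) -> `|f (a t) - f (a u)| <= K * `|a t - a u| `^ th.
Proof.
move=> /within_continuous_distP ca inja loc.
(* A single [r] is both the exponent and the inverse of the constant, so that near each pair of
   parameters every sufficiently small [r] works. *)
pose P (r : R) (w : R * R) := w.1 \in `[0, 1] -> w.2 \in `[0, 1] ->
  Z (a w.1) -> Z (a w.2) ->
  `|f (a w.1) - f (a w.2)| <= r^-1 * `|a w.1 - a w.2| `^ r.
suff [r r0 hr] : exists2 r : R, 0 < r &
    `[0, 1]%classic `*` `[0, 1]%classic `<=` P r.
  exists r^-1, r; split=> // t u t01 u01 Zt Zu.
  exact: (hr (t, u) (conj t01 u01)).
have /compact_near_coveringP/(_ R (0^'+) P) := @square_compact R.
case; last first.
  move=> d /= d0 hd; have d2 : 0 < d / 2 by rewrite divr_gt0.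
  exists (d / 2) => //; apply: (hd (d / 2) _ d2).
  by rewrite /ball /= sub0r normrN gtr0_norm // ltr_pdivrMr // ltr_pMr // ltr1n.
move=> [t0 u0] [/= t001 u001].
have near_pair (e1 e2 r0 : R) : 0 < e1 -> 0 < e2 -> 0 < r0 ->
    (forall t u r, t \in `[0, 1] -> u \in `[0, 1] -> Z (a t) -> Z (a u) ->
      `|t - t0| < e1 -> `|u - u0| < e2 -> 0 < r -> r < r0 ->
      `|f (a t) - f (a u)| <= r^-1 * `|a t - a u| `^ r) ->
    \forall w \near (t0, u0) & r \near (0 : R)^'+, P r w.
  move=> e10 e20 r00 h.
  pose e := Num.min e1 e2.
  have e0 : 0 < e by rewrite lt_min e10 e20.
  exists (ball (t0, u0) e, [set r | 0 < r /\ r < r0]).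
    split; first by apply: nbhsx_ballx.
    near=> r; split; first by near: r; exact: nbhs_right_gt.
    by near: r; exact: nbhs_right_lt.
  move=> [[t u] r] /= [[bt bu] [rpos rr0]] /= t01 u01 Zt Zu; apply: h => //.
    by move: bt; rewrite -ball_normE /= distrC lt_min => /andP[].
  by move: bu; rewrite -ball_normE /= distrC lt_min => /andP[].
have [tu|tu] := eqVneq t0 u0.
  subst u0; have [d [K [th [d0 K0 th0 hd]]]] := loc t0 t001.
  pose d' := Num.min d 2^-1.
  have d'0 : 0 < d' by rewrite lt_min d0 /=; lra.
  have [e e0 he] := ca t0 t001 d' d'0.
  pose r0 := Num.min th (K + 1)^-1.
  have K1 : 0 < K + 1 by rewrite ltr_wpDl.
  have r00 : 0 < r0 by rewrite lt_min th0 invr_gt0.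
  apply: (near_pair e e r0) => // t u r t01 u01 Zt Zu te ue rpos rr0.
  have := he t t01 te; rewrite lt_min => /andP[t1 t2].
  have := he u u01 ue; rewrite lt_min => /andP[u1 u2].
  apply: le_trans (hd _ _ Zt Zu t1 u1) _.
  have x1 : `|a t - a u| <= 1.
    by have := ler_distD (a t0) (a t) (a u); rewrite (distrC (a t0) (a u)); lra.
  have rth : r <= th by apply: ltW; apply: lt_le_trans rr0 _; rewrite ge_min lexx.
  have rK : r <= (K + 1)^-1.
    by apply: ltW; apply: lt_le_trans rr0 _; rewrite ge_min lexx orbT.
  have Kr : K <= r^-1.
    apply: (@le_trans _ _ (K + 1)); first by rewrite lerDl.
    by rewrite -[leLHS]invrK lef_pV2 ?posrE ?invr_gt0.
  by apply: ler_pM => //; rewrite ?powR_ge0 //; exact: powR_small.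
have bound t1 : t1 \in `[0, 1] -> exists2 M : R, 0 <= M & exists2 e : R, 0 < e &
    forall t, t \in `[0, 1] -> Z (a t) -> `|t - t1| < e -> `|f (a t)| <= M.
  move=> t101; have [d [K [th [d0 K0 th0 hd]]]] := loc t1 t101.
  pose d' := Num.min d 2^-1.
  have d'0 : 0 < d' by rewrite lt_min d0 /=; lra.
  have [e e0 he] := ca t1 t101 d' d'0.
  have [[t2 [t201 Zt2 t2e]]|none] := pselect (exists t, [/\ t \in `[0, 1], Z (a t) & `|t - t1| < e]).
    exists (`|f (a t2)| + K); first by rewrite addr_ge0.
    exists e => // t t01 Zt te.
    have := he t t01 te; rewrite lt_min => /andP[h1 h2].
    have := he t2 t201 t2e; rewrite lt_min => /andP[h3 h4].
    have := hd _ _ Zt Zt2 h1 h3.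
    have x1 : `|a t - a t2| <= 1.
      by have := ler_distD (a t1) (a t) (a t2); rewrite (distrC (a t1) (a t2)); lra.
    have p1 : `|a t - a t2| `^ th <= 1.
      have := @ge0_ler_powR R th (ltW th0) `|a t - a t2| 1.
      by rewrite powR1 !nnegrE => h; apply: h.
    move=> hK; have K1 := ler_wpM2l K0 p1.
    have := ler_normD (f (a t) - f (a t2)) (f (a t2)); rewrite subrK; lra.
  exists 0 => //; exists e => // t t01 Zt te.
  by case: none; exists t.
have [M1 M10 [e1 e10 h1]] := bound t0 t001.
have [M2 M20 [e2 e20 h2]] := bound u0 u001.
have m0 : 0 < `|a t0 - a u0|.
  by rewrite normr_gt0 subr_eq0; apply: contraNneq tu => e; apply/eqP/inja.
(* Points within a third of the distance of [a t0] and [a u0] remain at least that far apart; the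
   cap 1 is what [powR_ge_small] requires. *)
pose m := Num.min (`|a t0 - a u0| / 3) 1.
have m_gt0 : 0 < m by rewrite lt_min divr_gt0 // ltr01.
have m3 : m <= `|a t0 - a u0| / 3 by rewrite ge_min lexx.
have m1 : m <= 1 by rewrite ge_min lexx orbT.
have [e3 e30 h3] := ca t0 t001 m m_gt0; have [e4 e40 h4] := ca u0 u001 m m_gt0.
pose r0 := Num.min 1 (m / (M1 + M2 + 1)).
have MM : 0 < M1 + M2 + 1 by rewrite ltr_wpDl // addr_ge0.
have r00 : 0 < r0 by rewrite lt_min ltr01 divr_gt0.
apply: (near_pair (Num.min e1 e3) (Num.min e2 e4) r0) => //.
- by rewrite lt_min e10 e30.
- by rewrite lt_min e20 e40.
move=> t u r t01 u01 Zt Zu; rewrite !lt_min => /andP[t1 t3] /andP[u2 u4] rpos /andP[r1 rM].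
have b1 := h1 t t01 Zt t1; have b2 := h2 u u01 Zu u2.
have b3 := h3 t t01 t3; have b4 := h4 u u01 u4.
have far : m <= `|a t - a u|.
  have := ler_distD (a t) (a t0) (a u0); have := ler_distD (a u) (a t) (a u0).
  rewrite (distrC (a t0) (a t)); lra.
have xr := powR_ge_small m_gt0 m1 far rpos (ltW r1).
apply: (@le_trans _ _ (M1 + M2)).
  by have := ler_normB (f (a t)) (f (a u)); lra.
apply: (@le_trans _ _ (r^-1 * m)); last by rewrite ler_wpM2l // invr_ge0 ltW.
rewrite mulrC ler_pdivlMr //; move: rM; rewrite ltr_pdivlMr // => rM.
have : r * (M1 + M2) <= r * (M1 + M2 + 1) by rewrite ler_wpM2l ?ltW // ltrDl ltr01.
by rewrite mulrC; lra.
Unshelve. all: by end_near.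
Qed.
End Hoelder.

Lemma within_comp (T U W : topologicalType) (D : set T) (E : set U) (f : U -> W)
    (u : T -> U) : {within E, continuous f} -> {within D, continuous u} ->
  (forall x, D x -> E (u x)) -> {within D, continuous (fun x => f (u x))}.
Proof.
move=> /within_continuousP cf /within_continuousP cu DE.
apply/within_continuousP => x Dx O nO.
have h := cf (u x) (DE x Dx) O nO.
have := cu x Dx _ h; apply: filterS => y hy Dy; exact: hy Dy (DE y Dy).
Qed.

Lemma within_glue (T U : topologicalType) (A B : set T) (f g h : T -> U) :
  closed A -> closed B -> {within A, continuous f} -> {within B, continuous g} ->
  (forall x, A x -> h x = f x) -> (forall x, B x -> h x = g x) ->
  {within A `|` B, continuous h}.
Proof.
move=> cA cB cf cg hf hg; apply: withinU_continuous => //.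
- apply/within_continuousP => x Ax O; rewrite (hf x Ax) => nO.
  have := (within_continuousP _ _).1 cf x Ax O nO.
  by apply: filterS => y hy Ay; rewrite (hf y Ay); exact: hy.
- apply/within_continuousP => x Bx O; rewrite (hg x Bx) => nO.
  have := (within_continuousP _ _).1 cg x Bx O nO.
  by apply: filterS => y hy By; rewrite (hg y By); exact: hy.
Qed.

Lemma pair_continuous (T U W : topologicalType) (f : T -> U) (g : T -> W) :
  continuous f -> continuous g -> continuous (fun z => (f z, g z)).
Proof. by move=> cf cg z; exact: (cvg_pair (cf z) (cg z)). Qed.

Lemma scale_continuous (R : realType) (T : topologicalType) (a : R) (f : T -> R) :
  continuous f -> continuous (fun z => a * f z).
Proof.
move=> cf z; apply: (@continuousM _ _ (cst a) f); [exact: cst_continuous|exact: cf].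
Qed.

Lemma affine_continuous (R : realType) (T : topologicalType) (a b : R) (f : T -> R) :
  continuous f -> continuous (fun z => a * f z + b).
Proof.
move=> cf z; apply: (@continuousD _ _ _ (fun z => a * f z) (cst b)); last exact: cst_continuous.
exact: scale_continuous.
Qed.

Lemma fst_continuous (T U : topologicalType) : continuous (fst : T * U -> T).
Proof. by move=> z; exact: cvg_fst. Qed.

Lemma snd_continuous (T U : topologicalType) : continuous (snd : T * U -> U).
Proof. by move=> z; exact: cvg_snd. Qed.

(** * Homotopies of paths with fixed ends *)

Section Paths.
Context {R : realType}.
Local Notation II := (`[0, 1]%classic `*` `[0, 1]%classic : set (R * R)).

Lemma loop_cat_continuous (T : topologicalType) (f g : R -> T) :
  {within `[0, 1], continuous f} -> {within `[0, 1], continuous g} -> f 1 = g 0 ->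
  {within `[0, 1], continuous (loop_cat f g)}.
Proof.
move=> cf cg fg.
have -> : [set` `[0, 1]] = `[0, 2^-1]%classic `|` `[2^-1, 1]%classic :> set R.
  apply/seteqP; split=> t /=; rewrite !in_itv /=.
    by move=> /andP[t0 t1]; case: (leP t 2^-1) => h; [left|right]; rewrite ?t0 ?t1 // ltW.
  by case=> /andP[t0 t1]; apply/andP; split; lra.
apply: (@within_glue R T _ _ (fun t : R => f (2 * t)) (fun t : R => g (2 * t - 1))).
- exact: itv_closed.
- exact: itv_closed.
- apply: (within_comp cf).
    exact: (continuous_subspaceT (scale_continuous (a := 2) (fun t : R => cvg_id))).
  by move=> t; rewrite /= !in_itv /= => /andP[t0 t1]; apply/andP; split; lra.
- apply: (within_comp cg).
    by apply: continuous_subspaceT; apply: (@affine_continuous R R 2 (-1) id) => t; exact: cvg_id.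
  by move=> t; rewrite /= !in_itv /= => /andP[t0 t1]; apply/andP; split; lra.
- by move=> t; rewrite /= in_itv /= /loop_cat => /andP[_ ->].
- move=> t; rewrite /= in_itv /= /loop_cat => /andP[t0 t1].
  case: ifP => // t2; have -> : t = 2^-1 by apply/eqP; rewrite eq_le t2.
  by rewrite divff // subrr fg.
Qed.

Definition path_homotopic (T : topologicalType) (F G : R -> T) := exists K : R -> R -> T,
  [/\ {within `[0, 1] `*` `[0, 1], continuous (fun z : R * R => K z.1 z.2)},
      (forall u, u \in `[0, 1] -> K u 0 = F 0 /\ K u 1 = F 1),
      (forall t, t \in `[0, 1] -> K 0 t = F t) &
      (forall t, t \in `[0, 1] -> K 1 t = G t)].

Lemma closed_le_comp (T : topologicalType) (f : T -> R) (b : R) : continuous f ->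
  closed [set z | f z <= b] /\ closed [set z | b <= f z].
Proof.
move=> cf; split.
  by apply: (@closed_comp _ _ f [set x | x <= b]) => //; exact: closed_le.
by apply: (@closed_comp _ _ f [set x | b <= x]) => //; exact: closed_ge.
Qed.

Lemma square_halves (f : R * R -> R) : continuous f ->
  [/\ II `<=` (II `&` [set z | f z <= 2^-1]) `|` (II `&` [set z | 2^-1 <= f z]),
     closed (II `&` [set z | f z <= 2^-1]) & closed (II `&` [set z | 2^-1 <= f z])].
Proof.
move=> cf; have [c1 c2] := closed_le_comp 2^-1 cf.
have cI : closed II by apply: compact_closedRR; exact: square_compact.
split; [|exact: closedI|exact: closedI].
by move=> z zI; case: (leP (f z) 2^-1) => h; [left|right; split=> //; exact: ltW].
Qed.

Lemma path_homotopic_ends (T : topologicalType) (F G : R -> T) :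
  path_homotopic F G -> F 0 = G 0 /\ F 1 = G 1.
Proof.
move=> [K [_ e _ k1]].
have z1 : (1 : R) \in `[0, 1] by rewrite in_itv /= lexx ler01.
have z0 : (0 : R) \in `[0, 1] by rewrite in_itv /= lexx ler01.
by have [<- <-] := e 1 z1; rewrite !k1.
Qed.

Lemma path_homotopic_trans (T : topologicalType) (F G J : R -> T) :
  path_homotopic F G -> path_homotopic G J -> path_homotopic F J.
Proof.
move=> FG; have [FG0 FG1] := path_homotopic_ends FG; move: FG.
move=> [K [cK eK K0 K1]] [M [cM eM M0 M1]].
exists (fun u t => if u <= 2^-1 then K (2 * u) t else M (2 * u - 1) t); split.
- have [eI cl1 cl2] := square_halves (fun z : R * R => cvg_fst : {for z, continuous fst}).
  apply: (continuous_subspaceW eI).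
  apply: (@within_glue _ _ _ _ (fun z : R * R => K (2 * z.1) z.2)
      (fun z => M (2 * z.1 - 1) z.2)).
  + exact: cl1.
  + exact: cl2.
  + apply: (within_comp (u := fun z : R * R => (2 * z.1, z.2)) cK).
      apply: continuous_subspaceT; apply: pair_continuous; last exact: snd_continuous.
      exact: (scale_continuous (a := 2) (@fst_continuous _ _)).
    move=> [u t] /= [[]]; rewrite /= !in_itv /= => /andP[u0 u1] t01 uh.
    by split=> //; apply/andP; split; lra.
  + apply: (within_comp (u := fun z : R * R => (2 * z.1 - 1, z.2)) cM).
      apply: continuous_subspaceT; apply: pair_continuous; last exact: snd_continuous.
      exact: (@affine_continuous R _ 2 (-1) fst (@fst_continuous _ _)).
    move=> [u t] /= [[]]; rewrite /= !in_itv /= => /andP[u0 u1] t01 uh.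
    by split=> //; apply/andP; split; lra.
  + by move=> z [_ /= ->].
  + move=> [u t] [[_ /= t01] /= uh]; case: ifP => // u2.
    have -> : u = 2^-1 by apply/eqP; rewrite eq_le u2.
    by rewrite divff // subrr K1 // M0.
- move=> u; rewrite in_itv /= => /andP[u0 u1]; case: ifPn => uh.
    by apply: eK; rewrite in_itv /=; apply/andP; split; lra.
  rewrite -ltNge in uh; rewrite FG0 FG1.
  by apply: eM; rewrite in_itv /=; apply/andP; split; lra.
- move=> t t01; rewrite ifT; last by lra.
  by rewrite mulr0 K0.
- move=> t t01; rewrite ifF; last by apply/negbTE; rewrite -ltNge; lra.
  by rewrite mulr1 (_ : 2 - 1 = 1) ?M1 //; lra.
Qed.

Lemma path_homotopic_cat (T : topologicalType) (F G F' G' : R -> T) :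
  path_homotopic F G -> path_homotopic F' G' -> F 1 = F' 0 ->
  path_homotopic (loop_cat F F') (loop_cat G G').
Proof.
move=> [K [cK eK K0 K1]] [M [cM eM M0 M1]] FF.
exists (fun u => loop_cat (K u) (M u)); split.
- have [eI cl1 cl2] := square_halves (fun z : R * R => cvg_snd : {for z, continuous snd}).
  apply: (continuous_subspaceW eI).
  apply: (@within_glue _ _ _ _ (fun z : R * R => K z.1 (2 * z.2))
      (fun z => M z.1 (2 * z.2 - 1))).
  + exact: cl1.
  + exact: cl2.
  + apply: (within_comp (u := fun z : R * R => (z.1, 2 * z.2)) cK).
      apply: continuous_subspaceT; apply: pair_continuous; first exact: fst_continuous.
      exact: (scale_continuous (a := 2) (@snd_continuous _ _)).
    move=> [u t] /= [[]]; rewrite /= !in_itv /= => u01 /andP[t0 t1] th.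
    by split=> //; apply/andP; split; lra.
  + apply: (within_comp (u := fun z : R * R => (z.1, 2 * z.2 - 1)) cM).
      apply: continuous_subspaceT; apply: pair_continuous; first exact: fst_continuous.
      exact: (@affine_continuous R _ 2 (-1) snd (@snd_continuous _ _)).
    move=> [u t] /= [[]]; rewrite /= !in_itv /= => u01 /andP[t0 t1] th.
    by split=> //; apply/andP; split; lra.
  + by move=> z [_ /= th]; rewrite /loop_cat th.
  + move=> [u t] [[/= u01 _] /= th]; rewrite /loop_cat; case: ifP => // t2.
    have -> : t = 2^-1 by apply/eqP; rewrite eq_le t2.
    by rewrite divff // subrr (eK u u01).2 (eM u u01).1.
- have h0 : (0 : R) <= 2^-1 by lra.
  have h1 : (1 <= 2^-1 :> R) = false by apply/negbTE; rewrite -ltNge; lra.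
  have e1 : (2 * 1 - 1 : R) = 1 by lra.
  by move=> u u01; rewrite /loop_cat h0 h1 mulr0 e1 (eK u u01).1 (eM u u01).2.
- move=> t; rewrite in_itv /= /loop_cat => /andP[t0 t1]; case: ifPn => th.
    by apply: K0; rewrite in_itv /=; apply/andP; split; lra.
  rewrite -ltNge in th.
  by apply: M0; rewrite in_itv /=; apply/andP; split; lra.
- move=> t; rewrite in_itv /= /loop_cat => /andP[t0 t1]; case: ifPn => th.
    by apply: K1; rewrite in_itv /=; apply/andP; split; lra.
  rewrite -ltNge in th.
  by apply: M1; rewrite in_itv /=; apply/andP; split; lra.
Qed.

Lemma path_homotopic_reparam (T : topologicalType) (F : R -> T) (a b : R -> R) :
  {within `[0, 1], continuous F} ->
  {within `[0, 1], continuous a} -> {within `[0, 1], continuous b} ->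
  (forall t, t \in `[0, 1] -> a t \in `[0, 1]) ->
  (forall t, t \in `[0, 1] -> b t \in `[0, 1]) -> a 0 = b 0 -> a 1 = b 1 ->
  path_homotopic (fun t => F (a t)) (fun t => F (b t)).
Proof.
move=> cF ca cb a01 b01 e0 e1.
exists (fun u t => F ((1 - u) * a t + u * b t)); split.
- apply: (within_comp (u := fun z : R * R => (1 - z.1) * a z.2 + z.1 * b z.2) cF).
    have c2 (f : R -> R) : {within `[0, 1], continuous f} ->
        {within II, continuous (fun z : R * R => f z.2)}.
      move=> cf; apply: (within_comp (u := snd) cf); last by move=> z [].
      by apply: continuous_subspaceT => z; exact: cvg_snd.
    move=> z; apply: cvgD; apply: cvgM.
    + apply: cvgB; first exact: cvg_cst.
      by apply: continuous_subspaceT => w; exact: cvg_fst.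
    + exact: c2.
    + by apply: continuous_subspaceT => w; exact: cvg_fst.
    + exact: c2.
  move=> [u t] /= [/=]; rewrite /= in_itv /= => /andP[u0 u1] t01.
  have := a01 t t01; have := b01 t t01; rewrite !in_itv /= => /andP[b0 b1] /andP[a0 a1].
  have [u0' u1'] : 0 <= 1 - u /\ 0 <= 1 - b t by rewrite !subr_ge0.
  apply/andP; split; first by rewrite addr_ge0 // mulr_ge0.
  by nra.
- move=> u _; rewrite -e0 -e1; split; congr (F _); ring.
- by move=> t _; congr (F _); ring.
- by move=> t _; congr (F _); ring.
Qed.

Lemma path_homotopic_eq (T : topologicalType) (F G : R -> T) :
  {within `[0, 1], continuous G} -> (forall t : R, t \in `[0, 1] -> F t = G t) ->
  path_homotopic F G.
Proof.
move=> cG FG; exists (fun=> G); split=> //.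
- apply: (within_comp (u := snd) cG); last by move=> z [].
  by apply: continuous_subspaceT => z; exact: cvg_snd.
- by move=> u _; rewrite !FG // in_itv /= lexx ler01.
- by move=> t t01; rewrite FG.
Qed.

Lemma path_homotopic_extl (T : topologicalType) (F F' G : R -> T) :
  (forall t : R, t \in `[0, 1] -> F' t = F t) -> path_homotopic F G ->
  path_homotopic F' G.
Proof.
move=> FF [K [cK eK K0 K1]]; exists K; split=> // [u u01|t t01]; last by rewrite K0 // FF.
by rewrite !FF ?in_itv /= ?lexx ?ler01 //; exact: eK.
Qed.

(** The concatenation is itself a reparametrization of [F]. With one of the reparametrizations
    constant, this also inserts or removes a stationary piece. *)
Lemma path_homotopic_split (T : topologicalType) (F : R -> T) (a b : R -> R) :
  {within `[0, 1], continuous F} ->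
  {within `[0, 1], continuous a} -> {within `[0, 1], continuous b} ->
  (forall t, t \in `[0, 1] -> a t \in `[0, 1]) ->
  (forall t, t \in `[0, 1] -> b t \in `[0, 1]) -> a 0 = 0 -> a 1 = b 0 -> b 1 = 1 ->
  path_homotopic F (loop_cat (fun t => F (a t)) (fun t => F (b t))).
Proof.
move=> cF ca cb a01 b01 a0 ab b1.
have -> : loop_cat (fun t => F (a t)) (fun t => F (b t)) = (fun t => F (loop_cat a b t)).
  by apply/funext => t; rewrite /loop_cat; case: ifP.
apply: (path_homotopic_reparam (a := id) cF) => //.
- by apply: continuous_subspaceT => t; exact: cvg_id.
- exact: loop_cat_continuous.
- move=> t; rewrite in_itv /= /loop_cat => /andP[t0 t1]; case: ifPn => th.
    by apply: a01; rewrite in_itv /=; apply/andP; split; lra.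
  rewrite -ltNge in th; by apply: b01; rewrite in_itv /=; apply/andP; split; lra.
- by rewrite /loop_cat ifT ?mulr0 //; lra.
- rewrite /loop_cat ifF; last by apply/negbTE; rewrite -ltNge; lra.
  by rewrite (_ : 2 * 1 - 1 = 1) //; lra.
Qed.
End Paths.

Section UnitInterval.
Context {R : realType}.
Implicit Types s t u e d : R.

Lemma oo01 s : s \in `]0, 1[ -> s \in `[0, 1].
Proof. by rewrite !in_itv /= => /andP[/ltW-> /ltW->]. Qed.

Lemma z01 : (0 : R) \in `[0, 1]. Proof. by rewrite in_itv /= lexx ler01. Qed.

Lemma end01 s : s \in `[0, 1] -> s \notin `]0, 1[ -> s = 0 \/ s = 1.
Proof.
rewrite !in_itv /= negb_and -!leNgt => /andP[s0 s1] /orP[l|l]; [left|right].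
  by apply/eqP; rewrite eq_le l s0.
by apply/eqP; rewrite eq_le l s1.
Qed.

Lemma oo_nbhs s : s \in `]0, 1[ -> exists2 e : R, 0 < e &
  forall s' : R, `|s' - s| <= e -> s' \in `]0, 1[.
Proof.
rewrite in_itv /= => /andP[s0 s1].
exists (Num.min s (1 - s) / 2); first by rewrite divr_gt0 // lt_min s0 subr_gt0.
move=> s'; set m := Num.min _ _.
have m1 : m <= s by rewrite ge_min lexx.
have m2 : m <= 1 - s by rewrite ge_min lexx orbT.
have m0 : 0 < m by rewrite lt_min s0 subr_gt0.
rewrite ler_norml in_itv /= => /andP[h1 h2]; apply/andP; split; lra.
Qed.

Lemma half_oo : (2^-1 : R) \in `]0, 1[.
Proof. by rewrite in_itv /=; apply/andP; split; lra. Qed.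

Lemma one01 : (1 : R) \in `[0, 1]. Proof. by rewrite in_itv /= lexx ler01. Qed.

Lemma zero_noo : (0 : R) \notin `]0, 1[. Proof. by rewrite in_itv /= ltxx. Qed.

Lemma one_noo : (1 : R) \notin `]0, 1[. Proof. by rewrite in_itv /= ltxx andbF. Qed.

(** Two points of an edge within a quarter of its ends cannot straddle the midpoint at distance less
    than one half. The bounds of [passes] and [near_vertex] are matched by this. *)
Lemma star_gap (u w : R) : u <= 2^-1 -> 2^-1 < w -> w - u < 2^-1 ->
  u < 4^-1 \/ 1 - 4^-1 < u -> w < 4^-1 \/ 1 - 4^-1 < w -> False.
Proof. by move=> h1 h2 h3 [l1|l1] [l2|l2]; lra. Qed.

Lemma itv_dist s : s \in `]0, 1[ -> exists2 d : R, 0 < d &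
  forall s', s' \notin `]0, 1[ -> d <= `|s' - s|.
Proof.
move=> soo; have [e e0 he] := oo_nbhs soo.
exists e => // s' s'oo; rewrite leNgt; apply/negP => l.
by move/negP: s'oo; apply; apply: he; exact: ltW.
Qed.

Lemma segment01 s e u : s \in `[0, 1] -> e \in `[0, 1] -> u \in `[0, 1] ->
  s + u * (e - s) \in `[0, 1].
Proof.
rewrite !in_itv /= => /andP[s0 s1] /andP[e0 e1] /andP[u0 u1]; apply/andP; split; nra.
Qed.

(** The radial parameter of the homotopy used in a star: zero at both ends of the path and, for
    [u = 1], equal to 1 on the middle half of the interval. *)
Definition tent (u t : R) : R := Num.min u (Num.min (4 * t) (4 * (1 - t))).

(** A clock that runs only during the middle half, so that for [u = 1] the path moves only while
    [tent] keeps it at the centre of the star. *)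
Definition slow (t : R) : R := Num.max 0 (Num.min 1 (2 * t - 2^-1)).

Lemma tent01 u t : u \in `[0, 1] -> t \in `[0, 1] -> tent u t \in `[0, 1].
Proof.
rewrite !in_itv /= => /andP[u0 u1] /andP[t0 t1]; apply/andP; split.
  by rewrite /tent !le_min u0 /= !mulr_ge0 // subr_ge0.
by rewrite /tent ge_min u1.
Qed.

Lemma tent0 t : t \in `[0, 1] -> tent 0 t = 0.
Proof.
rewrite in_itv /= => /andP[t0 t1]; rewrite /tent min_l //.
by rewrite le_min !mulr_ge0 // subr_ge0.
Qed.

Lemma tent_end u : u \in `[0, 1] -> tent u 0 = 0 /\ tent u 1 = 0.
Proof.
rewrite in_itv /= => /andP[u0 u1]; rewrite /tent subrr mulr0 subr0 mulr1; split.
  by rewrite (min_l (_ : 0 <= 4)) // min_r.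
by rewrite (min_r (_ : 0 <= 4)) // min_r.
Qed.

Lemma tent1 t : [/\ t <= 4^-1 -> tent 1 t = 4 * t,
  4^-1 <= t -> t <= 1 - 4^-1 -> tent 1 t = 1 & 1 - 4^-1 <= t -> tent 1 t = 4 * (1 - t)].
Proof.
rewrite /tent; split=> [h|h h'|h].
- by rewrite (min_l (_ : 4 * t <= _)) ?min_r //; lra.
- by rewrite min_l // le_min; apply/andP; split; lra.
- by rewrite (min_r (_ : _ <= 4 * t)) ?min_r //; lra.
Qed.

Lemma slowE t : [/\ t <= 4^-1 -> slow t = 0, 1 - 4^-1 <= t -> slow t = 1 &
  slow t \in `[0, 1]].
Proof.
rewrite /slow; split=> [h|h|].
- by rewrite max_l // ge_min; apply/orP; right; lra.
- by rewrite min_l ?max_r //; lra.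
- by rewrite in_itv /= le_max lexx /= ge_max ler01 ge_min lexx.
Qed.

Lemma tent_continuous : continuous (fun z : R * R => tent z.1 z.2).
Proof.
move=> z; apply: continuous_min; first exact: cvg_fst.
apply: continuous_min.
  by apply: cvgM; [exact: cvg_cst|exact: cvg_snd].
by apply: cvgM; [exact: cvg_cst|apply: cvgB; [exact: cvg_cst|exact: cvg_snd]].
Qed.

Lemma slow_continuous : continuous slow.
Proof.
move=> t; apply: (@continuous_max R R (cst 0) (fun t => Num.min 1 (2 * t - 2^-1))).
  exact: cvg_cst.
apply: (@continuous_min R R (cst 1) (fun t => 2 * t - 2^-1)); first exact: cvg_cst.
apply: cvgB; last exact: cvg_cst.
by apply: cvgM; [exact: cvg_cst|exact: cvg_id].
Qed.

Lemma affine_within (D : set R) (a b : R) : {within D, continuous (fun t : R => a + t * b)}.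
Proof.
apply: continuous_subspaceT => t; apply: cvgD; first exact: cvg_cst.
by apply: cvgM; [exact: cvg_id|exact: cvg_cst].
Qed.

End UnitInterval.

(** * The character defined by a local cocycle *)

Section Holonomy.
Context {R : realType} {Y : topologicalType} (th : Y -> Y -> R).
Hypothesis th_neq0 : forall x y, th x y != 0.
Hypothesis th_refl : forall x, th x x = 1.
Hypothesis th_cocycle : forall y0 : Y, exists2 W : set Y, nbhs y0 W &
  forall x y z, W x -> W y -> W z -> th x y * th y z = th x z.
Implicit Types F G f : R -> Y.

Lemma primitive_exists F : {within `[0, 1], continuous F} ->
  exists2 phi : R -> R, (forall t, phi t != 0) & primitive_along th F phi 0 1.
Proof.
move=> /(path_primitive th_neq0 th_cocycle)[phi [d [d0 phi0 hphi]]].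
exists phi => // t0 t001; have d2 : 0 < d / 2 by rewrite divr_gt0.
exists (d / 2) => // s t s01 t01 st tt; apply: hphi => //.
have := ler_distD t0 t s; rewrite (distrC t0 s); lra.
Qed.

(** The value at 0 is divided by the value at 1, not conversely, because holonomy is transport
    around the reversed path. *)
Definition holonomy F : R :=
  xget 1 [set r | exists phi : R -> R, [/\ (forall t, phi t != 0),
    primitive_along th F phi 0 1 & r = phi 0 / phi 1]].

Lemma holonomyE F (phi : R -> R) : (forall t, phi t != 0) ->
  primitive_along th F phi 0 1 -> holonomy F = phi 0 / phi 1.
Proof.
move=> phi0 hphi; rewrite /holonomy; case: xgetP => [r _ [psi [psi0 hpsi ->]]|h].
  have [c c0 e] := primitive_unique ler01 th_neq0 psi0 phi0 hpsi hphi.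
  by rewrite !e ?(@z01 R) ?(@one01 R) // invfM mulrACA divff // mul1r.
by exfalso; apply: (h (phi 0 / phi 1)); exists phi.
Qed.

Lemma holonomy_neq0 F : {within `[0, 1], continuous F} -> holonomy F != 0.
Proof.
move=> /primitive_exists[phi phi0 hphi].
by rewrite (holonomyE phi0 hphi) mulf_neq0 // invr_neq0.
Qed.

Lemma primitive_reparam F (phi : R -> R) (u : R -> R) (k p q p' q' : R) : 0 < k ->
  (forall s t, `|u s - u t| <= k * `|s - t|) ->
  (forall t, t \in `[p', q'] -> u t \in `[p, q]) ->
  primitive_along th F phi p q ->
  primitive_along th (fun t => F (u t)) (fun t => phi (u t)) p' q'.
Proof.
move=> k0 uk u01 h t0 /u01/h[e e0 he]; exists (e / k); first exact: divr_gt0.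
move=> s t /u01 s01 /u01 t01; rewrite !ltr_pdivlMr // => st tt; apply: he => //.
  by apply: le_lt_trans (uk _ _) _; rewrite mulrC.
by apply: le_lt_trans (uk _ _) _; rewrite mulrC.
Qed.

(** A primitive on the homotopy square restricts to a primitive on each row. On the two sides along
    which the homotopy stays at [b] it is constant, so the end ratios of the first and last rows
    agree. *)
Lemma holonomy_homotopic b F G : loop_homotopic b F G -> holonomy F = holonomy G.
Proof.
move=> [K [cK Kb K0 K1]].
have [phi [d [d0 phi0 hphi]]] := square_primitive th_neq0 th_cocycle cK.
have d2 : 0 < d / 2 by rewrite divr_gt0.
have near3 (t0 s t : R) : `|s - t0| < d / 2 -> `|t - t0| < d / 2 -> `|t - s| < d.
  by move=> h1 h2; have := ler_distD t0 t s; rewrite (distrC t0 s); lra.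
have pr1 u : u \in `[0, 1] -> primitive_along th (K u) (phi u) 0 1.
  move=> u01 t0 t001; exists (d / 2) => // s t s01 t01 st tt.
  by apply: hphi => //; [rewrite subrr normr0|exact: near3 st tt].
have pr2 t : t \in `[0, 1] -> primitive_along th (K^~ t) (phi^~ t) 0 1.
  move=> t01 t0 t001; exists (d / 2) => // s u s01 u01 st tt.
  by apply: hphi => //; [exact: near3 st tt|rewrite subrr normr0].
have z0 := @z01 R; have o1 := @one01 R.
have e0 := primitive_const ler01 (th_refl b) (fun u u01 => (Kb u u01).1) (pr2 0 z0) z0 o1.
have e1 := primitive_const ler01 (th_refl b) (fun u u01 => (Kb u u01).2) (pr2 1 o1) z0 o1.
rewrite (holonomyE (phi0 0) (primitive_ext K0 (pr1 0 z0))).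
by rewrite (holonomyE (phi0 1) (primitive_ext K1 (pr1 1 o1))) e0 e1.
Qed.

Lemma holonomy_cat F G : {within `[0, 1], continuous F} ->
  {within `[0, 1], continuous G} -> F 1 = G 0 ->
  holonomy (loop_cat F G) = holonomy F * holonomy G.
Proof.
move=> cF cG FG.
have [phi phi0 hphi] := primitive_exists (loop_cat_continuous cF cG FG).
have k0 : (0 : R) < 1 by [].
have p1 : primitive_along th F (fun t => phi (2^-1 * t)) 0 1.
  apply: primitive_ext (primitive_reparam (u := fun t => 2^-1 * t) k0 _ _ hphi).
  - move=> t; rewrite in_itv /= => /andP[t0 t1]; rewrite /loop_cat ifT; last by lra.
    by congr F; lra.
  - by move=> s t; rewrite -mulrBr normrM ger0_norm // ler_wpM2r //; lra.
  - by move=> t; rewrite !in_itv /= => /andP[t0 t1]; apply/andP; split; lra.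
have p2 : primitive_along th G (fun t => phi (2^-1 * t + 2^-1)) 0 1.
  apply: primitive_ext (primitive_reparam (u := fun t => 2^-1 * t + 2^-1) k0 _ _ hphi).
  - move=> t; rewrite in_itv /= => /andP[t0 t1]; rewrite /loop_cat.
    case: ifPn => [h|_]; last by congr G; lra.
    have t00 : t = 0 by lra.
    by rewrite t00 mulr0 add0r divff // FG.
  - move=> s t; rewrite [X in `|X|](_ : _ = 2^-1 * (s - t)); last by ring.
    by rewrite normrM ger0_norm // ler_wpM2r //; lra.
  - by move=> t; rewrite !in_itv /= => /andP[t0 t1]; apply/andP; split; lra.
rewrite (holonomyE (fun t => phi0 _) p1) (holonomyE (fun t => phi0 _) p2).
rewrite (holonomyE phi0 hphi) !mulr0 !mulr1 add0r.
have -> : 2^-1 + 2^-1 = 1 :> R by lra.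
by rewrite mulrA mulfVK.
Qed.

Lemma loop_homotopic_refl b f : loop b f -> loop_homotopic b f f.
Proof.
move=> [cf f0 f1]; have [K [cK eK K0 K1]] := path_homotopic_eq cf (fun t _ => erefl (f t)).
by exists K; split=> // u u01; have := eK u u01; rewrite f0 f1.
Qed.

Definition character_of (b : Y) (C : set (R -> Y)) : R := holonomy (xget (fun=> b) C).

Lemma character_ofE b f : loop b f -> character_of b (loop_class b f) = holonomy f.
Proof.
move=> lf; rewrite /character_of; case: xgetP => [g _ [_ fg]|h].
  by rewrite (holonomy_homotopic fg).
by exfalso; apply: (h f); split=> //; exact: loop_homotopic_refl.
Qed.

Lemma character_of_pi1 b : pi1_character b (character_of b).
Proof.
split=> [f lf|f g lf lg]; first by rewrite character_ofE // holonomy_neq0 //; case: lf.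
have [cf f0 f1] := lf; have [cg g0 g1] := lg.
have fg : f 1 = g 0 by rewrite f1.
have lc : loop b (loop_cat f g).
  split; first exact: loop_cat_continuous.
  - by rewrite /loop_cat ifT ?mulr0 //; lra.
  - rewrite /loop_cat ifF; last by apply/negbTE; rewrite -ltNge; lra.
    by rewrite (_ : 2 * 1 - 1 = 1) //; lra.
by rewrite !character_ofE // holonomy_cat.
Qed.
End Holonomy.

Lemma within_pair (T U W : topologicalType) (D : set T) (f : T -> U) (g : T -> W) :
  {within D, continuous f} -> {within D, continuous g} ->
  {within D, continuous (fun w => (f w, g w))}.
Proof. by move=> cf cg w; exact: (cvg_pair (cf w) (cg w)). Qed.

(** * Equivariance of the slithering map *)

Section SlitheringConnection.
Context {R : realType}.
Local Notation V := 'cV[R]_3.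
Context {Gamma : set 'M[R]_3} {X : topologicalType} {pr : V -> X}
  {rho : 'M[R]_3 -> 'M[R]_3} {Om : set V} {xi : V -> V} {L : set (V * V)}
  {n : nat} {Q : 'I_n -> R -> R -> V} {S : V * V -> V * V -> 'M[R]_3}.
Hypothesis H : setup Gamma pr rho Om xi L Q S.

Implicit Types (B : 'M[R]_3) (x y z : V) (g h k : V * V).

Let hGamma := setup_group H.
Let hX := setup_cover H.

Lemma leaf_ideal g : L g -> ideal g.
Proof. by case: (setup_lamination H) => _ h _ _ /h[]. Qed.

Lemma leaf_grev g : L g -> L (grev g).
Proof. by case: (setup_lamination H) => _ h _ _ /h[]. Qed.

Lemma leaf_act B g : Gamma B -> L g -> L (geod_act B g).
Proof. by case: (setup_lamination H) => _ _ h _; exact: h. Qed.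

Lemma leaf_meet g h z : L g -> L h -> geod g z -> geod h z -> h = g \/ h = grev g.
Proof. by case: (setup_lamination H) => _ _ _ h'; exact: h'. Qed.

Lemma geod_Hyp g x : geod g x -> Hyp x. Proof. by case. Qed.

Lemma act_invK B g : Gamma B -> ideal g -> geod_act B (geod_act (invmx B) g) = g.
Proof.
move=> gB [b1 b2 _].
have iB := Gamma_isom hGamma (GammaV hGamma gB).
have BB : B *m invmx B = 1%:M by rewrite mulmxV // (Gamma_unit hGamma gB).
by rewrite (surjective_pairing g) /geod_act /= !bd_actM // BB !bd_act1.
Qed.

Lemma act_Kinv B g : Gamma B -> ideal g -> geod_act (invmx B) (geod_act B g) = g.
Proof.
move=> gB ig; have := act_invK (GammaV hGamma gB) ig.
by rewrite invmxK.
Qed.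

Lemma ideal_act B g : Gamma B -> ideal g -> ideal (geod_act B g).
Proof.
move=> gB ig; have [b1 b2 n12] := ig.
have iB := Gamma_isom hGamma gB.
split; [exact: bd_act_bd|exact: bd_act_bd|].
apply: contra n12 => /eqP e; apply/eqP.
by have := act_Kinv gB ig; rewrite /geod_act e => <-.
Qed.

Lemma geod_actE B g x : Gamma B -> ideal g ->
  geod (geod_act B g) (B *m x) <-> geod g x.
Proof.
move=> gB ig; split; last first.
  by case: ig => b1 b2 _; apply: geod_actP => //; exact: Gamma_isom gB.
have [b1 b2 _] := ideal_act gB ig.
move=> /(geod_actP (Gamma_isom hGamma (GammaV hGamma gB)) b1 b2).
by rewrite act_Kinv // (GammaK hGamma).
Qed.

Lemma separates_act B g h k : Gamma B -> ideal g -> ideal h -> ideal k ->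
  separates h g k -> separates (geod_act B h) (geod_act B g) (geod_act B k).
Proof.
move=> gB ig ih ik s x y gx ky.
have iB := Gamma_isom hGamma gB.
rewrite -(GammaVK hGamma x gB) -(GammaVK hGamma y gB) in gx ky *.
move: (invmx B *m x) (invmx B *m y) gx ky => x' y'.
move=> /(geod_actE _ gB ig) gx' /(geod_actE _ gB ik) ky'.
have [h1 h2 _] := ih; have [c c0 cE] := vol3_act x' iB h1 h2.
rewrite /= !cE mulrACA pmulr_rlt0 ?mulr_gt0 //; exact: s.
Qed.

Lemma lifted_transversal_act B a : Gamma B ->
  lifted_transversal pr L a -> lifted_transversal pr L (fun t => B *m a t).
Proof.
move=> gB [h1 h2 h3 h4].
have iB := Gamma_isom hGamma gB.
split.
- move=> t t01; have [Ha da dn] := h1 t t01.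
  have [da' dE] := derive1_mulmx B da.
  split=> //; first exact: Gamma_Hyp gB Ha.
  rewrite dE; apply: contra dn => /eqP e; apply/eqP.
  by rewrite -(GammaK hGamma (derive1 a t) gB) e mulmx0.
- apply/within_continuous_distP => t t01 e e0.
  have cB := @continuous_mulmx R _ _ 1 B (derive1 a t).
  have /nbhs_distP[e' e'0 he'] : nbhs (derive1 a t)
     (fun y => `|B *m derive1 a t - B *m y| < e).
    exact: (@cvgr_dist_lt _ _ _ _ _ _ _ cB).
  have [d d0 hd] := (within_continuous_distP _ _).1 h2 t t01 e' e'0.
  exists d => // s s01 st.
  have [_ das _] := h1 s s01; have [_ dat _] := h1 t t01.
  rewrite (derive1_mulmx B das).2 (derive1_mulmx B dat).2 distrC.
  by apply: he'; exact: hd.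
- move=> s t s01 t01.
  have [Hs _ _] := h1 s s01; have [Ht _ _] := h1 t t01.
  by rewrite !(pr_Gamma hGamma hX gB) //; exact: h3.
- move=> t g t01 Lg gBa.
  have [_ dat _] := h1 t t01; rewrite (derive1_mulmx B dat).2.
  have ig := leaf_ideal Lg.
  have Lg' := leaf_act (GammaV hGamma gB) Lg; have ig' := leaf_ideal Lg'.
  rewrite -(act_invK gB ig) in gBa *.
  move/(geod_actE _ gB ig'): gBa => ga.
  have [b1 b2 _] := ig'; have [c c0 cE] := vol3_act 0 iB b1 b2.
  by rewrite /= cE mulf_neq0 ?(gt_eqF c0) //; exact: (h4 t _ t01 Lg' ga).
Qed.

Lemma arc_of_act B a : Gamma B -> (forall t, t \in `[0, 1] -> Hyp (a t)) ->
  arc_of pr (fun t => B *m a t) = arc_of pr a.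
Proof.
move=> gB Ha; apply/seteqP; split => _ [t t01 <-]; exists t => //.
  by rewrite (pr_Gamma hGamma hX gB) //; exact: Ha.
by rewrite (pr_Gamma hGamma hX gB) //; exact: Ha.
Qed.

Lemma lifts_act B a (A : set X) : Gamma B -> lifts pr L a A -> lifts pr L (fun t => B *m a t) A.
Proof.
move=> gB [la <-]; split; first exact: lifted_transversal_act.
by apply: arc_of_act => // t t01; case: la => h _ _ _; case: (h t t01).
Qed.

Lemma crossed_act B h g : Gamma B -> crossed pr L Q h g ->
  crossed pr L Q (geod_act B h) (geod_act B g).
Proof.
move=> gB [Lh Lg [A [a [s [t [tA la s01 t01 [ga ha]]]]]]].
split; [exact: leaf_act|exact: leaf_act|].
exists A, (fun t => B *m a t), s, t; split=> //; first exact: lifts_act.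
by split; apply/geod_actE => //; exact: leaf_ideal.
Qed.

Lemma crossed_grevr h g : crossed pr L Q h g -> crossed pr L Q h (grev g).
Proof.
move=> [Lh Lg [A [a [s [t [tA la s01 t01 [ga ha]]]]]]].
split=> //; first exact: leaf_grev.
by exists A, a, s, t; split=> //; rewrite geod_grev.
Qed.

Lemma crossedC h g : crossed pr L Q h g -> crossed pr L Q g h.
Proof.
move=> [Lh Lg [A [a [s [t [tA la s01 t01 [ga ha]]]]]]].
by split=> //; exists A, a, t, s.
Qed.

Let conv : properly_convex Om.
Proof. by case: (setup_hitchin H) => _ [c _ _] _ _ _. Qed.

Lemma rho_det B : Gamma B -> \det (rho B) = 1.
Proof. by case: (setup_hitchin H) => -[h _] _ _ _ _; exact: h. Qed.

Lemma rho_unit B : Gamma B -> rho B \in unitmx.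
Proof. by move=> gB; rewrite unitmxE rho_det // unitr1. Qed.

Lemma rhoM (A : 'M[R]_3) B : Gamma A -> Gamma B -> rho (A *m B) = rho A *m rho B.
Proof. by case: (setup_hitchin H) => -[_ h] _ _ _ _; exact: h. Qed.

Lemma rho1 : rho 1%:M = 1%:M.
Proof.
have g1 := Gamma1 hGamma; have u1 := rho_unit g1.
have := congr1 (mulmx (invmx (rho 1%:M))) (rhoM g1 g1).
by rewrite mulmx1 mulmxA mulVmx // mul1mx.
Qed.

Lemma rhoV B : Gamma B -> rho (invmx B) = invmx (rho B).
Proof.
move=> gB; have gV := GammaV hGamma gB.
have := rhoM gV gB; rewrite mulVmx ?(Gamma_unit hGamma) // rho1.
move=> /(congr1 (mulmx^~ (invmx (rho B)))).
by rewrite mul1mx -mulmxA mulmxV ?rho_unit // mulmx1.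
Qed.

(** [hitchin] gives invariance of the domain only projectively, so [rho B] maps the cone to itself
    or to its opposite. A scalar that carries a boundary vector to a boundary vector settles the
    sign, since the closed cone contains no line. *)
Lemma rho_cone B x x' (c : R) : Gamma B -> cone_bd Om x -> cone_bd Om x' ->
  x' = (c *: rho B) *m x -> c != 0 ->
  forall y, Om y -> Om ((c *: rho B) *m y).
Proof.
move=> gB [cx _ x0] [cx' _ x'0] x'E c0.
have side : forall y, Om y -> Om ((c *: rho B) *m y) \/ Om (- ((c *: rho B) *m y)).
  move=> y Oy; case: (setup_hitchin H) => _ _ h _ _.
  have [w Ow [d d0 wE]] := h B y gB Oy.
  have -> : (c *: rho B) *m y = (c / d) *: w.
    by rewrite wE scalerA divfK // scalemxAl.
  have [cd|cd] := ltP 0 (c / d); first by left; exact: cone_scale.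
  right; rewrite -scaleNr; apply: cone_scale => //.
  by rewrite oppr_gt0 lt_neqAle cd mulf_neq0 // invr_eq0.
case: (cone_image_side conv side) => // neg.
have : x' = 0.
  case: conv => _ _ _; apply=> //.
  have -> : - x' = (- (c *: rho B)) *m x by rewrite mulNmx -x'E.
  by apply: closure_mulmx => // y Oy; rewrite mulNmx; exact: neg.
by move=> e; rewrite e eqxx in x'0.
Qed.

Lemma xi_act B p : Gamma B -> bdHyp p ->
  exists2 c : R, c != 0 & xi (bd_act B p) = (c *: rho B) *m xi p.
Proof.
move=> gB bp; case: (setup_boundary H) => _ _ _ _ h.
by have [c c0 e] := h B p gB bp; exists c; rewrite // e scalemxAl.
Qed.

Lemma xi_bd p : bdHyp p -> cone_bd Om (xi p).
Proof. by case: (setup_boundary H) => _ h _ _ _; exact: h. Qed.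

Lemma invmxM (M N : 'M[R]_3) : M \in unitmx -> N \in unitmx ->
  invmx (M *m N) = invmx N *m invmx M.
Proof.
move=> uM uN; have uMN : M *m N \in unitmx by rewrite unitmx_mul uM.
apply: (can_inj (mulKmx uMN)).
by rewrite mulmxV // mulmxA -(mulmxA M) mulmxV // mulmx1 mulmxV.
Qed.

Lemma invmx_scale (c : R) (M : 'M[R]_3) : c != 0 -> M \in unitmx ->
  invmx (c *: M) = c^-1 *: invmx M.
Proof. by move=> c0 uM; rewrite invmxZ // unitmxZ // unitfE. Qed.

Lemma tangent_line_act B p (phi : 'rV[R]_3) : Gamma B -> bdHyp p ->
  tangent_line Om (xi p) phi ->
  tangent_line Om (xi (bd_act B p)) (phi *m invmx (rho B)).
Proof.
move=> gB bp tp.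
have iB := Gamma_isom hGamma gB.
have bp' := bd_act_bd iB bp.
have [c c0 e] := xi_act gB bp.
have uB := rho_unit gB.
have uM : c *: rho B \in unitmx by rewrite unitmxZ // unitfE.
have hM := rho_cone gB (xi_bd bp) (xi_bd bp') e c0.
have hM' y : Om y -> Om (invmx (c *: rho B) *m y).
  rewrite invmx_scale // -rhoV //.
  apply: (rho_cone (GammaV hGamma gB) (xi_bd bp') (xi_bd bp)).
    by rewrite rhoV // -invmx_scale // e mulKmx.
  by rewrite invr_eq0.
have e2 : c *: (phi *m invmx (c *: rho B)) = phi *m invmx (rho B).
  by rewrite invmx_scale // -scalemxAr scalerA divff // scale1r.
have h := tangent_line_scale c (tangent_line_mulmx uM hM hM' tp).
by rewrite e2 -e in h.
Qed.

Lemma annihilator_act B p (phi : 'rV[R]_3) : Gamma B -> bdHyp p ->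
  annihilator (xi p) phi -> annihilator (xi (bd_act B p)) (phi *m invmx (rho B)).
Proof.
move=> gB bp; rewrite /annihilator /= => h.
have [c c0 ->] := xi_act gB bp.
by rewrite -scalemxAl -scalemxAr mulmxA mulmxKV ?rho_unit // h scaler0.
Qed.

Let actK B p : Gamma B -> bdHyp p -> bd_act (invmx B) (bd_act B p) = p.
Proof.
move=> gB bp; have iB := Gamma_isom hGamma gB.
by rewrite (bd_actM _ iB bp) mulVmx ?(Gamma_unit hGamma) // bd_act1.
Qed.

(** Stated for an arbitrary equivariant family [F], so as to serve both the line and the plane of a
    flag. *)
Lemma image_flag_act (F : V -> set 'rV[R]_3) B (M : 'M[R]_3) p q : Gamma B -> bdHyp p -> bdHyp q ->
  (forall A r phi, Gamma A -> bdHyp r -> F r phi -> F (bd_act A r) (phi *m invmx (rho A))) ->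
  [set phi *m M | phi in F (bd_act B p)] = F (bd_act B q) ->
  [set phi *m (invmx (rho B) *m M *m rho B) | phi in F p] = F q.
Proof.
move=> gB bp bq hF hM.
have gV := GammaV hGamma gB.
have back r phi : bdHyp r -> F (bd_act B r) phi -> F r (phi *m rho B).
  move=> br Fr; have br' := bd_act_bd (Gamma_isom hGamma gB) br.
  by have := hF _ _ _ gV br' Fr; rewrite actK // rhoV // invmxK.
apply/seteqP; split => [_ [phi Fp <-]|psi Fq] /=.
  rewrite !mulmxA; apply: back => //; rewrite -hM.
  by exists (phi *m invmx (rho B)) => //; exact: hF.
have : F (bd_act B q) (psi *m invmx (rho B)) by exact: hF.
rewrite -hM => -[phi Fp e].
exists (phi *m rho B); first exact: back.
by rewrite !mulmxA mulmxK ?rho_unit // e mulmxKV ?rho_unit.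
Qed.

(* Conjugating [S] by [B] yields another family satisfying the axioms, so it
   is [S] by uniqueness. *)
Lemma slithering_act B h g : Gamma B -> crossed pr L Q h g ->
  S (geod_act B h) (geod_act B g) = rho B *m S h g *m invmx (rho B).
Proof.
move=> gB chg.
have gV := GammaV hGamma gB.
have uB := rho_unit gB.
have [[ax1 ax2 ax3 ax4 ax5] uniq _] := setup_slithering H.
pose S' h g := invmx (rho B) *m S (geod_act B h) (geod_act B g) *m rho B.
suff ax' : slithering_axioms pr L Q Om xi S'.
  have := uniq S' ax' h g chg; rewrite /S' => <-.
  by rewrite !mulmxA mulmxK // mulmxV // mul1mx.
have cB h' g' := @crossed_act B h' g' gB.
split.
- move=> h1 g1 c1; have [d e1 e2] := ax1 _ _ (cB _ _ c1).
  rewrite /S' !det_mulmx d mulr1 det_inv rho_det // invr1 mulr1; split=> //.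
    by rewrite geod_act_grev e1.
  by rewrite geod_act_grev e2.
- move=> h0 g0 c0; have [e [K [th [e0 th0 hK]]]] := ax2 _ _ (cB _ _ c0).
  have iB := Gamma_isom hGamma gB; have iV := Gamma_isom hGamma gV.
  (* [B] acts on pairs of geodesics as a Lipschitz map, so the Hölder estimate at the translated
     pair pulls back with the same exponent. *)
  have [C C0 hC] := bd_act_lipschitz iB iV.
  have lipg (g1 g2 : V * V) : ideal g1 -> ideal g2 ->
      `|geod_act B g1 - geod_act B g2| <= C * `|g1 - g2|.
    move=> [b1 b2 _] [b3 b4 _]; rewrite !prod_normE /= maxr_pMr ?(ltW C0) //.
    by rewrite ge_max !le_max !hC // orbT.
  have lip h1 g1 h2 g2 : crossed pr L Q h1 g1 -> crossed pr L Q h2 g2 ->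
      `|(geod_act B h1, geod_act B g1) - (geod_act B h2, geod_act B g2)|
      <= C * `|(h1, g1) - (h2, g2)|.
    move=> [/(leaf_ideal) i1 /(leaf_ideal) i2 _] [/(leaf_ideal) i3 /(leaf_ideal) i4 _].
    rewrite ![`|(_, _) - (_, _)|]prod_normE /= maxr_pMr ?(ltW C0) //.
    by rewrite ge_max !le_max !lipg // orbT.
  pose N := (3 * `|invmx (rho B)|) * (3 * `|rho B|).
  exists (e / C), (N * (`|K| * (C `^ th))), th; split => //; first by rewrite divr_gt0.
  move=> h1 g1 h2 g2 c1 c2 n1 n2.
  have near h' g' : crossed pr L Q h' g' -> `|(h', g') - (h0, g0)| < e / C ->
      `|(geod_act B h', geod_act B g') - (geod_act B h0, geod_act B g0)| < e.
    move=> c'; rewrite ltr_pdivlMr // mulrC; apply: le_lt_trans; exact: lip.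
  have main := hK _ _ _ _ (cB _ _ c1) (cB _ _ c2) (near _ _ c1 n1) (near _ _ c2 n2).
  have step : `|S' h1 g1 - S' h2 g2| <=
      N * `|S (geod_act B h1) (geod_act B g1) - S (geod_act B h2) (geod_act B g2)|.
    rewrite /S' -mulmxBl -mulmxBr.
    apply: le_trans (mulmx_norm_le _ _) _; rewrite /N.
    have := mulmx_norm_le (invmx (rho B))
      (S (geod_act B h1) (geod_act B g1) - S (geod_act B h2) (geod_act B g2)).
    set a := `|_ *m _|; set b := `|_ - _| => hab.
    have r0 : 0 <= 3 * `|rho B| by rewrite mulr_ge0.
    by have := ler_wpM2r r0 hab; rewrite -[3%N%:R]/(3 : R); lra.
  have N0 : 0 <= N by rewrite !mulr_ge0.
  exact: (hoelder_scale N0 (ltW C0) (ltW th0) (normr_ge0 _) (normr_ge0 _)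
    step main (lip _ _ _ _ c1 c2)).
- move=> h1 g1 c1; have [e1 e2] := ax3 _ _ (cB _ _ c1).
  rewrite /S' e1 mulmx1 mulVmx // e2; split=> //.
  have [d _ _] := ax1 _ _ (cB _ _ c1).
  have uS : S (geod_act B h1) (geod_act B g1) \in unitmx by rewrite unitmxE d unitr1.
  by rewrite !invmxM ?unitmx_mul ?unitmx_inv ?uB // invmxK mulmxA.
- move=> g1 g2 g3 c31 L2 sep; have [L3 L1 _] := c31.
  have := ax4 _ _ _ (cB _ _ c31) (leaf_act gB L2)
    (separates_act gB (leaf_ideal L1) (leaf_ideal L2) (leaf_ideal L3) sep).
  by rewrite /S' => ->; rewrite !mulmxA mulmxK.
- move=> z x y c; have [Lzy Lzx _] := c.
  have [bz bx _] := leaf_ideal Lzx; have [_ by_ _] := leaf_ideal Lzy.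
  have [un mz mx] := ax5 _ _ _ (cB _ _ c); rewrite /= in bz bx by_.
  have hT A r phi (gA : Gamma A) (br : bdHyp r) := @tangent_line_act A r phi gA br.
  have hA A r phi (gA : Gamma A) (br : bdHyp r) := @annihilator_act A r phi gA br.
  split.
  + rewrite /unipotent /S'.
    have -> : invmx (rho B) *m S (geod_act B (z, y)) (geod_act B (z, x)) *m rho B - 1 =
        invmx (rho B) *m (S (geod_act B (z, y)) (geod_act B (z, x)) - 1) *m rho B.
      by rewrite mulmxBr mulmxBl mulmx1 mulVmx.
    move: un; rewrite /unipotent /geod_act /=; set M := (_ - 1) => M3.
    transitivity (invmx (rho B) *m (M ^+ 3) *m rho B); last by rewrite M3 mulmx0 mul0mx.
    by rewrite !exprS !expr0 !mulr1 -!mulmxE !mulmxA !(mulmxK uB).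
  + by case: mz => m1 m2; split; [apply: (image_flag_act gB bz bz hT m1)
      |apply: (image_flag_act gB bz bz hA m2)].
  + by case: mx => m1 m2; split; [apply: (image_flag_act gB bx by_ hT m1)
      |apply: (image_flag_act gB bx by_ hA m2)].
Qed.

(** * The slithering cocycle along a tie and its sections *)

Implicit Types (A : set X).

Lemma tie_cross_once A a g s t : tie pr Q A -> lifts pr L a A -> L g ->
  s \in `[0, 1] -> t \in `[0, 1] -> geod g (a s) -> geod g (a t) -> s = t.
Proof. by case: (setup_track H) => _ _ _ _ h; exact: h. Qed.

Lemma lifts_Hyp A a t : lifts pr L a A -> t \in `[0, 1] -> Hyp (a t).
Proof. by move=> [[h _ _ _] _] /h[]. Qed.

Lemma lifts_inj A a s t : lifts pr L a A -> s \in `[0, 1] -> t \in `[0, 1] ->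
  pr (a s) = pr (a t) -> s = t.
Proof. by move=> [[_ _ h _] _]; exact: h. Qed.

Lemma lifts_continuous A a : lifts pr L a A -> {within `[0, 1], continuous a}.
Proof. by move=> [[h _ _ _] _]; apply: derivable_within => t /h[]. Qed.

Lemma crossedP A a g h s t : tie pr Q A -> lifts pr L a A -> L g -> L h ->
  s \in `[0, 1] -> t \in `[0, 1] -> geod g (a s) -> geod h (a t) ->
  crossed pr L Q h g.
Proof. by move=> tA la Lg Lh s01 t01 gs ht; split=> //; exists A, a, s, t. Qed.

Let ax1 h g : crossed pr L Q h g ->
  [/\ \det (S h g) = 1, S (grev h) g = S h g & S h (grev g) = S h g].
Proof. by case: (setup_slithering H) => -[h1 _ _ _ _] _ _; exact: h1. Qed.

Lemma slithering_unit h g : crossed pr L Q h g -> S h g \in unitmx.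
Proof. by move=> /ax1[d _ _]; rewrite unitmxE d unitr1. Qed.

Lemma slithering_refl h g : crossed pr L Q h g -> S g g = 1%:M.
Proof. by case: (setup_slithering H) => -[_ _ h1 _ _] _ _ /h1[]. Qed.

Lemma slithering_inv h g : crossed pr L Q h g -> S g h = invmx (S h g).
Proof. by case: (setup_slithering H) => -[_ _ h1 _ _] _ _ /h1[]. Qed.

Lemma slithering_grev h g h' g' : crossed pr L Q h g ->
  h' = h \/ h' = grev h -> g' = g \/ g' = grev g -> S h' g' = S h g.
Proof.
move=> c hh gg; have [_ e1 e2] := ax1 c.
have [_ e3 _] := ax1 (crossed_grevr c).
by case: hh => ->; case: gg => ->; rewrite ?e1 ?e3.
Qed.

Lemma crossed_refl h g : crossed pr L Q h g -> crossed pr L Q g g.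
Proof.
move=> [Lh Lg [A [a [s [t [tA la s01 t01 [gs ht]]]]]]].
exact: (crossedP tA la Lg Lg s01 s01).
Qed.

Lemma slithering_same h g : crossed pr L Q h g -> h = g \/ h = grev g -> S h g = 1%:M.
Proof.
move=> c hg; rewrite -(slithering_refl c).
by apply: (slithering_grev (crossed_refl c)) => //; left.
Qed.

Lemma leaf_same g h z : L g -> L h -> geod g z -> geod h z -> geod g = geod h.
Proof.
move=> Lg Lh gz hz; case: (leaf_meet Lg Lh gz hz) => -> //.
by rewrite geod_grev.
Qed.

(** The axiom composes only through a separating leaf. On a tie the leaf with the middle parameter
    separates the other two, the remaining orders follow by inversion, and leaves crossed at equal
    parameters agree up to orientation. *)
Lemma slithering_cocycle A a g h k t1 t2 t3 : tie pr Q A -> lifts pr L a A ->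
  L g -> L h -> L k -> t1 \in `[0, 1] -> t2 \in `[0, 1] -> t3 \in `[0, 1] ->
  geod g (a t1) -> geod h (a t2) -> geod k (a t3) ->
  S k g = S h g *m S k h.
Proof.
move=> tA la Lg Lh Lk t1i t2i t3i ga ha ka.
have cgh := crossedP tA la Lg Lh t1i t2i ga ha.
have chk := crossedP tA la Lh Lk t2i t3i ha ka.
have cgk := crossedP tA la Lg Lk t1i t3i ga ka.
have inv u v (c : crossed pr L Q u v) : S u v *m S v u = 1%:M.
  by rewrite (slithering_inv c) mulmxV // slithering_unit.
have [e12|n12] := eqVneq t1 t2.
  subst t2; have hg := leaf_meet Lg Lh ga ha.
  rewrite (slithering_same cgh hg) mul1mx.
  by apply/esym/slithering_grev => //; left.
have [e23|n23] := eqVneq t2 t3.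
  subst t3; have kh := leaf_meet Lh Lk ha ka.
  rewrite (slithering_same chk kh) mulmx1.
  by apply: slithering_grev => //; left.
have [e13|n13] := eqVneq t1 t3.
  subst t3; have kg := leaf_meet Lg Lk ga ka.
  rewrite (slithering_same cgk kg).
  have -> : S k h = S g h.
    by apply: (slithering_grev (crossedC cgh)) => //; left.
  by rewrite inv.
have ax4 u v w : crossed pr L Q w u -> L v -> separates v u w ->
    S w u = S v u *m S w v.
  by case: (setup_slithering H) => -[_ _ _ h4 _] _ _; exact: h4.
(* Leaves that meet coincide up to orientation, and such a leaf would cross the tie at two
   parameters. *)
have dis u v s t z : L u -> L v -> s \in `[0, 1] -> t \in `[0, 1] -> s != t ->
    geod u (a s) -> geod v (a t) -> geod u z -> geod v z -> False.
  move=> Lu Lv s01 t01 st us vt uz vz.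
  have e := leaf_same Lu Lv uz vz.
  move: st; rewrite (tie_cross_once tA la Lu s01 t01 us _) ?eqxx //.
  by rewrite e.
have sep u v w s1 s2 s3 : L u -> L v -> L w ->
    s1 \in `[0, 1] -> s2 \in `[0, 1] -> s3 \in `[0, 1] ->
    geod u (a s1) -> geod v (a s2) -> geod w (a s3) -> s1 < s2 -> s2 < s3 ->
    separates v u w.
  move=> Lu Lv Lw s1i s2i s3i us vs ws s12 s23.
  have sub t : t \in `[s1, s3] -> t \in `[0, 1].
    move: s1i s3i; rewrite !in_itv /= => /andP[l1 _] /andP[_ l2] /andP[l3 l4].
    by rewrite (le_trans l1 l3) (le_trans l4 l2).
  have [[hd _ _ ht] _] := la.
  have iu := leaf_ideal Lu; have iv := leaf_ideal Lv; have iw := leaf_ideal Lw.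
  apply: (@crossing_separates R a u v w s1 s2 s3) => //.
  - by move=> z; apply: (dis u v s1 s2) => //; rewrite lt_eqF.
  - by move=> z; apply: (dis w v s3 s2) => //; rewrite gt_eqF.
  - by move=> t /sub/hd[].
  - exact: ht.
  - by move=> t /sub t01 vt; apply: (tie_cross_once tA la Lv).
have sep' u v w s1 s2 s3 : L u -> L v -> L w ->
    s1 \in `[0, 1] -> s2 \in `[0, 1] -> s3 \in `[0, 1] ->
    geod u (a s1) -> geod v (a s2) -> geod w (a s3) ->
    (s1 < s2 < s3) \/ (s3 < s2 < s1) -> separates v u w.
  move=> Lu Lv Lw i1 i2 i3 us vs ws [/andP[h1 h2]|/andP[h1 h2]].
    exact: (sep u v w s1 s2 s3).
  by apply: separatesC; exact: (sep w v u s3 s2 s1).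
have : [\/ (t1 < t2 < t3) \/ (t3 < t2 < t1), (t1 < t3 < t2) \/ (t2 < t3 < t1)
    | (t2 < t1 < t3) \/ (t3 < t1 < t2)].
  move: n12 n23 n13; rewrite !neq_lt.
  move=> /orP[] l1 /orP[] l2 /orP[] l3; rewrite ?l1 ?l2 ?l3 /=;
    try (by apply: Or31; auto); try (by apply: Or32; auto); try (by apply: Or33; auto).
case=> ord.
- by apply: ax4 => //; apply: (sep' g h k t1 t2 t3).
- have -> : S h g = S k g *m S h k.
    by apply: ax4 => //; apply: (sep' g k h t1 t3 t2).
  by rewrite -mulmxA inv ?mulmx1 //; exact: crossedC.
- have -> : S k h = S g h *m S k g.
    by apply: ax4 => //; apply: (sep' h g k t2 t1 t3).
  by rewrite mulmxA inv // mul1mx.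
Qed.

Lemma Dline_scale g (v : 'rV[R]_3) (c : R) : Dline xi g v -> Dline xi g (c *: v).
Proof. by move=> [h1 h2]; split; rewrite /annihilator /= -scalemxAl ?h1 ?h2 scaler0. Qed.

Lemma Dline_act B g (v : 'rV[R]_3) : Gamma B -> L g -> Dline xi g v ->
  Dline xi (geod_act B g) (v *m invmx (rho B)).
Proof.
move=> gB Lg [h1 h2]; have [b1 b2 _] := leaf_ideal Lg.
by split; exact: (annihilator_act).
Qed.

Lemma Dline_slithering h g (v : 'rV[R]_3) : crossed pr L Q h g ->
  Dline xi g v -> Dline xi h (v *m S h g).
Proof.
move=> c Dv; case: (setup_slithering H) => _ _ h3; rewrite -(h3 _ _ c).
by exists v.
Qed.

(** [xi] separates the two endpoints projectively, so their images are independent vectors and the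
    functionals vanishing on both form a line. *)
Lemma DlineP g : L g -> exists2 w : 'rV[R]_3, w != 0 /\ Dline xi g w &
  forall v, Dline xi g v -> exists r : R, v = r *: w.
Proof.
move=> Lg; have [b1 b2 n12] := leaf_ideal Lg.
pose M : 'M[R]_(3, 2) := row_mx (xi g.1) (xi g.2).
have hM (v : 'rV[R]_3) :
    v *m M = row_mx (v *m xi g.1) (v *m xi g.2) :> 'M[R]_(1, 1 + 1).
  exact: mul_mx_row.
have DE (v : 'rV[R]_3) : Dline xi g v <-> (v <= kermx M)%MS.
  split.
    move=> [h1 h2]; apply/sub_kermxP; apply: etrans (hM v) _.
    by rewrite (h1 : v *m _ = 0) (h2 : v *m _ = 0); exact: row_mx0.
  move/sub_kermxP => e.
  have : row_mx (v *m xi g.1) (v *m xi g.2) = row_mx 0 0 :> 'M[R]_(1, 1 + 1).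
    by rewrite -hM row_mx0; exact: e.
  by move=> /eq_row_mx[].
have M0 i : M i 0 = xi g.1 i 0.
  rewrite (_ : (0 : 'I_2) = lshift 1 (0 : 'I_1)); first exact: row_mxEl.
  exact: val_inj.
have M1 i : M i (lift 0 0) = xi g.2 i 0.
  rewrite (_ : lift 0 0 = rshift 1 (0 : 'I_1)); first exact: row_mxEr.
  exact: val_inj.
clearbody M; have rM : \rank M = 2%N.
  suff : row_free M^T by rewrite -mxrank_tr => /eqP.
  rewrite -kermx_eq0; apply/rowV0P => v.
  move/sub_kermxP => vM.
  have x1n : xi g.1 != 0 by case: (xi_bd b1).
  have x2n : xi g.2 != 0 by case: (xi_bd b2).
  have e : v 0 0 *: xi g.1 + v 0 1 *: xi g.2 = 0.
    have := congr1 trmx vM; rewrite trmx_mul trmxK trmx0 => {}vM.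
    apply/colP => i; have := congr1 (fun w : V => w i 0) vM.
    rewrite !mxE big_ord_recl big_ord1 !mxE M0 M1 => <-.
    have -> : lift 0 0 = 1 :> 'I_2 by exact: val_inj.
    by congr (_ + _); rewrite mulrC.
  case: (setup_boundary H) => _ _ hinj _ _.
  have v1 : v 0 1 = 0.
    apply/eqP; apply: contraT => v1.
    have v0 : v 0 0 != 0.
      apply: contraTneq x2n => v0; move: e; rewrite v0 scale0r add0r => /eqP.
      by rewrite scaler_eq0 (negbTE v1) /= => ->.
    suff : g.1 = g.2 by move/eqP; rewrite (negbTE n12).
    apply: hinj => //; exists (- v 0 0 / v 0 1).
      by rewrite mulf_neq0 ?oppr_eq0 ?invr_eq0.
    have -> : xi g.2 = (v 0 1)^-1 *: (v 0 1 *: xi g.2) by rewrite scalerA mulVf // scale1r.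
    have -> : v 0 1 *: xi g.2 = - (v 0 0 *: xi g.1).
      by apply/eqP; rewrite -addr_eq0 addrC e.
    by rewrite scalerN scalerA -scaleNr; congr (_ *: _); rewrite mulNr mulrC.
  have v0 : v 0 0 = 0.
    move: e; rewrite v1 scale0r addr0 => /eqP; rewrite scaler_eq0 (negbTE x1n) orbF.
    by move/eqP.
  apply/rowP => i; rewrite mxE; case: i => -[|[|//]] p.
    by rewrite -[RHS]v0; congr (v _ _); exact: val_inj.
  by rewrite -[RHS]v1; congr (v _ _); exact: val_inj.
have rk : \rank (kermx M) = 1%N by rewrite mxrank_ker rM.
have kn0 : kermx M != 0 by rewrite -mxrank_eq0 rk.
pose w := nz_row (kermx M).
have w0 : w != 0 by rewrite nz_row_eq0.
have wk : (w <= kermx M)%MS by exact: nz_row_sub.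
exists w; first by split=> //; apply/DE.
move=> v /DE vk; apply/sub_rVP.
apply: submx_trans vk _; rewrite -(geq_leqif (mxrank_leqif_sup wk)) rk.
by rewrite rank_rV w0.
Qed.

Lemma lift_suppP x : lift_supp L x <-> Hyp x /\ supp pr L (pr x).
Proof.
split=> [[g Lg gx]|[Hx [y [g Lg gy] e]]].
  by split; [case: gx|exists x => //; exists g].
have [A gA xE] := (pr_eq hX (geod_Hyp gy) Hx).1 e.
exists (geod_act A g); first exact: (leaf_act).
by rewrite xE; apply/(geod_actE) => //; exact: (leaf_ideal).
Qed.

Lemma lift_supp_act B x : Gamma B -> lift_supp L x -> lift_supp L (B *m x).
Proof.
move=> gB [g Lg gx]; exists (geod_act B g); first exact: (leaf_act).
by apply/(geod_actE) => //; exact: (leaf_ideal).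
Qed.

Lemma lift_of_arc A a x : lifts pr L a A -> lift_of pr L A x ->
  exists B t g, [/\ Gamma B, t \in `[0, 1], L g, geod g x & x = B *m a t].
Proof.
move=> la [[g Lg gx]]; have [_ <-] := la; move=> [t t01 e].
have [B gB xE] := (pr_eq hX (lifts_Hyp la t01) (geod_Hyp gx)).1 e.
by exists B, t, g.
Qed.

Lemma lifts_translate_uniq A a B B' t t' : lifts pr L a A -> Gamma B -> Gamma B' ->
  t \in `[0, 1] -> t' \in `[0, 1] -> B *m a t = B' *m a t' -> B = B' /\ t = t'.
Proof.
move=> la gB gB' t01 t'01 e.
have tt : t = t'.
  apply: (lifts_inj la) => //.
  rewrite -(pr_Gamma hGamma hX gB (lifts_Hyp la t01)) e.
  by rewrite (pr_Gamma hGamma hX gB' (lifts_Hyp la t'01)).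
subst t'; split=> //.
exact: (Gamma_free hGamma gB gB' (lifts_Hyp la t01)).
Qed.

Lemma tie_leaf A : tie pr Q A -> exists a t g,
  [/\ lifts pr L a A, t \in `[0, 1], L g & geod g (a t)].
Proof.
move=> tA; case: (setup_track H) => _ _ _ h _.
have [[_ [a la]] [q [Aq sq]]] := h A tA.
have [_ aE] := la; have : arc_of pr a q by rewrite aE.
move=> [t t01 e].
have [g Lg ga] : lift_supp L (a t).
  by apply/(lift_suppP); rewrite e; split=> //; exact: (lifts_Hyp la).
by exists a, t, g.
Qed.

Lemma lifts_same_translate A a b : lifts pr L a A -> lifts pr L b A ->
  exists2 B, Gamma B & forall t, t \in `[0, 1] ->
    exists2 u, u \in `[0, 1] & b t = B *m a u.
Proof.
move=> la lb; apply: (path_in_translate hGamma hX ler01).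
- exact: (lifts_continuous la).
- by move=> t; exact: (lifts_Hyp la).
- by move=> s t; exact: (lifts_inj la).
- exact: (lifts_continuous lb).
- by move=> t; exact: (lifts_Hyp lb).
- move=> t t01; have [_ bE] := lb; have [_ aE] := la.
  have : arc_of pr a (pr (b t)) by rewrite aE -bE; exists t.
  by move=> [u u01 <-]; exists u.
Qed.

(** A vector over one leaf [g0] is spread along one lift of the tie by slithering, then to all
    translates by equivariance. This is consistent since the translates of the lift of an embedded
    arc are disjoint. *)
Lemma slithering_section_exists A : tie pr Q A ->
  exists s, slithering_section Gamma pr L rho xi S A s.
Proof.
move=> tA; have [a [t0 [g0 [la t0i Lg0 ga0]]]] := tie_leaf tA.
have [w [w0 Dw] _] := DlineP Lg0.
(* The point of [g] on the translate by [B] is brought back by the inverse of [B], reached from [g0]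
   by slithering, and the result is moved by [B] again. *)
pose val B g := w *m S (geod_act (invmx B) g) g0 *m invmx (rho B).
pose P x v := exists B t g,
  [/\ Gamma B, t \in `[0, 1], L g & [/\ geod g x, x = B *m a t & v = val B g]].
have back B t g : Gamma B -> t \in `[0, 1] -> L g -> geod g (B *m a t) ->
    [/\ L (geod_act (invmx B) g), geod (geod_act (invmx B) g) (a t) &
     crossed pr L Q (geod_act (invmx B) g) g0].
  move=> gB t01 Lg gx; have gV := GammaV hGamma gB.
  have Lg' := leaf_act gV Lg.
  have gx' : geod (geod_act (invmx B) g) (a t).
    rewrite -(GammaK hGamma (a t) gB); apply/(geod_actE) => //.
    exact: (leaf_ideal).
  split=> //; exact: (crossedP tA la Lg0 Lg' t0i t01 ga0 gx').
have Puniq x v v' : P x v -> P x v' -> v = v'.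
  move=> [B [t [g [gB t01 Lg [gx xE ->]]]]] [B' [t' [g' [gB' t'01 Lg' [gx' xE' ->]]]]].
  have [BB tt] := lifts_translate_uniq la gB gB' t01 t'01 (etrans (esym xE) xE').
  subst B' t' x; rewrite /val; congr (_ *m _ *m _).
  have [Lh gh _] := back _ _ _ gB t01 Lg gx.
  have [Lh' gh' c'] := back _ _ _ gB t01 Lg' gx'.
  apply: (slithering_grev c'); last by left.
  exact: (leaf_meet Lh' Lh gh' gh).
pose s x := xget 0 (P x).
have sP x v : P x v -> s x = v.
  move=> Pv; apply: (Puniq x) => //.
  exact: (@xgetI _ 0 (P x) v Pv).
have Pex x : lift_of pr L A x -> exists v, P x v.
  move=> /(lift_of_arc la)[B [t [g [gB t01 Lg gx xE]]]].
  by exists (val B g), B, t, g.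
exists s; split.
- split.
  + move=> x g Ax Lg gx.
    have [B [t [g' [gB t01 Lg' gx' xE]]]] := lift_of_arc la Ax.
    have -> : s x = val B g by apply: sP; exists B, t, g.
    have gxB : geod g (B *m a t) by rewrite -xE.
    have [Lh gh c] := back _ _ _ gB t01 Lg gxB.
    have := Dline_act gB Lh (Dline_slithering c Dw).
    by rewrite (act_invK gB) //; exact: (leaf_ideal).
  + move=> B x gB Ax.
    have [C [t [g [gC t01 Lg gx xE]]]] := lift_of_arc la Ax.
    have -> : s x = val C g by apply: sP; exists C, t, g.
    have gBC := GammaM hGamma gB gC.
    have -> : s (B *m x) = val (B *m C) (geod_act B g).
      apply: sP; exists (B *m C), t, (geod_act B g); split=> //.
        exact: (leaf_act).
      split=> //; last by rewrite xE mulmxA.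
      by apply/(geod_actE) => //; exact: (leaf_ideal).
    rewrite /val (rhoM gB gC) (invmxM (rho_unit gB) (rho_unit gC)) !mulmxA.
    congr (_ *m S _ _ *m _ *m _).
    have uB := Gamma_unit hGamma gB; have uC := Gamma_unit hGamma gC.
    rewrite (invmxM uB uC).
    have [b1 b2 _] := leaf_ideal Lg.
    have iB := Gamma_isom hGamma gB.
    have [b3 b4] : bdHyp (bd_act B g.1) /\ bdHyp (bd_act B g.2).
      by split; exact: bd_act_bd.
    have iV := Gamma_isom hGamma (GammaV hGamma gB).
    have comp p : bdHyp p -> bd_act (invmx C *m invmx B) (bd_act B p) = bd_act (invmx C) p.
      move=> bp; rewrite -(bd_actM _ iV); last exact: bd_act_bd.
      by rewrite (bd_actM _ iB bp) mulVmx // bd_act1.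
    by rewrite /geod_act /= !comp.
- move=> x Ax.
  have [B [t [g [gB t01 Lg gx xE]]]] := lift_of_arc la Ax.
  have -> : s x = val B g by apply: sP; exists B, t, g.
  have gxB : geod g (B *m a t) by rewrite -xE.
  have [Lh gh c] := back _ _ _ gB t01 Lg gxB.
  rewrite /val; apply: contraNneq w0 => e.
  rewrite -(mulmxK (slithering_unit c) w) -(mulmxKV (rho_unit gB) (w *m _)) e.
  by rewrite !mul0mx.
- move=> b lb t u g h t01 u01 Lg Lh gb hb.
  (* The invariance is required along every lift [b], but any of them runs inside one translate of
     [a]. *)
  have [B gB hB] := lifts_same_translate la lb.
  have [t' t'01 bt] := hB t t01; have [u' u'01 bu] := hB u u01.
  rewrite bt in gb *; rewrite bu in hb *.
  have -> : s (B *m a t') = val B g by apply: sP; exists B, t', g.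
  have -> : s (B *m a u') = val B h by apply: sP; exists B, u', h.
  have [Lg' gg' cg] := back _ _ _ gB t'01 Lg gb.
  have [Lh' gh' ch] := back _ _ _ gB u'01 Lh hb.
  have chg := crossedP tA la Lg' Lh' t'01 u'01 gg' gh'.
  have -> : S h g = rho B *m S (geod_act (invmx B) h) (geod_act (invmx B) g) *m invmx (rho B).
    have := slithering_act gB chg.
    rewrite (act_invK gB (leaf_ideal Lh)).
    by rewrite (act_invK gB (leaf_ideal Lg)).
  rewrite /val (slithering_cocycle tA la Lg0 Lg' Lh' t0i t'01 u'01 ga0 gg' gh').
  by rewrite !mulmxA mulmxKV ?(rho_unit gB).
Qed.

(** * Rectangles of the neighborhood *)

Local Notation N := (nbhd_of pr Q).

Implicit Types (s t e : R) (i j : 'I_n).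

Lemma Q_Hyp i s t : s \in `[0, 1] -> t \in `[0, 1] -> Hyp (Q i s t).
Proof. by case: (setup_track H) => h _ _ _ _; case: (h i) => _; exact. Qed.

Lemma Q_continuous i : {within `[0, 1] `*` `[0, 1], continuous (fun w : R * R => Q i w.1 w.2)}.
Proof. by case: (setup_track H) => h _ _ _ _; case: (h i). Qed.

Lemma Q_inj i j s t s' t' : s \in `]0, 1[ -> t \in `[0, 1] -> s' \in `[0, 1] ->
  t' \in `[0, 1] -> pr (Q i s t) = pr (Q j s' t') -> [/\ i = j, s = s' & t = t'].
Proof. by case: (setup_track H) => _ [h _] _ _ _; exact: h. Qed.

Lemma Q_inj_tie i s t t' : s \in `[0, 1] -> t \in `[0, 1] -> t' \in `[0, 1] ->
  pr (Q i s t) = pr (Q i s t') -> t = t'.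
Proof.
move=> s01 t01 t'01 e.
have [soo|] := boolP (s \in `]0, 1[); first by case: (Q_inj soo t01 s01 t'01 e).
case: (setup_track H) => _ [_ h] _ _ _ nso; apply: (h i s t t') => //.
move: s01 nso; rewrite !in_itv /= negb_and -!leNgt => /andP[s0 s1] /orP[l|l]; [left|right].
  by apply/eqP; rewrite eq_le l s0.
by apply/eqP; rewrite eq_le l s1.
Qed.

Lemma Q_nbhd i s t : s \in `[0, 1] -> t \in `[0, 1] -> N (pr (Q i s t)).
Proof. by move=> s01 t01; exists i, s, t. Qed.

Lemma supp_nbhd : supp pr L `<=` N.
Proof.
case: (setup_track H) => _ _ h _ _; apply: subset_trans h _.
exact: interior_subset.
Qed.

Lemma lift_supp_nbhd x : lift_supp L x -> N (pr x).
Proof. by move=> /(lift_suppP)[_ /supp_nbhd]. Qed.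

Lemma lift_nbhdP x : Hyp x -> N (pr x) -> exists B i s t,
  [/\ Gamma B, s \in `[0, 1], t \in `[0, 1] & x = B *m Q i s t].
Proof.
move=> Hx [i [s [t [s01 t01 e]]]].
have [B gB xE] := (pr_eq hX (Q_Hyp i s01 t01) Hx).1 (esym e).
by exists B, i, s, t.
Qed.

Lemma Q_compact i (K : set (R * R)) : K `<=` `[0, 1]%classic `*` `[0, 1]%classic ->
  closed K -> compact ((fun w : R * R => Q i w.1 w.2) @` K).
Proof.
move=> K01 clK; apply: continuous_compact.
  by apply: (continuous_subspaceW K01); exact: Q_continuous.
by apply: (subclosed_compact clK _ K01); exact: square_compact.
Qed.

(* Finitely many translated rectangles come near [x0], and they contain it. *)
Lemma rect_near x0 e : Hyp x0 -> 0 < e -> \forall y \near x0,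
  forall B i s t, Gamma B -> s \in `[0, 1] -> t \in `[0, 1] -> y = B *m Q i s t ->
  exists s' t', [/\ s' \in `[0, 1], t' \in `[0, 1], `|s - s'| <= e & x0 = B *m Q i s' t'].
Proof.
move=> Hx0 e0.
pose M := (Num.truncn e^-1).+1.
have M0 : 0 < M%:R :> R by rewrite ltr0n.
have M1 : (M%:R)^-1 <= e.
  by rewrite -[leRHS]invrK lef_pV2 ?posrE ?invr_gt0 // ltW // truncnS_gt.
(* Slices of width at most [e]: nearness to a translated slice only tells that [x0] lies in that
   translated slice, which determines its first coordinate up to [e]. *)
pose K (k : 'I_M) : set (R * R) :=
  `[k%:R / M%:R, k.+1%:R / M%:R]%classic `*` `[0, 1]%classic.
have K01 (k : 'I_M) : K k `<=` `[0, 1]%classic `*` `[0, 1]%classic.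
  move=> [s t] /= [sk t01]; split=> //=; move: sk; rewrite /= !in_itv /= => /andP[l1 l2].
  rewrite (le_trans _ l1) ?divr_ge0 // (le_trans l2) //.
  by rewrite ler_pdivrMr // mul1r ler_nat.
have clK (k : 'I_M) : closed (K k).
  by apply: compact_closedRR; apply: compact_setX; exact: segment_compact.
have near1 : \forall y \near x0, forall ik : 'I_n * 'I_M, [set: 'I_n * 'I_M] ik ->
    forall B z, Gamma B -> ((fun w : R * R => Q ik.1 w.1 w.2) @` K ik.2) z -> y = B *m z ->
    exists2 z', ((fun w : R * R => Q ik.1 w.1 w.2) @` K ik.2) z' & x0 = B *m z'.
  apply: near_finite_set; first exact: (@finite_finset ('I_n * 'I_M)%type).
  move=> [i k] _ /=.
  have Kc := @Q_compact i _ (@K01 k) (clK k).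
  have KH : (fun w : R * R => Q i w.1 w.2) @` K k `<=` Hyp.
    by move=> _ [[s t] /K01[s01 t01] <-]; exact: Q_Hyp.
  have h := translates_near hGamma Kc KH Hx0.
  exact: h.
apply: filterS near1 => y hy B i s t gB s01 t01 yE.
have [k sk] : exists k : 'I_M, s \in `[k%:R / M%:R, k.+1%:R / M%:R].
  have [s0 s1] : 0 <= s /\ s <= 1 by move: s01; rewrite in_itv /= => /andP[].
  have [s1'|s1'] := ltP s 1; last first.
    exists ord_max; have -> : s = 1 by apply/eqP; rewrite eq_le s1 s1'.
    rewrite in_itv /=; apply/andP; split.
      by rewrite ler_pdivrMr // mul1r ler_nat.
    by rewrite ler_pdivlMr // mul1r.
  have tr := truncn_itv (mulr_ge0 s0 (ltW M0)).
  have lk : (Num.truncn (s * M%:R) < M)%N.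
    rewrite -(ltr_nat R); apply: le_lt_trans (_ : s * M%:R < _).
      by case/andP: tr.
    by rewrite gtr_pMl.
  exists (Ordinal lk); rewrite in_itv /= ler_pdivrMr // ler_pdivlMr //.
  by case/andP: tr => -> /ltW ->.
have [|z' [[s' t'] [/= s'k t'01] <-] x0E] := hy (i, k) I B (Q i s t) gB _ yE.
  by exists (s, t).
have [/= s'01 _] := K01 k (s', t') (conj s'k t'01).
exists s', t'; split=> //; apply: le_trans M1.
move: sk; rewrite in_itv /= => /andP[l1 l2].
move: s'k; rewrite in_itv /= => /andP[l3 l4].
have e' : k.+1%:R / M%:R = k%:R / M%:R + (M%:R)^-1 :> R.
  by rewrite -natr1 mulrDl mul1r.
rewrite e' in l2 l4; rewrite ler_norml; apply/andP; split; lra.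
Qed.

(* Near a point of an open rectangle there is no other rectangle. *)
Lemma strip_near i s t e : s \in `]0, 1[ -> t \in `[0, 1] -> 0 < e ->
  \forall y \near Q i s t, Hyp y -> N (pr y) ->
  exists s' t', [/\ s' \in `[0, 1], t' \in `[0, 1], `|s' - s| <= e & y = Q i s' t'].
Proof.
move=> soo t01 e0; have s01 := oo01 soo.
apply: filterS (rect_near (Q_Hyp i s01 t01) e0) => y hy Hy Ny.
have [B [j [s1 [t1 [gB s101 t101 yE]]]]] := lift_nbhdP Hy Ny.
have [s' [t' [s'01 t'01 ss x0E]]] := hy B j s1 t1 gB s101 t101 yE.
have pe : pr (Q i s t) = pr (Q j s' t').
  by rewrite x0E (pr_Gamma hGamma hX gB) //; exact: Q_Hyp.
have [ij es et] := Q_inj soo t01 s'01 t'01 pe; subst j s' t'.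
have B1 : B = 1%:M.
  by apply: (Gamma_free hGamma gB (Gamma1 hGamma) (Q_Hyp i s01 t01)); rewrite -x0E mul1mx.
by exists s1, t1; split=> //; rewrite yE B1 mul1mx.
Qed.

Lemma rect_tie_connected i s : s \in `[0, 1] -> connected (rect_tie pr Q i s).
Proof.
move=> s01; apply: connected_continuous_connected; first exact: segment_connected.
apply/within_continuousP => t t01 O nO.
have cp := (within_continuousP _ _).1 (pr_continuous hX) _ (Q_Hyp i s01 t01) O nO.
have cQ := (within_continuousP _ _).1 (@Q_continuous i) (s, t) (conj s01 t01) _ cp.
have /nbhs_ballP[d /= d0 hd] := cQ.
apply/nbhs_ballP; exists d => // u tu u01.
have h : ball (s, t) d (s, u) by split=> //; exact: ballxx.
by apply: (hd _ h (conj s01 u01)); exact: Q_Hyp.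
Qed.

(** At a short side the tie is a whole component of the union of the short sides, in which several
    rectangles may meet. *)
Definition tie_at i s : set X :=
  if s \in `]0, 1[ then rect_tie pr Q i s
  else connected_component (short_sides pr Q) (pr (Q i s 0)).

Lemma rect_tie_short i s : s \in `[0, 1] -> s \notin `]0, 1[ ->
  rect_tie pr Q i s `<=` short_sides pr Q.
Proof.
by move=> s01 ns x xi_; case: (end01 s01 ns) => e; exists i; rewrite -e; [left|right].
Qed.

Lemma tie_at_tie i s : s \in `[0, 1] -> tie pr Q (tie_at i s).
Proof.
move=> s01; rewrite /tie_at; case: ifPn => [soo|ns].
  by left; exists i, s.
right; exists (pr (Q i s 0)) => //.
by apply: (rect_tie_short s01 ns); exists 0 => //; exact: z01.
Qed.

Lemma tie_at_sub i s : s \in `[0, 1] -> rect_tie pr Q i s `<=` tie_at i s.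
Proof.
move=> s01; rewrite /tie_at; case: ifPn => [soo|ns]; first by move=> x.
have h0 : rect_tie pr Q i s (pr (Q i s 0)) by exists 0 => //; exact: z01.
apply: (connected_component_max h0).
- exact: rect_tie_short.
- exact: rect_tie_connected.
Qed.

(** [Q] is only continuous. What is known for transversals is applied to its vertical sides by
    placing each of them in a smooth lift of the tie that contains it. *)
Lemma rect_lift i s : s \in `[0, 1] -> exists2 a, lifts pr L a (tie_at i s) &
  forall t, t \in `[0, 1] -> exists2 u, u \in `[0, 1] & Q i s t = a u.
Proof.
move=> s01; have tA := tie_at_tie i s01.
have [a [_ [_ [la _ _ _]]]] := tie_leaf tA.
have [B gB hB] : exists2 B, Gamma B & forall t, t \in `[0, 1] ->
    exists2 u, u \in `[0, 1] & Q i s t = B *m a u.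
  apply: (path_in_translate hGamma hX ler01).
  - exact: (lifts_continuous la).
  - by move=> t; exact: (lifts_Hyp la).
  - by move=> t t'; exact: (lifts_inj la).
  - apply/within_continuousP => t t01 O nO.
    have cQ := (within_continuousP _ _).1 (@Q_continuous i) (s, t) (conj s01 t01) _ nO.
    have /nbhs_ballP[d /= d0 hd] := cQ.
    apply/nbhs_ballP; exists d => // u tu u01.
    have h : ball (s, t) d (s, u) by split=> //; exact: ballxx.
    exact: (hd _ h (conj s01 u01)).
  - by move=> t; exact: Q_Hyp.
  - move=> t t01.
    have : tie_at i s (pr (Q i s t)) by apply: tie_at_sub => //; exists t.
    by have [_ <-] := la => -[u u01 <-]; exists u.
exists (fun t => B *m a t) => //.
exact: (lifts_act gB la).
Qed.

Lemma rect_cross_once i g s t t' : L g -> s \in `[0, 1] -> t \in `[0, 1] ->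
  t' \in `[0, 1] -> geod g (Q i s t) -> geod g (Q i s t') -> t = t'.
Proof.
move=> Lg s01 t01 t'01 gt gt'.
have [a la ha] := rect_lift i s01.
have [u u01 e] := ha t t01; have [u' u'01 e'] := ha t' t'01.
apply: (Q_inj_tie s01 t01 t'01 (i := i)); rewrite e e'; congr (pr (a _)).
apply: (tie_cross_once (tie_at_tie i s01) la Lg) => //; first by rewrite -e.
by rewrite -e'.
Qed.

Definition crosses i g s := exists2 t, t \in `[0, 1] & geod g (Q i s t).

Lemma closed_fst (K : set (R * R)) : compact K -> closed [set s | exists t, K (s, t)].
Proof.
move=> cK; apply: compact_closedR.
have -> : [set s | exists t, K (s, t)] = (fun w : R * R => w.1) @` K.
  apply/seteqP; split => [s [t st]|s [[s' t] st <-]]; last by exists t.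
  by exists (s, t).
apply: continuous_compact cK; apply: continuous_subspaceT => -[s t].
exact: cvg_fst.
Qed.

Lemma crosses_compact i g (D : set R) : L g -> closed D ->
  closed [set s | exists t,
    [/\ s \in `[0, 1], t \in `[0, 1], geod g (Q i s t) & D t]].
Proof.
move=> Lg clD.
have cK := within_preimage_compact (compact_closedRR square_compact) square_compact
  (@Q_continuous i) (closed_geod (leaf_ideal Lg)).
pose P : set (R * R) := (fun w => w.2) @^-1` D.
have clP : closed P.
  apply: ((continuous_closedP _).1 _ _ clD) => -[s t]; exact: cvg_snd.
have cKP : compact (`[0, 1]%classic `*` `[0, 1]%classic `&`
   (fun w : R * R => Q i w.1 w.2) @^-1` geod g `&` P).
  apply: (subclosed_compact _ cK); last by move=> w [].
  by apply: closedI => //; exact: compact_closedRR.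
have := closed_fst cKP; congr (closed _); apply/seteqP; split => s /=.
  by move=> [t [[[/= s01 t01] gQ] Dt]]; exists t.
by move=> [t [s01 t01 gQ Dt]]; exists t.
Qed.

Lemma crosses_closed i g : L g -> closed [set s | s \in `[0, 1] /\ crosses i g s].
Proof.
move=> Lg; have := @crosses_compact i g setT Lg closedT; congr (closed _).
apply/seteqP; split => s /=; first by move=> [t [s01 t01 gQ _]]; split=> //; exists t.
by move=> [s01 [t t01 gQ]]; exists t.
Qed.

(* A leaf meets every tie at most once, so its first rectangle coordinate is
   strictly monotone; in particular the set of ties it crosses is open. *)
Lemma crosses_open i g s0 : L g -> s0 \in `]0, 1[ -> crosses i g s0 ->
  exists2 d : R, 0 < d & forall s, `|s - s0| < d -> crosses i g s.
Proof.
move=> Lg s0oo [t0 t001 gx0].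
have [c [c1 gc cc injc]] := geod_path (leaf_ideal Lg) gx0.
have Nc r : 0 < r -> Hyp (c r) /\ N (pr (c r)).
  move=> r0; split; first exact: geod_Hyp (gc r r0).
  by apply: (lift_supp_nbhd); exists g => //; exact: gc.
have [e0 e00 he0] := oo_nbhs s0oo.
have near1 : nbhs (1 : R) (fun r => Hyp (c r) -> N (pr (c r)) -> exists s' t',
    [/\ s' \in `[0, 1], t' \in `[0, 1], `|s' - s0| <= e0 & c r = Q i s' t']).
  have nc : nbhs (c 1) (fun y => Hyp y -> N (pr y) -> exists s' t',
    [/\ s' \in `[0, 1], t' \in `[0, 1], `|s' - s0| <= e0 & y = Q i s' t']).
    by rewrite c1; exact: (strip_near i s0oo t001 e00).
  exact: (cc 1 ltr01 _ nc).
have /nbhs_distP[d d0 hd] := near1.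
pose eta : R := Num.min (d / 2) 2^-1.
have eta0 : 0 < eta by rewrite lt_min divr_gt0 //=; lra.
have etad : eta < d by rewrite gt_min ltr_pdivrMr // ltr_pMr // ltr1n.
have eta1 : eta <= 2^-1 by rewrite ge_min lexx orbT.
pose I : interval R := `[1 - eta, 1 + eta].
have Ipos r : r \in I -> 0 < r.
  rewrite in_itv /= => /andP[h _]; apply: lt_le_trans h; lra.
have ex r : r \in I -> exists s, (s \in `]0, 1[) /\ exists2 t, t \in `[0, 1] & c r = Q i s t.
  move=> rI; have r0 := Ipos r rI; have [Hr Nr] := Nc r r0.
  have rd : `|r - 1| < d.
    move: rI; rewrite in_itv /= => /andP[h1 h2]; apply: le_lt_trans etad.
    by rewrite ler_norml; apply/andP; split; lra.
  have [s [t [s01 t01 /he0 soo e]]] := hd r rd Hr Nr.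
  by exists s; split=> //; exists t.
pose P r s := (s \in `]0, 1[) /\ exists2 t, t \in `[0, 1] & c r = Q i s t.
pose f r := xget 0 (P r).
have fP r : r \in I -> P r (f r).
  by move=> /ex[s Ps]; exact: (@xgetI _ 0 (P r) s Ps).
have Puniq r s s' t' : P r s -> s' \in `[0, 1] -> t' \in `[0, 1] -> c r = Q i s' t' -> s = s'.
  move=> [soo [t t01 e]] s'01 t'01 e'.
  by have [] := Q_inj soo t01 s'01 t'01 (congr1 pr (etrans (esym e) e')).
have f1 : f 1 = s0.
  have oneI : 1 \in I by rewrite in_itv /=; apply/andP; split; lra.
  by apply: (Puniq 1 _ _ t0 (fP 1 oneI)) => //; exact: oo01.
have cf : {within [set` I], continuous f}.
  apply/within_continuous_distP => r rI e e_gt0.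
  have [foo [t t01 cE]] := fP r rI.
  have e2 : 0 < e / 2 by rewrite divr_gt0.
  have nr : nbhs r (fun r' => Hyp (c r') -> N (pr (c r')) -> exists s' t',
    [/\ s' \in `[0, 1], t' \in `[0, 1], `|s' - f r| <= e / 2 & c r' = Q i s' t']).
    have nc : nbhs (c r) (fun y => Hyp y -> N (pr y) -> exists s' t',
      [/\ s' \in `[0, 1], t' \in `[0, 1], `|s' - f r| <= e / 2 & y = Q i s' t']).
      by rewrite cE; exact: (strip_near i foo t01 e2).
    exact: (cc r (Ipos r rI) _ nc).
  have /nbhs_distP[d' d'0 hd'] := nr.
  exists d' => // r' r'I rr'.
  have [Hr' Nr'] := Nc r' (Ipos r' r'I).
  have [s' [t' [s'01 t'01 ss e']]] := hd' r' rr' Hr' Nr'.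
  rewrite (Puniq r' _ s' t' (fP r' r'I)) //; apply: le_lt_trans ss _.
  by rewrite ltr_pdivrMr // ltr_pMr // ltr1n.
have injf r r' : r \in I -> r' \in I -> f r = f r' -> r = r'.
  move=> rI r'I e; have [foo [t t01 cE]] := fP r rI; have [foo' [t' t'01 cE']] := fP r' r'I.
  apply: injc; [exact: Ipos|exact: Ipos|].
  rewrite -e in cE'; rewrite cE cE'; congr (Q i _ _).
  apply: (rect_cross_once (i := i) Lg (oo01 foo) t01 t'01).
    by rewrite -cE; apply: gc; exact: Ipos.
  by rewrite -cE'; apply: gc; exact: Ipos.
have [l1 l2] : 1 - eta < 1 /\ 1 < 1 + eta by split; lra.
have [d' d'0 hd'] := injective_interval_open l1 l2 cf injf.
exists d' => // s; rewrite -f1 => /hd'[r rI <-].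
have [_ [t t01 e]] := fP r rI.
by exists t => //; rewrite -e; apply: gc; exact: Ipos.
Qed.

(** A leaf that enters an open rectangle crosses it from end to end: the parameters of the ties that
    it meets form an open and closed part of the open interval, and closedness adds the two short
    sides. *)
Lemma traverse i g s0 : L g -> s0 \in `]0, 1[ -> crosses i g s0 ->
  forall s, s \in `[0, 1] -> crosses i g s.
Proof.
move=> Lg s0oo c0.
have clE := @crosses_closed i g Lg; set E := (X in closed X) in clE.
have Eoo s : s \in `]0, 1[ -> E s.
  move=> soo.
  have loc a b : a \in `]0, 1[ -> b \in `]0, 1[ -> a <= b -> `[< E a >] = `[< E b >].
    rewrite !in_itv /= => /andP[a0 a1] /andP[b0 b1] ab.
    apply: (@locally_constant R bool a b (fun s => `[< E s >])) => //;
      rewrite ?in_itv /= ?lexx ?ab //.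
    move=> t; rewrite in_itv /= => /andP[at_ tb].
    have too : t \in `]0, 1[ by rewrite in_itv /= (lt_le_trans a0 at_) (le_lt_trans tb b1).
    have [[t01 ct]|nE] := pselect (E t).
      have [d d0 hd] := crosses_open Lg too ct.
      have [e e0 he] := oo_nbhs too.
      exists (Num.min d e); first by rewrite lt_min d0 e0.
      have E' p : `|p - t| < Num.min d e -> E p.
        rewrite lt_min => /andP[pd pe]; split; last exact: hd.
        by apply: oo01; apply: he; exact: ltW.
      by move=> p q _ _ /E' Ep /E' Eq; rewrite !asboolT.
    have : nbhs t (~` E) by apply: open_nbhs_nbhs; split=> //; exact: closed_openC.
    move=> /nbhs_distP[e e0 he]; exists e => // p q _ _ /he np /he nq.
    by rewrite !asboolF.
  have Es0 : E s0 by split=> //; exact: oo01.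
  apply/asboolP; have [l|/ltW l] := leP s0 s.
    by rewrite -(loc _ _ s0oo soo l); apply/asboolP.
  by rewrite (loc _ _ soo s0oo l); apply/asboolP.
move=> s s01; suff [] : E s by [].
apply: clE => U /nbhs_distP[e e0 he].
pose m := Num.min e 2^-1.
have m0 : 0 < m by rewrite lt_min e0 /=; lra.
have me : m <= e by rewrite ge_min lexx.
have m1 : m <= 2^-1 by rewrite ge_min lexx orbT.
have [sge0 sle1] : 0 <= s /\ s <= 1 by move: s01; rewrite in_itv /= => /andP.
have [l|l] := leP s 2^-1.
  exists (s + m / 2); split; last by apply: he; rewrite addrC addKr gtr0_norm ?divr_gt0 //; lra.
  by apply: Eoo; rewrite in_itv /=; apply/andP; split; lra.
exists (s - m / 2); split; last by apply: he; rewrite addrC addKr normrN gtr0_norm ?divr_gt0 //; lra.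
by apply: Eoo; rewrite in_itv /=; apply/andP; split; lra.
Qed.

(** The crossing point on each tie is unique and the set of crossings is compact, so it depends
    continuously on the tie. *)
Lemma crossing_continuous i g (f : R -> R) : L g ->
  (forall s, s \in `[0, 1] -> f s \in `[0, 1] /\ geod g (Q i s (f s))) ->
  {within `[0, 1], continuous (fun s => Q i s (f s))}.
Proof.
move=> Lg hf.
have cf : {within `[0, 1], continuous f}.
  apply/within_continuous_distP => s s01 e e0.
  have [fs01 gs] := hf s s01.
  pose D := [set t | e <= `|t - f s|].
  have clD : closed D.
    have ca : continuous (fun t => `|t - f s| : R).
      apply: (@continuous_dist R R^o R^o _ 1) => u v; rewrite mul1r.
      have -> : u - v = (u - f s) - (v - f s) by rewrite opprB addrA subrK.
      exact: ler_dist_dist.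
    exact: ((continuous_closedP _).1 ca _ (@closed_ge R e)).
  have clE := @crosses_compact i g D Lg clD; set E := (X in closed X) in clE.
  have nEs : ~ E s.
    move=> [t [_ t01 gt Dt]]; have tf := rect_cross_once Lg s01 t01 fs01 gt gs.
    by move: Dt; rewrite /D /= tf subrr normr0 leNgt e0.
  have : nbhs s (~` E) by apply: open_nbhs_nbhs; split=> //; exact: closed_openC.
  move=> /nbhs_distP[d d0 hd]; exists d => // s' s'01 ss'.
  have [fs'01 gs'] := hf s' s'01.
  rewrite ltNge; apply/negP => Dt; apply: (hd s' ss').
  by exists (f s').
apply/within_continuousP => s s01 O nO.
have [fs01 gs] := hf s s01.
have cQ := (within_continuousP _ _).1 (@Q_continuous i)
  (s, f s) (conj s01 fs01) _ nO.
have /nbhs_ballP[d /= d0 hd] := cQ.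
have [d' d'0 hd'] := (within_continuous_distP _ _).1 cf s s01 d d0.
apply/nbhs_distP; exists (Num.min d d'); first by rewrite lt_min d0 d'0.
move=> s'; rewrite lt_min => /andP[l1 l2] s'01.
have [fs'01 _] := hf s' s'01.
have h : ball (s, f s) d (s', f s').
  by split=> /=; rewrite -ball_normE /= distrC //; exact: hd'.
exact: (hd _ h (conj s'01 fs'01)).
Qed.

(** * Topology of the train track *)

Context {tau : topologicalType} {coll : X -> tau}.
Hypothesis htau : collapse pr Q coll.

Implicit Types (p : tau).

Definition edge i s : tau := coll (pr (Q i s 0)).
Local Notation q := edge.

Lemma coll_tie u v : N u -> N v ->
  coll u = coll v <-> exists A, [/\ tie pr Q A, A u & A v].
Proof. by case: htau => _; exact. Qed.

Lemma coll_rect i s t : s \in `[0, 1] -> t \in `[0, 1] -> coll (pr (Q i s t)) = q i s.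
Proof.
move=> s01 t01; apply/(coll_tie (Q_nbhd i s01 t01) (Q_nbhd i s01 z01)).
exists (tie_at i s); split; first exact: tie_at_tie.
  by apply: (tie_at_sub s01); exists t.
by apply: (tie_at_sub s01); exists 0 => //; exact: z01.
Qed.

Lemma coll_act B i s t : Gamma B -> s \in `[0, 1] -> t \in `[0, 1] ->
  coll (pr (B *m Q i s t)) = q i s.
Proof.
move=> gB s01 t01; rewrite (pr_Gamma hGamma hX gB (Q_Hyp i s01 t01)).
exact: coll_rect.
Qed.

Lemma tie_oo A i s t : s \in `]0, 1[ -> t \in `[0, 1] -> tie pr Q A ->
  A (pr (Q i s t)) -> A = rect_tie pr Q i s.
Proof.
move=> soo t01 [[j [s' s'oo ->]]|[x xs ->]].
  move=> [t' t'01 e]; have [-> -> _] := Q_inj soo t01 (oo01 s'oo) t'01 (esym e).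
  by [].
move=> /connected_component_sub[j [] [t' t'01 e]].
  have [_ s0 _] := Q_inj soo t01 z01 t'01 (esym e).
  by move: soo; rewrite s0 in_itv /= ltxx.
have one01 : (1 : R) \in `[0, 1] by rewrite in_itv /= ler01 lexx.
have [_ s1 _] := Q_inj soo t01 one01 t'01 (esym e).
by move: soo; rewrite s1 in_itv /= ltxx andbF.
Qed.

Lemma edge_inj i j s s' : s \in `]0, 1[ -> s' \in `[0, 1] -> q i s = q j s' ->
  i = j /\ s = s'.
Proof.
move=> soo s'01 e; have z := @z01 R; have s01 := oo01 soo.
have [A [tA A1 A2]] := (coll_tie (Q_nbhd i s01 z) (Q_nbhd j s'01 z)).1 e.
have AE := tie_oo soo z tA A1; rewrite AE in A2.
have [t t01 e'] := A2.
by have [-> -> _] := Q_inj soo t01 s'01 z e'.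
Qed.

Lemma edge_surj p : exists i s, s \in `[0, 1] /\ p = q i s.
Proof.
case: htau => -[im _] _; have : [set: tau] p by [].
rewrite -im => -[u [i [s [t [s01 t01 ->]]]] <-].
by exists i, s; split=> //; exact: coll_rect.
Qed.

Lemma short_tie i s : s \in `[0, 1] -> s \notin `]0, 1[ -> forall A, tie pr Q A ->
  A (pr (Q i s 0)) -> A = tie_at i s.
Proof.
move=> s01 ns A [[j [s' s'oo ->]]|[x xs ->]].
  move=> [t t01 e]; have [_ es _] := Q_inj s'oo t01 s01 z01 e.
  by rewrite -es s'oo in ns.
by move=> h; rewrite /tie_at (negbTE ns); exact: same_connected_component.
Qed.

Lemma tie_at_end i j s s' : s \in `[0, 1] -> s' \in `[0, 1] -> s \notin `]0, 1[ ->
  q i s = q j s' -> tie_at i s = tie_at j s' /\ (s' \notin `]0, 1[).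
Proof.
move=> s01 s'01 ns e; have z := @z01 R.
have ns' : s' \notin `]0, 1[.
  apply: contra ns => s'oo; have [_ <-] := edge_inj s'oo s01 (esym e).
  by [].
split=> //.
have [A [tA A1 A2]] := (coll_tie (Q_nbhd i s01 z) (Q_nbhd j s'01 z)).1 e.
by rewrite -(short_tie s01 ns tA A1) -(short_tie s'01 ns' tA A2).
Qed.

Lemma coll_continuous : {within N, continuous coll}.
Proof.
case: htau => -[_ cq] _; apply/within_continuousP => x Nx O.
rewrite nbhsE => -[U [oU Ux] UO].
have [W oW e] := (cq U).1 oU.
have Wx : W x.
  have : (N `&` coll @^-1` U) x by [].
  by rewrite e => -[].
apply: filterS (open_nbhs_nbhs (conj oW Wx)) => y Wy Ny; apply: UO.
have : (N `&` W) y by [].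
by rewrite -e => -[].
Qed.

Lemma coll_path_continuous (T : topologicalType) (K : set T) (c : T -> V) :
  {within K, continuous c} -> (forall u, K u -> Hyp (c u) /\ N (pr (c u))) ->
  {within K, continuous (fun u => coll (pr (c u)))}.
Proof.
move=> /within_continuousP cc hc; apply/within_continuousP => u Ku O nO.
have [Hu Nu] := hc u Ku.
have n1 := (within_continuousP _ _).1 coll_continuous _ Nu _ nO.
have n2 := (within_continuousP _ _).1 (pr_continuous hX) _ Hu _ n1.
have n3 := cc u Ku _ n2.
apply: filterS n3 => v hv Kv; have [Hv Nv] := hc v Kv.
exact: hv Kv Hv Nv.
Qed.

Lemma edge_continuous i : {within `[0, 1], continuous (q i)}.
Proof.
apply: (@coll_path_continuous _ _ (fun s => Q i s 0)); last first.
  by move=> s s01; split; [apply: (Q_Hyp)|apply: Q_nbhd] => //; exact: z01.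
apply/within_continuousP => s s01 O nO.
have cQ := (within_continuousP _ _).1 (@Q_continuous i)
  (s, 0) (conj s01 z01) _ nO.
have /nbhs_ballP[d /= d0 hd] := cQ.
apply/nbhs_ballP; exists d => // u su u01.
have h : ball (s, 0 : R) d (u, 0) by split=> //; exact: ballxx.
exact: (hd _ h (conj u01 z01)).
Qed.

(** The topology of the track is tested edge by edge: the complement of [O] corresponds to finitely
    many compact unions of vertical sides, whose images in the surface are closed. *)
Lemma open_track (O : set tau) :
  (forall i s, s \in `[0, 1] -> O (q i s) -> exists2 d : R, 0 < d &
     forall s', s' \in `[0, 1] -> `|s' - s| < d -> O (q i s')) -> open O.
Proof.
move=> hO; case: htau => -[_ cq] _; apply/cq.
pose K i : set (R * R) := [set s | s \in `[0, 1] /\ ~ O (q i s)] `*` `[0, 1]%classic.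
have K01 i : K i `<=` `[0, 1]%classic `*` `[0, 1]%classic.
  by move=> [s t] [[s01 _] t01].
have clK i : closed (K i).
  have cl1 : closed [set s | s \in `[0, 1] /\ ~ O (q i s)].
    apply: closed_nbhsP => s ns.
    have [s01|ns01] := boolP (s \in `[0, 1]).
      have Os : O (q i s) by apply: contrapT => nO; apply: ns.
      have [d d0 hd] := hO i s s01 Os.
      by apply/nbhs_distP; exists d => // s' ss' [s'01]; apply; exact: hd.
    have : nbhs s (~` [set` `[0, 1] : interval R]).
      apply: open_nbhs_nbhs; split; last by apply/negP.
      by apply: closed_openC; exact: (compact_closedR (@segment_compact R 0 1)).
    by apply: filterS => s' ns' [].
  have -> : K i = (fun w : R * R => w.1) @^-1` [set s | s \in `[0, 1] /\ ~ O (q i s)]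
      `&` (fun w : R * R => w.2) @^-1` `[0, 1]%classic by [].
  apply: closedI.
    have cs : continuous (fun w : R * R => w.1) by move=> [s t]; exact: cvg_fst.
    exact: ((continuous_closedP _).1 cs _ cl1).
  have cs : continuous (fun w : R * R => w.2) by move=> [s t]; exact: cvg_snd.
  exact: ((continuous_closedP _).1 cs _ (compact_closedR (@segment_compact R 0 1))).
pose F i := pr @` ((fun w : R * R => Q i w.1 w.2) @` K i).
have clF i : closed (F i).
  apply: (closed_pr hGamma hX (Q_compact (K01 i) (clK i))).
  by move=> _ [[s t] /K01[s01 t01] <-]; exact: (Q_Hyp).
exists (~` (\bigcup_(i in [set: 'I_n]) F i)).
  by apply: closed_openC; apply: closed_bigcup; [exact: finite_finset|move=> i _].
apply/seteqP; split => x [Nx h]; (split; first exact: Nx).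
  move=> [i _ [_ [[s t] [[/= s01 nO] t01] <-] e]]; apply: nO.
  by rewrite -(coll_rect i s01 t01) e.
move: Nx h => [i [s [t [s01 t01 ->]]]] nF /=; rewrite coll_rect //.
apply: contrapT => nO; apply: nF; exists i => //.
by exists (Q i s t) => //; exists (s, t).
Qed.

(** * The equivariant section normalized at the switches *)

Implicit Types (C : 'M[R]_3).

(** The midpoint is assigned to the end 0; the weak and strict inequalities of [passes] follow this
    choice. *)
Definition near_end s : R := if s <= 2^-1 then 0 else 1.

Lemma near_endP s : near_end s = 0 \/ near_end s = 1.
Proof. by rewrite /near_end; case: ifP; [left|right]. Qed.

Lemma near_end01 s : near_end s \in `[0, 1].
Proof. by case: (near_endP s) => ->; rewrite in_itv /= ?lexx ?ler01. Qed.

Lemma near_end_oo s : near_end s \notin `]0, 1[.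
Proof. by case: (near_endP s) => ->; rewrite in_itv /= ltxx ?andbF. Qed.

Lemma near_end0 : near_end 0 = 0. Proof. by rewrite /near_end ifT //; lra. Qed.

Lemma near_end1 : near_end 1 = 1. Proof. by rewrite /near_end ifF //; lra. Qed.

Lemma near_end_id s : s \in `[0, 1] -> s \notin `]0, 1[ -> near_end s = s.
Proof. by move=> s01 ns; case: (end01 s01 ns) => ->; rewrite ?near_end0 ?near_end1. Qed.

Lemma traverse_act B i g s t : Gamma B -> L g -> s \in `]0, 1[ -> t \in `[0, 1] ->
  geod g (B *m Q i s t) -> forall s', s' \in `[0, 1] ->
  exists2 t', t' \in `[0, 1] & geod g (B *m Q i s' t').
Proof.
move=> gB Lg soo t01 gx s' s'01.
have Lg' := leaf_act (GammaV hGamma gB) Lg; have ig' := leaf_ideal Lg'.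
have gE : geod_act B (geod_act (invmx B) g) = g by exact: (act_invK gB (leaf_ideal Lg)).
rewrite -gE in gx *; move/(geod_actE _ gB ig'): gx => gx.
have [t' t'01 gx'] := traverse Lg' soo (ex_intro2 _ _ t t01 gx) s'01.
by exists t' => //; apply/(geod_actE).
Qed.

Lemma cross_once_act B i g s t t' : Gamma B -> L g -> s \in `[0, 1] ->
  t \in `[0, 1] -> t' \in `[0, 1] -> geod g (B *m Q i s t) ->
  geod g (B *m Q i s t') -> t = t'.
Proof.
move=> gB Lg s01 t01 t'01.
have Lg' := leaf_act (GammaV hGamma gB) Lg; have ig' := leaf_ideal Lg'.
have gE : geod_act B (geod_act (invmx B) g) = g by exact: (act_invK gB (leaf_ideal Lg)).
rewrite -gE => /(geod_actE _ gB ig') g1 /(geod_actE _ gB ig') g2.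
exact: (rect_cross_once Lg' s01 t01 t'01 g1 g2).
Qed.

Lemma rect_lift_act B i s : Gamma B -> s \in `[0, 1] ->
  exists2 a, lifts pr L a (tie_at i s) &
  forall t, t \in `[0, 1] -> exists2 u, u \in `[0, 1] & B *m Q i s t = a u.
Proof.
move=> gB s01; have [a la ha] := rect_lift i s01.
exists (fun t => B *m a t); first exact: (lifts_act).
by move=> t t01; have [u u01 ->] := ha t t01; exists u.
Qed.

Definition tie_section A : V -> 'rV[R]_3 :=
  xget (fun=> 0) [set f | slithering_section Gamma pr L rho xi S A f].

Lemma tie_sectionP A : tie pr Q A ->
  slithering_section Gamma pr L rho xi S A (tie_section A).
Proof.
by move=> /(slithering_section_exists)[f hf]; rewrite /tie_section; apply: xgetI hf.
Qed.

(* [x] lies on the leaf [g] in the rectangle [B * Q i]; its value is that of the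
   chosen section over the nearer short side, carried along [g]. *)
Definition section_value x v := exists B i s t t' g,
  [/\ Gamma B, s \in `[0, 1], t \in `[0, 1], t' \in `[0, 1] &
  [/\ L g, geod g x, x = B *m Q i s t, geod g (B *m Q i (near_end s) t') &
  v = tie_section (tie_at i (near_end s)) (B *m Q i (near_end s) t')]].

(** Inside a rectangle the coordinates and the translate are unique. On a short side several
    rectangles may contain the point, but they meet in the same tie and use the same section over
    it. *)
Lemma section_value_uniq x v v' : section_value x v -> section_value x v' -> v = v'.
Proof.
move=> [B [i [s [t [t' [g [gB s01 t01 t'01 [Lg gx xE gx' ->]]]]]]]].
move=> [C [j [u [w [w' [h [gC u01 w01 w'01 [Lh hx xE' hx' ->]]]]]]]].
have gh := leaf_same Lg Lh gx hx.
have qq : q i s = q j u.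
  by rewrite -(coll_act i gB s01 t01) -(coll_act j gC u01 w01) -xE -xE'.
have pe : pr (Q i s t) = pr (Q j u w).
  rewrite -(pr_Gamma hGamma hX gB (Q_Hyp i s01 t01)) -xE xE'.
  by rewrite (pr_Gamma hGamma hX gC (Q_Hyp j u01 w01)).
have [soo|ns] := boolP (s \in `]0, 1[).
  have [ij es et] := Q_inj soo t01 u01 w01 pe; subst j u w.
  have BC : B = C.
    by apply: (Gamma_free hGamma gB gC (Q_Hyp i s01 t01)); rewrite -xE.
  subst C; congr (tie_section _ (_ *m Q i _ _)).
  by apply: (cross_once_act gB Lg (near_end01 s) t'01 w'01 gx'); rewrite gh.
have [te nu] := tie_at_end s01 u01 ns qq.
rewrite (near_end_id s01 ns) in gx' *; rewrite (near_end_id u01 nu) in hx' *.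
rewrite xE in gx; rewrite xE' in hx.
rewrite -(cross_once_act gB Lg s01 t01 t'01 gx gx').
rewrite -(cross_once_act gC Lh u01 w01 w'01 hx hx').
by rewrite te -xE xE'.
Qed.

Definition track_section x := xget 0 (section_value x).

Lemma track_sectionP x v : section_value x v -> track_section x = v.
Proof.
move=> xv; apply: (@section_value_uniq x) => //.
exact: (@xgetI _ 0 (section_value x) v xv).
Qed.

Lemma end_point B i s t g : Gamma B -> s \in `[0, 1] -> t \in `[0, 1] -> L g ->
  geod g (B *m Q i s t) -> exists2 t', t' \in `[0, 1] &
  geod g (B *m Q i (near_end s) t').
Proof.
move=> gB s01 t01 Lg gx.
have [soo|ns] := boolP (s \in `]0, 1[).
  exact: (traverse_act gB Lg soo t01 gx (near_end01 s)).
by exists t => //; rewrite near_end_id.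
Qed.

Lemma track_section_end B i s t t' g : Gamma B -> s \in `[0, 1] -> t \in `[0, 1] ->
  t' \in `[0, 1] -> L g -> geod g (B *m Q i s t) ->
  geod g (B *m Q i (near_end s) t') ->
  track_section (B *m Q i s t) = track_section (B *m Q i (near_end s) t').
Proof.
move=> gB s01 t01 t'01 Lg gx gx'.
have b01 := near_end01 s; have nb := near_end_oo s.
have nn := near_end_id b01 nb.
transitivity (tie_section (tie_at i (near_end s)) (B *m Q i (near_end s) t')).
  by apply: track_sectionP; exists B, i, s, t, t', g.
apply/esym; apply: track_sectionP.
by exists B, i, (near_end s), t', t', g; rewrite !nn.
Qed.

Lemma track_section_vertex x i s : s \in `[0, 1] -> s \notin `]0, 1[ ->
  lift_supp L x -> tie_at i s (pr x) -> track_section x = tie_section (tie_at i s) x.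
Proof.
move=> s01 ns [g Lg gx] xT.
have [xs|] := pselect (short_sides pr Q (pr x)); last first.
  by case; move: xT; rewrite /tie_at (negbTE ns); exact: connected_component_sub.
have [j [u [t [u01 nu t01 pe]]]] : exists j u t,
    [/\ u \in `[0, 1], u \notin `]0, 1[, t \in `[0, 1] & pr (Q j u t) = pr x].
  move: xs => [j [] [t t01 e]]; [exists j, 0, t|exists j, 1, t];
  by split; rewrite // in_itv /= ?lexx ?ler01 ?ltxx ?andbF.
have [B gB xE] := (pr_eq hX (Q_Hyp j u01 t01) (geod_Hyp gx)).1 pe.
have qq : q i s = q j u.
  rewrite -(coll_rect j u01 t01) pe.
  apply/(coll_tie); [exact: (Q_nbhd i s01 z01)|by rewrite -pe; exact: Q_nbhd|].
  exists (tie_at i s); split=> //; first exact: tie_at_tie.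
  by apply: (tie_at_sub s01); exists 0 => //; exact: z01.
have [-> _] := tie_at_end s01 u01 ns qq.
apply: track_sectionP; exists B, j, u, t, t, g; rewrite (near_end_id u01 nu).
by split=> //; split=> //; rewrite -xE.
Qed.

Lemma track_section_tie i s a t u g h : s \in `[0, 1] -> s \notin `]0, 1[ ->
  lifts pr L a (tie_at i s) -> t \in `[0, 1] -> u \in `[0, 1] -> L g -> L h ->
  geod g (a t) -> geod h (a u) ->
  crossed pr L Q h g /\ track_section (a u) = track_section (a t) *m S h g.
Proof.
move=> s01 ns la t01 u01 Lg Lh gt hu; have tA : tie pr Q (tie_at i s) by exact: tie_at_tie.
split; first exact: (crossedP tA la Lg Lh t01 u01 gt hu).
have inT w : w \in `[0, 1] -> tie_at i s (pr (a w)) by case: la => _ <- w01; exists w.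
have st : lift_supp L (a t) by exists g.
have su : lift_supp L (a u) by exists h.
rewrite (track_section_vertex s01 ns su (inT u u01)).
rewrite (track_section_vertex s01 ns st (inT t t01)).
by have [_ _ sl] := tie_sectionP tA; exact: sl.
Qed.

Lemma end_lift B i s t g : Gamma B -> s \in `[0, 1] -> t \in `[0, 1] -> L g ->
  geod g (B *m Q i s t) -> exists t',
  [/\ t' \in `[0, 1], geod g (B *m Q i (near_end s) t'),
     lift_supp L (B *m Q i (near_end s) t') &
     track_section (B *m Q i s t) =
     tie_section (tie_at i (near_end s)) (B *m Q i (near_end s) t')].
Proof.
move=> gB s01 t01 Lg gx; have [t' t'01 gx'] := end_point gB s01 t01 Lg gx.
exists t'; split=> //; first by exists g.
by apply: track_sectionP; exists B, i, s, t, t', g.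
Qed.

Lemma lift_of_end B i s t : Gamma B -> t \in `[0, 1] ->
  lift_supp L (B *m Q i (near_end s) t) ->
  lift_of pr L (tie_at i (near_end s)) (B *m Q i (near_end s) t).
Proof.
move=> gB t01 sx; split=> //; have b01 := near_end01 s.
rewrite /preimage /= (pr_Gamma hGamma hX gB (Q_Hyp i b01 t01)).
by apply: (tie_at_sub b01); exists t.
Qed.

Lemma lift_suppE x : lift_supp L x -> exists B i s t g,
  [/\ Gamma B, s \in `[0, 1], t \in `[0, 1], L g &
     geod g x /\ x = B *m Q i s t].
Proof.
move=> sx; have [g Lg gx] := sx.
have [B [i [s [t [gB s01 t01 xE]]]]] := lift_nbhdP (geod_Hyp gx) (lift_supp_nbhd sx).
by exists B, i, s, t, g.
Qed.

Lemma track_section_Dline x g : L g -> geod g x -> Dline xi g (track_section x).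
Proof.
move=> Lg gx; have [B [i [s [t [_ [gB s01 t01 _ [_ xE]]]]]]] := lift_suppE (ex_intro2 _ _ g Lg gx).
rewrite xE in gx *; have [t' [t'01 gx' sx' ->]] := end_lift gB s01 t01 Lg gx.
have [[D _] _ _] := tie_sectionP (tie_at_tie i (near_end01 s)).
by apply: D => //; exact: lift_of_end.
Qed.

Lemma track_section_neq0 x : lift_supp L x -> track_section x != 0.
Proof.
move=> /lift_suppE[B [i [s [t [g [gB s01 t01 Lg [gx xE]]]]]]].
rewrite xE in gx *; have [t' [t'01 gx' sx' ->]] := end_lift gB s01 t01 Lg gx.
have [_ n0 _] := tie_sectionP (tie_at_tie i (near_end01 s)).
by apply: n0; exact: lift_of_end.
Qed.

Lemma track_section_act C x : Gamma C -> lift_supp L x ->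
  track_section (C *m x) = track_section x *m invmx (rho C).
Proof.
move=> gC /lift_suppE[B [i [s [t [g [gB s01 t01 Lg [gx xE]]]]]]].
rewrite xE in gx *; have [t' [t'01 gx' sx' ->]] := end_lift gB s01 t01 Lg gx.
have [[_ eq] _ _] := tie_sectionP (tie_at_tie i (near_end01 s)).
rewrite -(eq C) //; last exact: lift_of_end.
have Lg' := leaf_act gC Lg; have ig := leaf_ideal Lg.
apply: track_sectionP; exists (C *m B), i, s, t, t', (geod_act C g).
split=> //; first exact: (GammaM hGamma).
by rewrite -!mulmxA; split=> //; apply/(geod_actE).
Qed.

(** * The transition cocycle *)

Local Notation ts := track_section.

Lemma strip_leaf i : exists B t g,
  [/\ Gamma B, t \in `[0, 1], L g & geod g (B *m Q i 2^-1 t)].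
Proof.
have tA : tie pr Q (tie_at i 2^-1) by apply: tie_at_tie; exact: oo01 half_oo.
have [a [t [g [la t01 Lg ga]]]] := tie_leaf tA.
have : tie_at i 2^-1 (pr (a t)) by case: la => _ <-; exists t.
rewrite /tie_at half_oo => -[t' t'01 e].
have [B gB E] := (pr_eq hX (Q_Hyp i (oo01 half_oo) t'01) (geod_Hyp ga)).1 e.
by exists B, t', g; rewrite -E.
Qed.

Lemma end_slide B i s t u g h : Gamma B -> s \in `[0, 1] -> s \notin `]0, 1[ ->
  t \in `[0, 1] -> u \in `[0, 1] -> L g -> L h ->
  geod g (B *m Q i s t) -> geod h (B *m Q i s u) ->
  crossed pr L Q h g /\ ts (B *m Q i s u) = ts (B *m Q i s t) *m S h g.
Proof.
move=> gB s01 ns t01 u01 Lg Lh gt hu.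
have [a la ha] := rect_lift_act i gB s01.
have [t' t'01 et] := ha t t01; have [u' u'01 eu] := ha u u01.
rewrite et eu; rewrite et in gt; rewrite eu in hu.
exact: (track_section_tie s01 ns la t'01 u'01 Lg Lh gt hu).
Qed.

(** The ratio is read off on one leaf. For any other leaf of the rectangle the same slithering map
    carries the reference values to its values at both ends, so the scalar is unchanged. *)
Lemma edge_ratio_exists i : exists2 r : R, r != 0 &
  forall B g s t t0 t1, Gamma B -> L g -> s \in `]0, 1[ -> t \in `[0, 1] ->
    geod g (B *m Q i s t) -> t0 \in `[0, 1] -> t1 \in `[0, 1] ->
    geod g (B *m Q i 0 t0) -> geod g (B *m Q i 1 t1) ->
    ts (B *m Q i 0 t0) = r *: ts (B *m Q i 1 t1).
Proof.
have [B0 [t [g0 [gB0 t01 Lg0 gx]]]] := strip_leaf i.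
have [u0 u001 g0x0] := traverse_act gB0 Lg0 half_oo t01 gx z01.
have [u1 u101 g0x1] := traverse_act gB0 Lg0 half_oo t01 gx one01.
have D0 := track_section_Dline Lg0 g0x0.
have D1 := track_section_Dline Lg0 g0x1.
have n0 : ts (B0 *m Q i 0 u0) != 0 by apply: (track_section_neq0); exists g0.
have n1 : ts (B0 *m Q i 1 u1) != 0 by apply: (track_section_neq0); exists g0.
have [w _ hw] := DlineP Lg0.
have [r0 e0] := hw _ D0; have [r1 e1] := hw _ D1.
have r0n : r0 != 0 by apply: contraNneq n0 => z; rewrite e0 z scale0r.
have r1n : r1 != 0 by apply: contraNneq n1 => z; rewrite e1 z scale0r.
exists (r0 / r1); first by rewrite mulf_neq0 // invr_eq0.
have ref : ts (B0 *m Q i 0 u0) = (r0 / r1) *: ts (B0 *m Q i 1 u1).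
  by rewrite e0 e1 scalerA divfK.
move=> B g s t' t0 t1 gB Lg soo t'01 gx' t001 t101 gt0 gt1.
(* Moves the given leaf into the translate of the rectangle that contains the reference leaf. *)
pose C := B0 *m invmx B.
have gC : Gamma C by apply: (GammaM hGamma) => //; exact: (GammaV hGamma).
have CB (y : V) : C *m (B *m y) = B0 *m y by rewrite /C -mulmxA (GammaK hGamma).
have Lg' := leaf_act gC Lg; have ig := leaf_ideal Lg.
have gt0' : geod (geod_act C g) (B0 *m Q i 0 t0) by rewrite -CB; apply/(geod_actE).
have gt1' : geod (geod_act C g) (B0 *m Q i 1 t1) by rewrite -CB; apply/(geod_actE).
have [_ s0] := end_slide gB0 z01 zero_noo u001 t001 Lg0 Lg' g0x0 gt0'.
have [_ s1] := end_slide gB0 one01 one_noo u101 t101 Lg0 Lg' g0x1 gt1'.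
have main : ts (B0 *m Q i 0 t0) = (r0 / r1) *: ts (B0 *m Q i 1 t1).
  by rewrite s0 s1 ref scalemxAl.
have uC := rho_unit gC.
have b0 := track_section_act gC (ex_intro2 _ _ g Lg gt0).
have b1 := track_section_act gC (ex_intro2 _ _ g Lg gt1).
rewrite CB in b0; rewrite CB in b1.
have := congr1 (mulmx^~ (rho C)) main.
by rewrite b0 b1 -!scalemxAl !mulmxKV.
Qed.

Definition edge_ratio i : R := xget 1 [set r : R | r != 0 /\
  forall B g s t t0 t1, Gamma B -> L g -> s \in `]0, 1[ -> t \in `[0, 1] ->
    geod g (B *m Q i s t) -> t0 \in `[0, 1] -> t1 \in `[0, 1] ->
    geod g (B *m Q i 0 t0) -> geod g (B *m Q i 1 t1) ->
    ts (B *m Q i 0 t0) = r *: ts (B *m Q i 1 t1)].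

Lemma edge_ratioP i : edge_ratio i != 0 /\
  forall B g s t t0 t1, Gamma B -> L g -> s \in `]0, 1[ -> t \in `[0, 1] ->
    geod g (B *m Q i s t) -> t0 \in `[0, 1] -> t1 \in `[0, 1] ->
    geod g (B *m Q i 0 t0) -> geod g (B *m Q i 1 t1) ->
    ts (B *m Q i 0 t0) = edge_ratio i *: ts (B *m Q i 1 t1).
Proof.
have [r r0 hr] := edge_ratio_exists i.
exact: (@xgetI _ 1 [set r : R | r != 0 /\
  forall B g s t t0 t1, Gamma B -> L g -> s \in `]0, 1[ -> t \in `[0, 1] ->
    geod g (B *m Q i s t) -> t0 \in `[0, 1] -> t1 \in `[0, 1] ->
    geod g (B *m Q i 0 t0) -> geod g (B *m Q i 1 t1) ->
    ts (B *m Q i 0 t0) = r *: ts (B *m Q i 1 t1)] r (conj r0 hr)).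
Qed.

(* A short move across the midpoint of the edge [i], where the normalization of
   the track section jumps. *)
Definition passes i (p p' : tau) := exists s s',
  [/\ p = q i s, p' = q i s', 0 < s <= 2^-1, 2^-1 < s' < 1 & s' - s < 2^-1].

(** The factor by which the section at the arrival point is to be multiplied to become the slithered
    section of the departure point. [passes_uniq] and [passes_asym] make the choice of the edge and
    of the branch immaterial. *)
Definition transition (p p' : tau) : R :=
  match pselect (exists i, passes i p p') with
  | left h => edge_ratio (projT1 (cid h))
  | right _ => match pselect (exists i, passes i p' p) with
    | left h => (edge_ratio (projT1 (cid h)))^-1
    | right _ => 1
    end
  end.

Lemma passesP i p p' : passes i p p' -> exists s s',
  [/\ p = q i s, p' = q i s', s \in `]0, 1[ & s' \in `]0, 1[] /\
  [/\ s <= 2^-1, 2^-1 < s' & s' - s < 2^-1].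
Proof.
move=> [s [s' [-> -> /andP[s0 s1] /andP[s'0 s'1] d]]]; exists s, s'.
by split; split=> //; rewrite in_itv /=; apply/andP; split; lra.
Qed.

Lemma passes_uniq i j p p' : passes i p p' -> passes j p p' -> i = j.
Proof.
move=> /passesP[s [s' [[-> _ soo _] _]]] /passesP[u [u' [[e _ uoo _] _]]].
by have [-> _] := edge_inj soo (oo01 uoo) e.
Qed.

Lemma passes_asym i j p p' : passes i p p' -> ~ passes j p' p.
Proof.
move=> /passesP[s [s' [[-> -> soo s'oo] [h1 h2 _]]]].
move=> /passesP[u [u' [[e _ uoo _] [h3 _ _]]]].
have [_ es] := edge_inj s'oo (oo01 uoo) e; subst u.
by move: h3; rewrite leNgt h2.
Qed.

Lemma transition_passes i p p' : passes i p p' -> transition p p' = edge_ratio i.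
Proof.
move=> h; rewrite /transition; case: pselect => [k|[]]; last by exists i.
by case: cid => j hj /=; rewrite (passes_uniq hj h).
Qed.

Lemma transition_passesV i p p' : passes i p' p -> transition p p' = (edge_ratio i)^-1.
Proof.
move=> h; rewrite /transition; case: pselect => [[j hj]|_].
  by case: (passes_asym h hj).
case: pselect => [k|[]]; last by exists i.
by case: cid => j hj /=; rewrite (passes_uniq hj h).
Qed.

Lemma transition_id p p' : (forall i, ~ passes i p p') -> (forall i, ~ passes i p' p) ->
  transition p p' = 1.
Proof.
move=> h1 h2; rewrite /transition; case: pselect => [[i hi]|_]; first by case: (h1 i).
by case: pselect => [[i hi]|//]; case: (h2 i).
Qed.

Lemma transition_neq0 p p' : transition p p' != 0.
Proof.
rewrite /transition; case: pselect => [k|_]; first by case: (edge_ratioP (projT1 (cid k))).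
case: pselect => [k|_]; last exact: oner_neq0.
by rewrite invr_eq0; case: (edge_ratioP (projT1 (cid k))).
Qed.

Lemma passes_edge i j s s' : s \in `]0, 1[ -> s' \in `[0, 1] ->
  passes j (q i s) (q i s') -> j = i /\ [/\ s <= 2^-1, 2^-1 < s' & s' - s < 2^-1].
Proof.
move=> soo s'01 /passesP[u [u' [[e e' uoo u'oo] hu]]].
have [ij es] := edge_inj soo (oo01 uoo) e; subst j u.
by have [_ es'] := edge_inj u'oo s'01 (esym e'); subst u'.
Qed.

(** Inside an edge the transition is the coboundary of a step function that jumps at the midpoint,
    as long as the two points are less than one half apart. *)
Lemma transition_edge i s s' : s \in `]0, 1[ -> s' \in `]0, 1[ -> `|s' - s| < 2^-1 ->
  transition (q i s) (q i s') =
  (if 2^-1 < s' then edge_ratio i else 1) / (if 2^-1 < s then edge_ratio i else 1).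
Proof.
move=> soo s'oo; rewrite ltr_norml => /andP[d1 d2].
have [r0 _] := edge_ratioP i.
have pos (u : R) : u \in `]0, 1[ -> 0 < u < 1 by rewrite in_itv.
have [/andP[s0 s1] /andP[s'0 s'1]] := (pos s soo, pos s' s'oo).
have [l|l] := ltP 2^-1 s; have [l'|l'] := ltP 2^-1 s'.
- rewrite divff //; apply: transition_id => j.
    by move=> /(passes_edge soo (oo01 s'oo))[_ [h _ _]]; rewrite leNgt l in h.
  by move=> /(passes_edge s'oo (oo01 soo))[_ [h _ _]]; rewrite leNgt l' in h.
- rewrite mul1r; apply: transition_passesV; exists s', s.
  by rewrite s'0 l' l s1; split=> //; lra.
- rewrite divr1; apply: transition_passes; exists s, s'.
  by rewrite s0 l l' s'1; split=> //; lra.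
- rewrite divr1; apply: transition_id => j.
    by move=> /(passes_edge soo (oo01 s'oo))[_ [_ h _]]; rewrite ltNge l' in h.
  by move=> /(passes_edge s'oo (oo01 soo))[_ [_ h _]]; rewrite ltNge l in h.
Qed.

Definition near_vertex p := exists i s,
  [/\ s \in `[0, 1], p = q i s & s < 4^-1 \/ 1 - 4^-1 < s].

Lemma transition_star p p' : near_vertex p -> near_vertex p' -> transition p p' = 1.
Proof.
have aux i r r' : near_vertex r -> near_vertex r' -> ~ passes i r r'.
  move=> [j [u [u01 eu hu]]] [k [w [w01 ew hw]]].
  move=> /passesP[s [s' [[e e' soo s'oo] [h1 h2 h3]]]].
  have [_ es] := edge_inj soo u01 (etrans (esym e) eu); subst u.
  have [_ es'] := edge_inj s'oo w01 (etrans (esym e') ew); subst w.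
  exact: star_gap h1 h2 h3 hu hw.
by move=> h h'; apply: transition_id => i; exact: aux.
Qed.

Lemma near_vertex_open : open near_vertex.
Proof.
apply: (open_track) => i s s01 [j [u [u01 e hu]]].
have [soo|ns] := boolP (s \in `]0, 1[).
  have [ij es] := edge_inj soo u01 e; subst j u.
  case: hu => hu.
    exists (4^-1 - s); first by rewrite subr_gt0.
    move=> s' s'01; rewrite ltr_norml => /andP[h1 h2]; exists i, s'; split=> //; left; lra.
  exists (s - (1 - 4^-1)); first by rewrite subr_gt0.
  move=> s' s'01; rewrite ltr_norml => /andP[h1 h2]; exists i, s'; split=> //; right; lra.
exists 4^-1; first by rewrite invr_gt0.
move=> s' s'01; rewrite ltr_norml => /andP[h1 h2]; exists i, s'; split=> //.
by case: (end01 s01 ns) => es; [left|right]; lra.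
Qed.

Lemma vertex_near i s : s \in `[0, 1] -> s \notin `]0, 1[ -> near_vertex (q i s).
Proof.
move=> s01 ns; exists i, s; split=> //; case: (end01 s01 ns) => ->; [left|right]; lra.
Qed.

Lemma edge_nbhd_open i s d : s \in `]0, 1[ ->
  (forall s', `|s' - s| <= d -> s' \in `]0, 1[) ->
  open [set p | exists2 s', `|s' - s| < d & p = q i s'].
Proof.
move=> soo hd; apply: (open_track) => j u u01 [s' ss' e].
have s'oo : s' \in `]0, 1[ by apply: hd; exact: ltW.
have [ij es] := edge_inj s'oo u01 (esym e); subst j u.
exists (d - `|s' - s|); first by rewrite subr_gt0.
move=> u' u'01 hu; exists u' => //.
by have := ler_distD s' u' s; lra.
Qed.

(** Near a switch the transition is identically 1, and inside an edge it is a coboundary; the radius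
    at most 1/4 keeps any two points of the neighborhood within the reach of [transition_edge]. *)
Lemma transition_cocycle p0 : exists2 W : set tau, nbhs p0 W &
  forall p1 p2 p3, W p1 -> W p2 -> W p3 ->
    transition p1 p2 * transition p2 p3 = transition p1 p3.
Proof.
have [i [s [s01 ->]]] := edge_surj p0.
have [soo|ns] := boolP (s \in `]0, 1[); last first.
  exists near_vertex.
    by apply: open_nbhs_nbhs; split; [exact: near_vertex_open|exact: vertex_near].
  by move=> p1 p2 p3 h1 h2 h3; rewrite !transition_star ?mulr1.
have [e e0 he] := oo_nbhs soo.
pose d := Num.min e 4^-1.
have d0 : 0 < d by rewrite lt_min e0 /=; lra.
have de : d <= e by rewrite ge_min lexx.
have d4 : d <= 4^-1 by rewrite ge_min lexx orbT.
have hd s' : `|s' - s| <= d -> s' \in `]0, 1[.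
  by move=> h; apply: he; exact: le_trans h de.
exists [set p | exists2 s', `|s' - s| < d & p = q i s'].
  apply: open_nbhs_nbhs; split; first exact: edge_nbhd_open.
  by exists s => //; rewrite subrr normr0.
move=> p1 p2 p3 [s1 h1 ->] [s2 h2 ->] [s3 h3 ->].
have close (u u' : R) : `|u - s| < d -> `|u' - s| < d -> `|u' - u| < 2^-1.
  by move=> hu hu'; have := ler_distD s u' u; rewrite (distrC s u); lra.
have o1 := hd s1 (ltW h1); have o2 := hd s2 (ltW h2); have o3 := hd s3 (ltW h3).
rewrite !transition_edge ?close //.
have [r0 _] := edge_ratioP i.
have n0 (b : bool) : (if b then edge_ratio i else 1) != 0.
  by case: b => //; exact: oner_neq0.
by rewrite mulrC mulrA divfK.
Qed.

Local Notation trans := transition.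

(** Both leaves cross the whole rectangle and are related by one slithering map at either end. If
    their points lie in different halves, [edge_ratio] converts one normalization into the other. *)
Lemma strip_transition B i s s' t t' g h : Gamma B -> s \in `]0, 1[ ->
  s' \in `]0, 1[ -> t \in `[0, 1] -> t' \in `[0, 1] -> `|s' - s| < 2^-1 ->
  L g -> L h -> geod g (B *m Q i s t) -> geod h (B *m Q i s' t') ->
  crossed pr L Q h g /\
  trans (q i s) (q i s') *: ts (B *m Q i s' t') = ts (B *m Q i s t) *m S h g.
Proof.
move=> gB soo s'oo t01 t'01 ss Lg Lh gx hy.
have [t0 t001 g0] := traverse_act gB Lg soo t01 gx z01.
have [t1 t101 g1] := traverse_act gB Lg soo t01 gx one01.
have [u0 u001 h0] := traverse_act gB Lh s'oo t'01 hy z01.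
have [u1 u101 h1] := traverse_act gB Lh s'oo t'01 hy one01.
have [c sl0] := end_slide gB z01 zero_noo t001 u001 Lg Lh g0 h0.
have [_ sl1] := end_slide gB one01 one_noo t101 u101 Lg Lh g1 h1.
have [r0 hr] := edge_ratioP i.
have rg := hr B g s t t0 t1 gB Lg soo t01 gx t001 t101 g0 g1.
have rh := hr B h s' t' u0 u1 gB Lh s'oo t'01 hy u001 u101 h0 h1.
have E (k : V * V) (v w w0 w1 : R) : L k -> v \in `]0, 1[ -> w \in `[0, 1] ->
    w0 \in `[0, 1] -> w1 \in `[0, 1] -> geod k (B *m Q i v w) ->
    geod k (B *m Q i 0 w0) -> geod k (B *m Q i 1 w1) ->
    ts (B *m Q i v w) = if 2^-1 < v then ts (B *m Q i 1 w1) else ts (B *m Q i 0 w0).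
  move=> Lk voo w01 w001 w101 kv k0 k1; have v01 := oo01 voo.
  have [l|l] := ltP 2^-1 v.
    have ne : near_end v = 1 by rewrite /near_end leNgt l.
    by rewrite -ne; apply: (track_section_end gB v01 w01 w101 Lk kv); rewrite ne.
  have ne : near_end v = 0 by rewrite /near_end l.
  by rewrite -ne; apply: (track_section_end gB v01 w01 w001 Lk kv); rewrite ne.
split=> //.
rewrite (E g s t t0 t1) // (E h s' t' u0 u1) // (transition_edge) //.
have [l|l] := ltP 2^-1 s; have [l'|l'] := ltP 2^-1 s'.
- by rewrite divff // scale1r.
- by rewrite mul1r rh scalerA mulVf // scale1r.
- by rewrite divr1 -rh.
- by rewrite divr1 scale1r.
Qed.

Lemma lifts_through A a b t u : lifts pr L a A -> lifts pr L b A ->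
  t \in `[0, 1] -> u \in `[0, 1] -> a t = b u ->
  forall w, w \in `[0, 1] -> exists2 w', w' \in `[0, 1] & b w = a w'.
Proof.
move=> la lb t01 u01 e; have [C gC hC] := lifts_same_translate la lb.
have [u' u'01 e'] := hC u u01.
have [C1 _] : 1%:M = C /\ t = u'.
  apply: (lifts_translate_uniq la (Gamma1 hGamma) gC t01 u'01).
  by rewrite mul1mx e.
move=> w w01; have [w' w'01 ->] := hC w w01; exists w' => //.
by rewrite -C1 mul1mx.
Qed.

(** Over the interior of an edge, the points near [x0] lie in one translated rectangle. Over a
    switch they may lie in several, but following their leaves to the short sides brings them to one
    lift of the switch, where the section was chosen slithering invariant. *)
Lemma track_section_local x0 : lift_supp L x0 -> exists2 d : R, 0 < d &
  forall y z g h, `|y - x0| < d -> `|z - x0| < d ->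
  L g -> geod g y -> L h -> geod h z ->
  crossed pr L Q h g /\
  trans (coll (pr y)) (coll (pr z)) *: ts z = ts y *m S h g.
Proof.
move=> sx0; have [B0 [i [s0 [t0 [g0 [gB0 s001 t001 Lg0 [gx0 xE]]]]]]] := lift_suppE sx0.
have Hx0 := geod_Hyp gx0.
have [soo|ns] := boolP (s0 \in `]0, 1[).
  have [e e0 he] := oo_nbhs soo.
  (* Two points whose first coordinates are within 1/8 of [s0] differ there by at most 1/4, below
     the bound 1/2 of [strip_transition]. *)
  pose d := Num.min e 8^-1.
  have d0 : 0 < d by rewrite lt_min e0 /=; lra.
  have de : d <= e by rewrite ge_min lexx.
  have d8 : d <= 8^-1 by rewrite ge_min lexx orbT.
  have /nbhs_distP[r r0 hr] := rect_near Hx0 d0.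
  exists r => // y z g h yr zr Lg gy Lh hz.
  have rep w k : L k -> geod k w -> `|w - x0| < r -> exists s t,
      [/\ s \in `]0, 1[, t \in `[0, 1], `|s - s0| <= d & w = B0 *m Q i s t].
    move=> Lk kw wr.
    have [B [j [s [t [gB s01 t01 wE]]]]] :=
      lift_nbhdP (geod_Hyp kw) (lift_supp_nbhd (ex_intro2 _ _ k Lk kw)).
    have [s' [t' [s'01 t'01 ss x0E]]] := hr w wr B j s t gB s01 t01 wE.
    have pe : pr (Q i s0 t0) = pr (Q j s' t').
      rewrite -(pr_Gamma hGamma hX gB0 (Q_Hyp i s001 t001)) -xE x0E.
      by rewrite (pr_Gamma hGamma hX gB (Q_Hyp j s'01 t'01)).
    have [ij es et] := Q_inj soo t001 s'01 t'01 pe; subst j s' t'.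
    have BB : B = B0.
      by apply: (Gamma_free hGamma gB gB0 (Q_Hyp i s001 t001)); rewrite -xE.
    subst B; exists s, t; split=> //; apply: he; exact: le_trans ss de.
  have [s [t [s_oo t01 sd yE]]] := rep y g Lg gy yr.
  have [s' [t' [s'oo t'01 s'd zE]]] := rep z h Lh hz zr.
  rewrite yE in gy *; rewrite zE in hz *.
  rewrite !(coll_act) ?(oo01 s_oo) ?(oo01 s'oo) //.
  apply: strip_transition => //.
  have := ler_distD s0 s' s; rewrite (distrC s0 s); lra.
have e8 : (0 : R) < 8^-1 by lra.
have nr := rect_near Hx0 e8.
have [d d0 hd] := (nbhs_distP _ _).1 nr.
have [a la ha] := rect_lift_act i gB0 s001.
have [w0 w001 x0a] := ha t0 t001; rewrite -xE in x0a.
exists d => // y z g h yr zr Lg gy Lh hz.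
have rep w k : L k -> geod k w -> `|w - x0| < d -> near_vertex (coll (pr w)) /\
    exists2 u, u \in `[0, 1] & geod k (a u) /\ ts w = ts (a u).
  move=> Lk kw wr.
  have [B [j [s [t [gB s01 t01 wE]]]]] :=
    lift_nbhdP (geod_Hyp kw) (lift_supp_nbhd (ex_intro2 _ _ k Lk kw)).
  have [s' [t' [s'01 t'01 ss x0E]]] := hd w wr B j s t gB s01 t01 wE.
  have qq : q i s0 = q j s'.
    rewrite -(coll_act i gB0 s001 t001) -(coll_act j gB s'01 t'01).
    by rewrite -xE -x0E.
  have [te ns'] := tie_at_end s001 s'01 ns qq.
  have nes : near_end s = s'.
    move: ss; rewrite /near_end ler_norml => /andP[l1 l2].
    case: (end01 s'01 ns') => es; rewrite es in l1 l2 *.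
      by rewrite ifT //; lra.
    by rewrite ifF //; apply/negbTE; rewrite -ltNge; lra.
  split.
    exists j, s; split=> //; first by rewrite wE (coll_act).
    move: ss; rewrite ler_norml => /andP[l1 l2].
    by case: (end01 s'01 ns') => es; rewrite es in l1 l2; [left|right]; lra.
  rewrite wE in kw *.
  have [t2 t201 k2] := end_point gB s01 t01 Lk kw.
  rewrite (track_section_end gB s01 t01 t201 Lk kw k2).
  have [b lb hb] := rect_lift_act j gB s'01; rewrite -te in lb.
  have [u0 u001 x0b] := hb t' t'01; rewrite -x0E in x0b.
  rewrite nes in k2 *.
  have [u1 u101 e1] := hb t2 t201.
  have [u2 u201 e2] := lifts_through la lb w001 u001 (etrans (esym x0a) x0b) u101.
  by exists u2 => //; rewrite -e2 -e1.
have [nvy [u u01 [gu ->]]] := rep y g Lg gy yr.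
have [nvz [u' u'01 [hu' ->]]] := rep z h Lh hz zr.
rewrite (transition_star nvy nvz) scale1r.
exact: (track_section_tie s001 ns la u01 u'01 Lg Lh gu hu').
Qed.

Lemma transition_refl p : trans p p = 1.
Proof.
apply: transition_id => i hi; exact: (passes_asym hi hi).
Qed.

(* A nonzero function on the arc [A] which, multiplied by [track_section],
   becomes invariant under slithering. *)
Definition arc_primitive A (f : X -> R) := (forall u, f u != 0) /\
  forall x0, Hyp x0 -> A (pr x0) -> exists2 d : R, 0 < d &
    forall y z, Hyp y -> Hyp z -> A (pr y) -> A (pr z) ->
      `|y - x0| < d -> `|z - x0| < d ->
      f (pr z) = f (pr y) * trans (coll (pr y)) (coll (pr z)).

(** The primitive along one lift descends to a function on the embedded arc. What remains is to
    bound the parameters of nearby points, since nearness is measured in the universal cover. *)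
Lemma arc_primitive_exists A : transversal_in pr L N A -> exists f, arc_primitive A f.
Proof.
move=> [AN [a la]].
have ca := lifts_continuous la.
have arcA t : t \in `[0, 1] -> A (pr (a t)) by case: la => _ <- t01; exists t.
have cF : {within `[0, 1], continuous (fun t => coll (pr (a t)))}.
  apply: (coll_path_continuous ca) => t t01; split.
    exact: (lifts_Hyp la).
  by apply: AN; exact: arcA.
have [f0 [d [d0 f0n hf0]]] := path_primitive transition_neq0 (transition_cocycle) cF.
pose P u t := t \in `[0, 1] /\ pr (a t) = u.
pose f u := f0 (xget 0 (P u)).
have fE t : t \in `[0, 1] -> f (pr (a t)) = f0 t.
  move=> t01; rewrite /f; congr f0.
  have [i e] := @xgetI _ 0 (P (pr (a t))) t (conj t01 erefl).
  exact: (lifts_inj la i t01 e).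
exists f; split; first by move=> u; exact: f0n.
move=> x0 Hx0 Ax0.
have rep x : Hyp x -> A (pr x) -> exists B t, [/\ Gamma B, t \in `[0, 1] & x = B *m a t].
  case: (la) => _ <- Hx [t t01 e].
  have [B gB xE] := (pr_eq hX (lifts_Hyp la t01) Hx).1 e.
  by exists B, t.
have [B0 [t0 [gB0 t001 x0E]]] := rep x0 Hx0 Ax0.
have d2 : 0 < d / 2 by rewrite divr_gt0.
(* No translate of the part of the arc with parameters far from [t0] contains [x0], so by
   compactness all of them avoid a neighborhood of it. *)
pose I := [set t : R | t \in `[0, 1] /\ d / 2 <= `|t - t0|].
have cI : compact I.
  apply: (subclosed_compact _ (@segment_compact R 0 1)); last by move=> t [].
  apply: closedI; first exact: (compact_closedR (@segment_compact R 0 1)).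
  have cn : continuous (fun t : R => `|t - t0|).
    apply: (@continuous_dist R R^o R^o _ 1) => u v; rewrite mul1r.
    have -> : u - v = (u - t0) - (v - t0) by rewrite opprB addrA subrK.
    exact: ler_dist_dist.
  exact: ((continuous_closedP _).1 cn _ (@closed_ge R (d / 2))).
have cK : compact (a @` I).
  by apply: continuous_compact cI; apply: continuous_subspaceW ca => t [].
have KH : a @` I `<=` Hyp by move=> _ [t [t01 _] <-]; exact: (lifts_Hyp la).
have nr := translates_near hGamma cK KH Hx0.
have [e e0 he] := (nbhs_distP _ _).1 nr.
exists e => // y z Hy Hz Ay Az ye ze.
have near0 x : Hyp x -> A (pr x) -> `|x - x0| < e -> exists t,
    [/\ t \in `[0, 1], `|t - t0| < d / 2 & pr x = pr (a t)].
  move=> Hx Ax xe; have [B [t [gB t01 xE]]] := rep x Hx Ax.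
  exists t; split=> //; last by rewrite xE (pr_Gamma hGamma hX gB (lifts_Hyp la t01)).
  rewrite ltNge; apply/negP => far.
  have [_ [t' [t'01 far'] <-] x0E'] := he x xe B (a t) gB (ex_intro2 _ _ t (conj t01 far) erefl) xE.
  have [_ tt] := lifts_translate_uniq la gB gB0 t'01 t001 (etrans (esym x0E') x0E).
  by move: far'; rewrite tt subrr normr0 leNgt d2.
have [t [t01 td ->]] := near0 y Hy Ay ye; have [u [u01 ud ->]] := near0 z Hz Az ze.
rewrite !fE //; apply: hf0 => //.
by have := ler_distD t0 u t; rewrite (distrC t0 t); lra.
Qed.

Definition arc_factor A : X -> R := xget (fun=> 1) [set f | arc_primitive A f].

Lemma arc_factorP A : transversal_in pr L N A -> arc_primitive A (arc_factor A).
Proof. by move=> /arc_primitive_exists[f hf]; rewrite /arc_factor; apply: xgetI hf. Qed.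

Lemma arc_primitive_along A f (c : R -> V) (a b : R) : arc_primitive A f ->
  {within `[a, b], continuous c} ->
  (forall t, t \in `[a, b] -> Hyp (c t) /\ A (pr (c t))) ->
  primitive_along trans (fun t => coll (pr (c t))) (fun t => f (pr (c t))) a b.
Proof.
move=> [_ hf] /within_continuous_distP cc hc t0 t0i.
have [Hc Ac] := hc t0 t0i; have [d d0 hd] := hf _ Hc Ac.
have [e e0 he] := cc t0 t0i d d0.
exists e => // s t si ti se te; have [Hs As] := hc s si; have [Ht At] := hc t ti.
by apply: hd => //; exact: he.
Qed.

(** Slithering from a leaf to itself is the identity, so along a leaf the track section changes only
    by transitions, which a primitive compensates. *)
Lemma transport_along_leaf (f : R -> R) (c : R -> V) g (a b : R) : a <= b -> L g ->
  {within `[a, b], continuous c} -> (forall t, t \in `[a, b] -> geod g (c t)) ->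
  primitive_along trans (fun t => coll (pr (c t))) f a b ->
  forall s t, s \in `[a, b] -> t \in `[a, b] -> f s *: ts (c s) = f t *: ts (c t).
Proof.
move=> ab Lg /within_continuous_distP cc gc hf.
apply: (locally_constant ab) => t0 t0i.
have [d d0 hd] := track_section_local (ex_intro2 _ _ g Lg (gc t0 t0i)).
have [e e0 he] := cc t0 t0i d d0; have [e' e'0 he'] := hf t0 t0i.
exists (Num.min e e'); first by rewrite lt_min e0 e'0.
move=> s t si ti; rewrite !lt_min => /andP[s1 s2] /andP[t1 t2].
have [cr E] := hd (c s) (c t) g g (he s si s1) (he t ti t1) Lg (gc s si) Lg (gc t ti).
rewrite (slithering_refl cr) mulmx1 in E.
by rewrite (he' s t) // -scalerA E.
Qed.

Definition slithering_connection A x : 'rV[R]_3 := arc_factor A (pr x) *: ts x.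
Local Notation nabla := slithering_connection.

Lemma connection_section A : transversal_in pr L N A ->
  bundle_section Gamma pr L rho xi A (nabla A).
Proof.
move=> tA; split.
  move=> x g _ Lg gx; apply: Dline_scale.
  exact: (track_section_Dline Lg gx).
move=> B x gB [sx Ax]; have [g Lg gx] := sx.
rewrite /nabla (pr_Gamma hGamma hX gB (geod_Hyp gx)) (track_section_act gB sx).
by rewrite scalemxAl.
Qed.

Lemma connection_neq0 A : transversal_in pr L N A -> nowhere_zero pr L A (nabla A).
Proof.
move=> /arc_factorP[f0 _] x [sx _]; rewrite /nabla scaler_eq0 (negbTE (f0 _)) /=.
exact: (track_section_neq0 sx).
Qed.

Lemma connection_restrict A (B : set X) : transversal_in pr L N A -> transversal_in pr L N B ->
  A `<=` B -> exists2 c : R, c != 0 &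
    forall x, lift_of pr L A x -> nabla A x = c *: nabla B x.
Proof.
move=> tA tB AB; have fA := arc_factorP tA; have fB := arc_factorP tB.
have [AN [a la]] := tA.
have ca := lifts_continuous la.
have arcA t : t \in `[0, 1] -> Hyp (a t) /\ A (pr (a t)).
  by move=> t01; split; [exact: (lifts_Hyp la)|case: la => _ <-; exists t].
have pA := arc_primitive_along fA ca arcA.
have arcB t : t \in `[0, 1] -> Hyp (a t) /\ B (pr (a t)).
  by move=> /arcA[Ha Aa]; split=> //; exact: AB.
have pB := arc_primitive_along fB ca arcB.
have [c c0 hc] := primitive_unique ler01 transition_neq0
  (fun t => fA.1 (pr (a t))) (fun t => fB.1 (pr (a t))) pA pB.
exists c => // x [_ Ax]; have [_ aE] := la.
have : arc_of pr a (pr x) by rewrite aE.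
by move=> [t t01 e]; rewrite /nabla -e hc // scalerA.
Qed.

(** One primitive on the isotopy square is proportional to the arc factor on the first and last
    rows. On a column that stays on a leaf, its product with the track section is constant. *)
Lemma connection_isotopy (K : R -> R -> V) : transversal_isotopy pr L N K ->
  exists2 c : R, c != 0 &
    forall t, t \in `[0, 1] -> lift_supp L (K 0 t) ->
      nabla (arc_of pr (K 1)) (K 1 t) = c *: nabla (arc_of pr (K 0)) (K 0 t).
Proof.
move=> [cK tK gK].
have HK u t : u \in `[0, 1] -> t \in `[0, 1] -> Hyp (K u t).
  by move=> u01 t01; have [[h _ _ _] _] := tK u u01; case: (h t t01).
have NK u t : u \in `[0, 1] -> t \in `[0, 1] -> N (pr (K u t)).
  by move=> u01 t01; have [_ h] := tK u u01; apply: h; exists t.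
have cF : {within `[0, 1] `*` `[0, 1], continuous (fun w : R * R => coll (pr (K w.1 w.2)))}.
  apply: (coll_path_continuous cK) => -[u t] [u01 t01].
  by split; [exact: HK|exact: NK].
have [f [d [d0 f0 hf]]] := @square_primitive _ _ _ transition_neq0 (transition_cocycle)
   (fun u t => coll (pr (K u t))) cF.
have e0 (x : R) : `|x - x| < d by rewrite subrr normr0.
have d2 : 0 < d / 2 by rewrite divr_gt0.
have close (t0 s t : R) : `|s - t0| < d / 2 -> `|t - t0| < d / 2 -> `|t - s| < d.
  by move=> hs ht; have := ler_distD t0 t s; rewrite (distrC t0 s); lra.
have row u : u \in `[0, 1] -> primitive_along trans (fun t => coll (pr (K u t))) (f u) 0 1.
  move=> u01 t0 t001; exists (d / 2) => // s t s01 t01 hs ht.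
  by apply: hf => //; exact: (close t0).
have col t : t \in `[0, 1] ->
    primitive_along trans (fun u => coll (pr (K u t))) (f^~ t) 0 1.
  move=> t01 u0 u001; exists (d / 2) => // s u s01 u01 hs hu.
  by apply: hf => //; exact: (close u0).
have cont_row u : u \in `[0, 1] -> {within `[0, 1], continuous (K u)}.
  by move=> u01; have [[h _ _ _] _] := tK u u01; apply: derivable_within => t /h[].
have cont_col t : t \in `[0, 1] -> {within `[0, 1], continuous (K^~ t)}.
  move=> t01; apply/within_continuousP => u u01 O nO.
  have := (within_continuousP _ _).1 cK (u, t) (conj u01 t01) O nO.
  move=> /nbhs_ballP[r /= r0 hr]; apply/nbhs_ballP; exists r => // v uv v01.
  have hb : ball (u, t) r (v, t) by split=> //; exact: ballxx.
  exact: (hr _ hb (conj v01 t01)).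
have compare u : u \in `[0, 1] -> exists2 c : R, c != 0 &
    forall t, t \in `[0, 1] -> arc_factor (arc_of pr (K u)) (pr (K u t)) = c * f u t.
  move=> u01.
  have tA : transversal_in pr L N (arc_of pr (K u)).
    by have [h1 h2] := tK u u01; split=> //; exists (K u).
  have fA := arc_factorP tA.
  have arcA t : t \in `[0, 1] -> Hyp (K u t) /\ arc_of pr (K u) (pr (K u t)).
    by move=> t01; split; [exact: HK|exists t].
  have pA := arc_primitive_along fA (cont_row u u01) arcA.
  exact: (primitive_unique ler01 transition_neq0 (fun t => fA.1 _) (f0 u) pA (row u u01)).
have [c0 c0n h0] := compare 0 z01; have [c1 c1n h1] := compare 1 one01.
exists (c1 / c0); first by rewrite mulf_neq0 // invr_eq0.
move=> t t01 [g Lg gt].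
have gc u : u \in `[0, 1] -> geod g (K u t).
  by move=> u01; apply/(gK u t g).
have := transport_along_leaf ler01 Lg (cont_col t t01) gc (col t t01) z01 one01.
rewrite /nabla h0 // h1 // -!scalerA => <-.
by rewrite (scalerA c0^-1) mulVf // scale1r.
Qed.

(** * Regularity of the connection *)

Lemma connection_local A x0 : transversal_in pr L N A -> lift_of pr L A x0 ->
  exists2 d : R, 0 < d & forall y z g h, lift_of pr L A y -> lift_of pr L A z ->
    `|y - x0| < d -> `|z - x0| < d -> L g -> geod g y -> L h -> geod h z ->
    crossed pr L Q h g /\ nabla A z = nabla A y *m S h g.
Proof.
move=> tA [sx0 Ax0]; have [_ fA] := arc_factorP tA.
have Hx0 := ((lift_suppP x0).1 sx0).1.
have [d1 d10 h1] := fA x0 Hx0 Ax0.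
have [d2 d20 h2] := track_section_local sx0.
exists (Num.min d1 d2); first by rewrite lt_min d10 d20.
move=> y z g h [sy Ay] [sz Az]; rewrite !lt_min => /andP[y1 y2] /andP[z1 z2] Lg gy Lh hz.
have [c E] := h2 y z g h y2 z2 Lg gy Lh hz.
split=> //; rewrite /slithering_connection.
rewrite (h1 y z (geod_Hyp gy) (geod_Hyp hz) Ay Az y1 z1).
by rewrite -scalerA E scalemxAl.
Qed.

Lemma lift_supp_closed x0 : Hyp x0 -> ~ lift_supp L x0 ->
  \forall y \near x0, ~ lift_supp L y.
Proof.
move=> Hx0 ns.
have cl : closed (supp pr L) by case: (setup_lamination H) => -[].
have nO : nbhs (pr x0) (~` supp pr L).
  apply: open_nbhs_nbhs; split; first exact: closed_openC.
  by move=> sx; apply: ns; apply/(lift_suppP).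
have := (within_continuousP _ _).1 (pr_continuous hX) x0 Hx0 _ nO.
apply: filterS => y hy sy; have [Hy sy'] := (lift_suppP y).1 sy.
exact: hy Hy sy'.
Qed.

Lemma height_near x0 y : `|y - x0| < 1 -> y i2 0 <= x0 i2 0 + 1.
Proof.
move=> h; have := normc_le (y - x0) i2; rewrite !mxE => h'.
have := ler_norm (y i2 0 - x0 i2 0); lra.
Qed.

Lemma grev_ideal_leaf g : L g -> L (grev g) /\ geod (grev g) = geod g.
Proof. by move=> Lg; split; [exact: (leaf_grev)|exact: geod_grev]. Qed.

(** Locally two values differ by a value times [S h g - S g g]; the slithering map is Hölder in the
    leaves, and the leaves are Lipschitz in their points. Away from the lamination the statement is
    vacuous. *)
Lemma connection_hoelder_local A x0 : transversal_in pr L N A -> Hyp x0 -> A (pr x0) ->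
  exists d K th : R, [/\ 0 < d, 0 <= K, 0 < th &
    forall y z, lift_of pr L A y -> lift_of pr L A z -> `|y - x0| < d -> `|z - x0| < d ->
      `|nabla A y - nabla A z| <= K * `|y - z| `^ th].
Proof.
move=> tA Hx0 Ax0.
have [sx0|nsx0] := pselect (lift_supp L x0); last first.
  have [d d0 hd] := (nbhs_distP _ _).1 (lift_supp_closed Hx0 nsx0).
  by exists d, 0, 1; split=> // y z [sy _] _ yd; case: (hd y yd sy).
have [g0 Lg0 gx0] := sx0.
have lx0 : lift_of pr L A x0 by [].
have [d1 d10 h1] := connection_local tA lx0.
have x00 : `|x0 - x0| < d1 by rewrite subrr normr0.
have [c00 _] := h1 x0 x0 g0 g0 lx0 lx0 x00 x00 Lg0 gx0 Lg0 gx0.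
have [[_ ax2 _ _ _] _ _] := setup_slithering H.
have [e [K [th [e0 th0 hK]]]] := ax2 g0 g0 c00.
pose M := Num.max 1 (x0 i2 0 + 1).
have M1 : 1 <= M by rewrite le_max lexx.
have [C C0 hC] := leaves_lipschitz M1.
(* The factor 3 accounts for [h]: it is within [2 * C * d] of [g], which is itself within [C * d] of
   [g0]. *)
pose d := Num.min (Num.min d1 1) (e / (3 * C)).
have C3 : 0 < 3 * C by rewrite mulr_gt0.
have d0 : 0 < d by rewrite !lt_min d10 ltr01 divr_gt0.
have dC : 3 * C * d <= e by rewrite mulrC -ler_pdivlMr // ge_min lexx orbT.
have low y : `|y - x0| < d -> `|y - x0| < d1 /\ y i2 0 <= M.
  rewrite !lt_min -andbA => /and3P[l1 l2 _]; split=> //.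
  by apply: le_trans (height_near l2) _; rewrite le_max lexx orbT.
have x0M : x0 i2 0 <= M by rewrite le_max; apply/orP; right; rewrite lerDl.
(* [leaves_lipschitz] compares leaves up to orientation; here the orientation closest to that of [g]
   is selected. *)
have orient g y z : L g -> geod g y -> y i2 0 <= M -> lift_supp L z -> z i2 0 <= M ->
    exists2 h, L h /\ geod h z & `|h - g| <= C * `|y - z|.
  move=> Lg gy yM [h Lh hz] zM.
  case: (hC g h y z (leaf_ideal Lg) (leaf_ideal Lh) _ gy hz yM zM) => [w gw hw|h2|h2].
  - exact: (leaf_meet Lg Lh gw hw).
  - by exists h.
  - by have [? e'] := grev_ideal_leaf Lh; exists (grev h); rewrite ?e'.
(* Bounds the connection near [x0], where its value at [y] is the value at [x0] slithered from [g0]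
   to [g]. *)
pose M3 := 3 * `|nabla A x0| * (`|S g0 g0| + `|K| * e `^ th).
have M30 : 0 <= M3 by rewrite !mulr_ge0 // addr_ge0 // mulr_ge0 // powR_ge0.
exists d, (3 * M3 * (`|K| * C `^ th)), th; split=> //.
  by apply: mulr_ge0; [apply: mulr_ge0|apply: mulr_ge0; rewrite ?powR_ge0].
move=> y z ly lz yd zd; have [yd1 yM] := low y yd; have [zd1 zM] := low z zd.
have [sy _] := ly; have [sz _] := lz.
have [g [Lg gy] gg0] := orient g0 x0 y Lg0 gx0 x0M sy yM.
have [h [Lh hz] hg] := orient g y z Lg gy yM sz zM.
have Cd (u w : V) : `|u - w| < 2 * d -> C * `|u - w| < 2 * C * d.
  by move=> uw; rewrite -mulrA mulrCA ltr_pM2l.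
have yz2 : `|y - z| < 2 * d.
  by have := ler_distD x0 y z; rewrite (distrC x0 z); lra.
have gd : `|g - g0| < e.
  have h3 : `|x0 - y| < d by rewrite distrC.
  have := ltr_pM2l C0 `|x0 - y| d; rewrite h3 => h4.
  have := mulr_gt0 C0 d0; move: gg0; lra.
have hd : `|h - g0| < e.
  have h3 : `|x0 - y| < d by rewrite distrC.
  have := ltr_pM2l C0 `|x0 - y| d; rewrite h3 => h4.
  have := Cd _ _ yz2; have := ler_distD g h g0; move: gg0 hg; lra.
have pairn (u v u' v' : V * V) (r : R) : `|u - u'| < r -> `|v - v'| < r ->
    `|(u, v) - (u', v')| < r.
  by move=> l1 l2; rewrite prod_normE gt_max l1 l2.
have [chg nz] := h1 y z g h ly lz yd1 zd1 Lg gy Lh hz.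
have [cgg _] := h1 y y g g ly ly yd1 yd1 Lg gy Lg gy.
have [cg0 ny] := h1 x0 y g0 g lx0 ly x00 yd1 Lg0 gx0 Lg gy.
have g00 : `|g0 - g0| < e by rewrite subrr normr0.
have b1 := hK h g g g chg cgg (pairn _ _ _ _ _ hd gd) (pairn _ _ _ _ _ gd gd).
have b2 := hK g g0 g0 g0 cg0 c00 (pairn _ _ _ _ _ gd g00) (pairn _ _ _ _ _ g00 g00).
have b2' : `|S g g0| <= `|S g0 g0| + `|K| * e `^ th.
  have := ler_normD (S g g0 - S g0 g0) (S g0 g0); rewrite subrK => tri.
  have b3 : K * `|(g, g0) - (g0, g0)| `^ th <= `|K| * e `^ th.
    apply: (@le_trans _ _ (`|K| * `|(g, g0) - (g0, g0)| `^ th)).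
      by rewrite ler_wpM2r ?powR_ge0 // ler_norm.
    apply: ler_wpM2l => //; apply: ge0_ler_powR; rewrite ?nnegrE ?(ltW th0) ?(ltW e0) //.
    exact: ltW (pairn _ _ _ _ _ gd g00).
  have := le_trans b2 b3; lra.
have nyM : `|nabla A y| <= M3.
  rewrite ny; apply: le_trans (mulmx_norm_le _ _) _.
  by rewrite /M3; apply: ler_wpM2l => //; rewrite mulr_ge0.
have step : `|nabla A y - nabla A z| <= 3 * M3 * `|S h g - S g g|.
  have -> : nabla A y - nabla A z = nabla A y *m (S g g - S h g).
    by rewrite mulmxBr -nz (slithering_refl cgg) mulmx1.
  apply: le_trans (mulmx_norm_le _ _) _; rewrite distrC.
  by apply: ler_wpM2r => //; apply: ler_wpM2l.
have hgC : `|(h, g) - (g, g)| <= C * `|y - z|.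
  rewrite prod_normE /= ge_max hg /=.
  by rewrite subrr normr0 mulr_ge0 // ltW.
apply: (hoelder_scale _ (ltW C0) (ltW th0) _ _ step b1 hgC) => //.
by rewrite mulr_ge0.
Qed.

Lemma connection_continuous A : transversal_in pr L N A ->
  {within lift_of pr L A, continuous (nabla A)}.
Proof.
move=> tA; apply/within_continuous_distP => x0 lx0 e e0.
have [sx0 Ax0] := lx0; have Hx0 := ((lift_suppP x0).1 sx0).1.
have [d [K [th [d0 K0 th0 hd]]]] := connection_hoelder_local tA Hx0 Ax0.
have K1 : 0 < K + 1 by rewrite ltr_wpDl.
pose r := (e / (K + 1)) `^ th^-1.
have eK : 0 < e / (K + 1) by rewrite divr_gt0.
have r0 : 0 < r by rewrite powR_gt0.
exists (Num.min d r); first by rewrite lt_min d0 r0.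
move=> y ly; rewrite lt_min => /andP[yd yr].
have x00 : `|x0 - x0| < d by rewrite subrr normr0.
apply: le_lt_trans (hd y x0 ly lx0 yd x00) _.
have pw : `|y - x0| `^ th <= e / (K + 1).
  have -> : e / (K + 1) = r `^ th.
    by rewrite /r -powRrM mulVf ?gt_eqF // powRr1 // ltW.
  by apply: ge0_ler_powR; rewrite ?nnegrE ?(ltW th0) ?(ltW r0) // ltW.
apply: le_lt_trans (ler_wpM2l K0 pw) _.
by rewrite mulrCA gtr_pMr // ltr_pdivrMr // mul1r ltrDl.
Qed.

Lemma connection_hoelder : hoelder_connection pr L N nabla.
Proof.
move=> A a tA la.
have loc t0 : t0 \in `[0, 1] -> exists d K th : R, [/\ 0 < d, 0 <= K, 0 < th &
     forall y z, lift_of pr L A y -> lift_of pr L A z -> `|y - a t0| < d ->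
       `|z - a t0| < d -> `|nabla A y - nabla A z| <= K * `|y - z| `^ th].
  move=> t001; apply: connection_hoelder_local => //; first exact: (lifts_Hyp la).
  by case: la => _ <-; exists t0.
have inja s t : s \in `[0, 1] -> t \in `[0, 1] -> a s = a t -> s = t.
  by move=> s01 t01 e; apply: (lifts_inj la s01 t01); rewrite e.
have [K [th [th0 hK]]] := hoelder_compact (lifts_continuous la) inja loc.
have arcA t : t \in `[0, 1] -> A (pr (a t)) by case: la => _ <-; exists t.
exists K, th; split=> // t u t01 u01 st su.
by apply: hK => //; split=> //; exact: arcA.
Qed.

Lemma tie_transversal A : tie pr Q A -> transversal_in pr L N A.
Proof. by move=> tA; case: (setup_track H) => _ _ _ h _; case: (h A tA). Qed.

Lemma tie_cases A : tie pr Q A -> exists i s, s \in `[0, 1] /\ A = tie_at i s.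
Proof.
move=> [[i [s soo ->]]|[x xs ->]].
  by exists i, s; split; [exact: oo01|rewrite /tie_at soo].
have [i [s [s01 ns xi_]]] : exists i s, [/\ s \in `[0, 1], s \notin `]0, 1[ &
    rect_tie pr Q i s x].
  case: xs => i [] xt; [exists i, 0|exists i, 1]; split=> //.
  - exact: z01.
  - exact: zero_noo.
  - exact: one01.
  - exact: one_noo.
exists i, s; split=> //; have := tie_at_sub s01 xi_.
by rewrite /tie_at (negbTE ns) => /same_connected_component.
Qed.

Lemma coll_tie_const A u v : tie pr Q A -> A u -> A v -> coll u = coll v.
Proof.
move=> tA Au Av; have [AN _] := tie_transversal tA.
by apply/(coll_tie); [exact: AN|exact: AN|exists A].
Qed.

Lemma factor_tie_const A u v : tie pr Q A -> A u -> A v -> arc_factor A u = arc_factor A v.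
Proof.
move=> tA; have tr := tie_transversal tA; have [AN [a la]] := tr.
have fA := arc_factorP tr.
have arcA t : t \in `[0, 1] -> Hyp (a t) /\ A (pr (a t)).
  by move=> t01; split; [exact: (lifts_Hyp la)|case: la => _ <-; exists t].
have pA := arc_primitive_along fA (lifts_continuous la) arcA.
have cst := primitive_const ler01 (transition_refl (coll (pr (a 0)))) _ pA.
have [_ aE] := la; rewrite -{1 2}aE => -[s s01 <-] [t t01 <-].
apply: cst => // w w01; apply: (coll_tie_const tA).
  exact: (arcA w w01).2.
exact: (arcA 0 (@z01 R)).2.
Qed.

Lemma track_section_tie_slither A a t u g h : tie pr Q A -> lifts pr L a A ->
  t \in `[0, 1] -> u \in `[0, 1] -> L g -> L h -> geod g (a t) -> geod h (a u) ->
  ts (a u) = ts (a t) *m S h g.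
Proof.
move=> tA la t01 u01 Lg Lh gt hu.
have [i [s [s01 AE]]] := tie_cases tA; subst A.
have [soo|ns] := boolP (s \in `]0, 1[); last first.
  by have [_ ->] := track_section_tie s01 ns la t01 u01 Lg Lh gt hu.
have rep : exists2 B, Gamma B & forall w, w \in `[0, 1] ->
    exists2 w', w' \in `[0, 1] & a w = B *m Q i s w'.
  apply: (path_in_translate hGamma hX ler01).
  - apply/within_continuousP => w w01 O nO.
    have cQ := (within_continuousP _ _).1 (@Q_continuous i)
      (s, w) (conj s01 w01) _ nO.
    have /nbhs_ballP[d /= d0 hd] := cQ.
    apply/nbhs_ballP; exists d => // v wv v01.
    have hv : ball (s, w) d (s, v) by split=> //; exact: ballxx.
    exact: (hd _ hv (conj s01 v01)).
  - by move=> w; exact: (Q_Hyp).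
  - by move=> w w' w01 w'01; exact: (Q_inj_tie s01 w01 w'01).
  - exact: (lifts_continuous la).
  - by move=> w; exact: (lifts_Hyp la).
  - move=> w w01; have : tie_at i s (pr (a w)) by case: (la) => _ <-; exists w.
    by rewrite /tie_at soo => -[w' w'01 <-]; exists w'.
have [B gB hB] := rep.
have [t' t'01 et] := hB t t01; have [u' u'01 eu] := hB u u01.
rewrite et in gt *; rewrite eu in hu *.
have ss : `|s - s| < 2^-1 by rewrite subrr normr0; lra.
have [_] := strip_transition gB soo soo t'01 u'01 ss Lg Lh gt hu.
by rewrite (transition_refl) scale1r.
Qed.

Lemma connection_tie A : tie pr Q A ->
  slithering_section Gamma pr L rho xi S A (nabla A).
Proof.
move=> tA; have tr := tie_transversal tA; split.
- exact: (connection_section tr).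
- exact: (connection_neq0 tr).
move=> a la t u g h t01 u01 Lg Lh gt hu.
have arcA w : w \in `[0, 1] -> A (pr (a w)) by case: (la) => _ <-; exists w.
rewrite /slithering_connection (factor_tie_const tA (arcA u u01) (arcA t t01)).
by rewrite (track_section_tie_slither tA la t01 u01 Lg Lh gt hu) scalemxAl.
Qed.

Lemma connection_flat : flat_connection Gamma pr L rho xi N nabla.
Proof.
split.
- move=> A tA; split; [exact: (connection_section tA)
    |exact: (connection_neq0 tA)|exact: connection_continuous].
- by move=> A B tA tB; exact: (connection_restrict tA tB).
- by move=> K; exact: (connection_isotopy).
Qed.

Implicit Types (d u : R) (w : tau).

(** * Lifting loops of the train track *)

(** The coordinate [s] of [w] is near an occurrence [e] of [p0] on the edge [i]. Both ends of one
    edge may be [p0], so [e] is part of the chart. *)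
Definition star_chart p0 d w i s e :=
  [/\ s \in `[0, 1], e \in `[0, 1], q i e = p0, `|s - e| < d & w = q i s].

Definition star p0 d : set tau := [set w | exists i s e, star_chart p0 d w i s e].

(** The star reaches no end of an edge other than [p0] itself, and the charts around two occurrences
    of [p0] on one edge do not overlap. *)
Definition small_star p0 d :=
  (forall i s e, s \in `[0, 1] -> e \in `[0, 1] -> q i e = p0 -> `|s - e| < d ->
     s \notin `]0, 1[ -> s = e) /\
  (forall i e e', e \in `[0, 1] -> e' \in `[0, 1] -> q i e = p0 -> q i e' = p0 ->
     `|e - e'| < d + d -> e = e').

Lemma small_star_exists p0 : exists2 d : R, 0 < d & small_star p0 d.
Proof.
have [[i0 [s0 [-> s0oo]]]|no] := pselect (exists i0 s0, p0 = q i0 s0 /\ s0 \in `]0, 1[).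
  have [d d0 hd] := itv_dist s0oo; exists d => //; split=> [i s e s01 e01|i e e' e01 e'01].
    move=> /esym/(edge_inj s0oo e01)[_ <-] sd soo.
    by have := hd s soo; rewrite leNgt sd.
  by move=> /esym/(edge_inj s0oo e01)[_ <-] /esym/(edge_inj s0oo e'01)[_ <-].
have ends i e : e \in `[0, 1] -> q i e = p0 -> e = 0 \/ e = 1.
  move=> e01 qe; apply: end01 => //; apply/negP => eoo.
  by apply: no; exists i, e.
have q0 : (0 : R) < 4^-1 by [].
exists 4^-1 => //; split=> [i s e s01 e01 qe se soo|i e e' e01 e'01 qe qe'].
  have h1 := end01 s01 soo; have h2 := ends i e e01 qe.
  move: se; rewrite ltr_norml => /andP[l1 l2].
  by case: h1 l1 l2 => ->; case: h2 => -> // l1 l2; exfalso; lra.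
have h1 := ends i e e01 qe; have h2 := ends i e' e'01 qe'.
rewrite ltr_norml => /andP[l1 l2].
by case: h1 l1 l2 => ->; case: h2 => -> // l1 l2; exfalso; lra.
Qed.

Lemma star_open p0 d d' : small_star p0 d -> 0 < d' -> d' <= d -> open (star p0 d').
Proof.
move=> [sm _] d'0 d'd; apply: (open_track) => j s' s'01 [i [s [e [s01 e01 qe se qs]]]].
have [s'oo|s'oo] := boolP (s' \in `]0, 1[).
  have [ij ss] := edge_inj s'oo s01 qs; subst j s'.
  exists (d' - `|s - e|); first by rewrite subr_gt0.
  move=> s'' s''01 l; exists i, s'', e; split=> //.
  by have := ler_distD s s'' e; lra.
have soo : s \notin `]0, 1[.
  apply/negP => soo; have [_ ss] := edge_inj soo s'01 (esym qs).
  by move: s'oo; rewrite -ss soo.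
have es := sm i s e s01 e01 qe (lt_le_trans se d'd) soo; subst s.
exists d' => // s'' s''01 l; exists j, s'', s'; split=> //; by rewrite qs.
Qed.

Lemma star_center p0 d : 0 < d -> star p0 d p0.
Proof.
move=> d0; have [i [s [s01 ->]]] := edge_surj p0.
by exists i, s, s; split=> //; rewrite subrr normr0.
Qed.

(** Contraction of the star along its radii: the identity at [u = 0], the centre at [u = 1].
    [radialE] shows that the chart does not matter. *)
Definition radial p0 d u w : tau :=
  xget p0 [set p | exists i s e, star_chart p0 d w i s e /\ p = q i (s + u * (e - s))].

Lemma radialE p0 d u w i s e : small_star p0 d -> star_chart p0 d w i s e ->
  radial p0 d u w = q i (s + u * (e - s)).
Proof.
move=> [sm1 sm2] c; rewrite /radial; case: xgetP => [p _ |h]; last first.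
  by exfalso; apply: (h (q i (s + u * (e - s)))); exists i, s, e.
have center j t f : star_chart p0 d w j t f -> t \notin `]0, 1[ -> t = f.
  by move=> [t01 f01 qf tf _] too; exact: (sm1 j).
move=> [j [t [f [c' ->]]]]; have [s01 e01 qe se ws] := c; have [t01 f01 qf tf wt] := c'.
have [soo|soo] := boolP (s \in `]0, 1[).
  rewrite ws in wt; have [ij st] := edge_inj soo t01 wt; subst j t.
  have -> : e = f; last by [].
  apply: (sm2 i) => //; have := ler_distD s e f; rewrite (distrC e s); lra.
have too : t \notin `]0, 1[.
  apply/negP => too; rewrite ws in wt.
  have [_ ts] := edge_inj too s01 (esym wt).
  by move: soo; rewrite -ts too.
by rewrite -(center _ _ _ c soo) -(center _ _ _ c' too) !subrr !mulr0 !addr0 -wt -ws.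
Qed.

Lemma near_chart p0 (O : set tau) : open O -> O p0 ->
  (forall i e, e \in `[0, 1] -> q i e = p0 -> e = 0 \/ e = 1) ->
  exists2 d : R, 0 < d & forall i s e, s \in `[0, 1] -> e \in `[0, 1] -> q i e = p0 ->
    `|s - e| < d -> O (q i s).
Proof.
move=> oO Op ends.
have loc i e : e \in `[0, 1] -> exists2 d : R, 0 < d & forall s, s \in `[0, 1] ->
    q i e = p0 -> `|s - e| < d -> O (q i s).
  move=> e01; have [qe|ne] := pselect (q i e = p0); last by exists 1.
  have nO : nbhs (q i e) O by rewrite qe; exact: open_nbhs_nbhs.
  have /nbhs_ballP[d /= d0 hd] := (within_continuousP _ _).1
    (@edge_continuous i) e e01 O nO.
  exists d => // s s01 _ l; apply: hd => //; by rewrite /ball /= distrC.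
have loc2 i : exists2 d : R, 0 < d & forall s e, s \in `[0, 1] -> e \in `[0, 1] ->
    q i e = p0 -> `|s - e| < d -> O (q i s).
  have [d0 d00 h0] := loc i 0 (@z01 R); have [d1 d10 h1] := loc i 1 (@one01 R).
  exists (Num.min d0 d1); first by rewrite lt_min d00 d10.
  move=> s e s01 e01 qe; rewrite lt_min => /andP[l0 l1].
  by have es := ends i e e01 qe; case: es qe l0 l1 => -> qe l0 l1; [apply: h0|apply: h1].
have [f hf] := choice (fun i => (exists2P _ _).1 (loc2 i)).
exists (\big[Num.min/1]_i f i).
  by apply/bigmin_gtP; split=> // i _; case: (hf i).
move=> i s e s01 e01 qe /bigmin_gtP[_ l]; have [_ h] := hf i.
by apply: (h s e) => //; exact: l.
Qed.

(** Over a point interior to an edge, the edge coordinate reduces this to a formula on the segment.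
    Otherwise the point is the centre, and continuity holds uniformly in [u] because the contraction
    does not increase the distance to the centre. *)
Lemma radial_continuous p0 d : 0 < d -> small_star p0 d ->
  {within [set z : R * tau | z.1 \in `[0, 1] /\ star p0 d z.2],
    continuous (fun z : R * tau => radial p0 d z.1 z.2)}.
Proof.
move=> d0 sm; apply/within_continuousP => -[u0 w0] /= [u01 [i [s [e c]]]] O' nO'.
have [ O [ oO Ow ] OO' ] : exists2 O, open O /\ O (radial p0 d u0 w0) & O `<=` O'.
  by move: nO'; rewrite nbhsE => -[ O [ oO Ow ] OO' ]; exists O.
have [s01 e01 qe se ws] := c; rewrite (radialE u0 sm c) in Ow.
have [soo|soo] := boolP (s \in `]0, 1[).
  have [r r0 hr] := oo_nbhs soo.
  have nO : nbhs (q i (s + u0 * (e - s))) O by exact: open_nbhs_nbhs.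
  have /nbhs_ballP[r1 /= r10 hr1] := (within_continuousP _ _).1
    (@edge_continuous i) _ (segment01 s01 e01 u01) O nO.
  pose r2 := Num.min (Num.min r (d - `|s - e|)) (r1 / 3).
  have r20 : 0 < r2 by rewrite !lt_min r0 subr_gt0 se divr_gt0.
  have r2r : r2 <= r by rewrite !ge_min lexx.
  have r2d : r2 <= d - `|s - e| by rewrite !ge_min lexx orbT.
  have r2r1 : 3 * r2 <= r1 by rewrite mulrC -ler_pdivlMr // ge_min lexx orbT.
  have oW : open [set p | exists2 s', `|s' - s| < r2 & p = q i s'].
    by apply: (@edge_nbhd_open i s r2 soo) => s' l; apply: hr; exact: le_trans l r2r.
  have nW : nbhs w0 [set p | exists2 s', `|s' - s| < r2 & p = q i s'].
    apply: open_nbhs_nbhs; split=> //; exists s => //; by rewrite subrr normr0.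
  exists (ball u0 r2, [set p | exists2 s', `|s' - s| < r2 & p = q i s']).
    by split=> //=; exact: nbhsx_ballx.
  move=> [u w] /= [ul [s' s's ->]] [u01' _]; apply: OO'.
  have s'01 : s' \in `[0, 1] by apply: oo01; apply: hr; exact: le_trans (ltW s's) r2r.
  have c' : star_chart p0 d (q i s') i s' e.
    by split=> //; have := ler_distD s s' e; lra.
  rewrite (radialE u sm c'); apply: hr1; last exact: segment01.
  rewrite /ball /= in ul *.
  have -> : s + u0 * (e - s) - (s' + u * (e - s')) =
    (1 - u) * (s - s') + (u0 - u) * (e - s) by ring.
  apply: le_lt_trans (ler_normD _ _) _; rewrite !normrM.
  move: (u01'); rewrite in_itv /= => /andP[v0 v1].
  have b1 : `|1 - u| <= 1 by rewrite ger0_norm; lra.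
  have b2 : `|e - s| <= 1.
    by move: s01 e01; rewrite !in_itv /= ler_norml => /andP[? ?] /andP[? ?]; apply/andP; split; lra.
  have l1 := ler_pM (normr_ge0 _) (normr_ge0 _) b1 (lexx `|s - s'|).
  have l2 := ler_pM (normr_ge0 _) (normr_ge0 _) (lexx `|u0 - u|) b2.
  by rewrite (distrC s s') in l1 *; lra.
have es := sm.1 i s e s01 e01 qe se soo; subst s.
rewrite subrr mulr0 addr0 qe in Ow.
have ends j f : f \in `[0, 1] -> q j f = p0 -> f = 0 \/ f = 1.
  move=> f01 qf; apply: end01 => //; apply/negP => foo.
  have [_ fe] : j = i /\ f = e by apply: (edge_inj foo e01); rewrite qf.
  by move: soo; rewrite -fe foo.
have [r r0 hr] := near_chart oO Ow ends.
pose r2 := Num.min r d.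
have r20 : 0 < r2 by rewrite lt_min r0 d0.
have r2d : r2 <= d by rewrite ge_min lexx orbT.
exists (setT, star p0 r2).
  split; first exact: filterT.
  apply: open_nbhs_nbhs; split; first exact: star_open sm r20 r2d.
  by rewrite /= ws qe; exact: star_center.
move=> [u w] /= [_ [j [t [f [t01 f01 qf tf wt]]]]] [u01' _]; apply: OO'.
have c' : star_chart p0 d w j t f by split=> //; exact: lt_le_trans tf r2d.
rewrite (radialE u sm c'); apply: (hr j _ f) => //; first exact: segment01.
have -> : t + u * (f - t) - f = (1 - u) * (t - f) by ring.
rewrite normrM; move: (u01'); rewrite in_itv /= => /andP[v0 v1].
have b1 : `|1 - u| <= 1 by rewrite ger0_norm; lra.
have := ler_pM (normr_ge0 _) (normr_ge0 _) b1 (lexx `|t - f|); rewrite mul1r => l.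
by apply: le_lt_trans l _; move: tf; rewrite lt_min => /andP[].
Qed.

Implicit Types (D : 'M[R]_3).
Implicit Types (c : R -> V) (F : R -> tau).

Definition leaf_or_tie c (a b : R) :=
  (exists g, L g /\ forall t, t \in `[a, b] -> geod g (c t)) \/
  (exists A a', [/\ tie pr Q A, lifts pr L a' A &
     forall t, t \in `[a, b] -> exists2 w, w \in `[0, 1] & c t = a' w]).

Definition chain c (m : nat) (u : nat -> R) :=
  [/\ u 0%N = 0, u m = 1, (forall k : nat, (k < m)%N -> u k <= u k.+1),
      (forall k : nat, (k <= m)%N -> lift_supp L (c (u k))) &
      forall k : nat, (k < m)%N -> leaf_or_tie c (u k) (u k.+1)].

(** Lifting is asked only up to homotopy with fixed ends: a path may change branch at a switch
    infinitely often, and no finite chain projects onto it exactly. *)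
Definition leaf_tie_lift x F y := exists c (m : nat) (u : nat -> R),
  [/\ {within `[0, 1], continuous c}, c 0 = x, c 1 = y, chain c m u &
      path_homotopic F (fun t => coll (pr (c t)))].

Lemma lift_homotopic x F F' y : path_homotopic F' F ->
  leaf_tie_lift x F y -> leaf_tie_lift x F' y.
Proof.
move=> FF [c [m [u [? ? ? ? h]]]]; exists c, m, u; split=> //.
exact: path_homotopic_trans FF h.
Qed.

Lemma lift_ext x F F' y : (forall t, t \in `[0, 1] -> F' t = F t) ->
  leaf_tie_lift x F y -> leaf_tie_lift x F' y.
Proof.
move=> FF [c [m [u [? ? ? ? h]]]]; exists c, m, u; split=> //.
exact: path_homotopic_extl FF h.
Qed.

Lemma leaf_or_tie_sub c c' (a b a' b' : R) (f : R -> R) :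
  (forall t, t \in `[a', b'] -> f t \in `[a, b] /\ c' t = c (f t)) ->
  leaf_or_tie c a b -> leaf_or_tie c' a' b'.
Proof.
move=> hf [[g [Lg h]]|[A [r [tA lr h]]]]; [left|right].
  by exists g; split=> // t /hf[/h ? ->].
by exists A, r; split=> // t /hf[/h ? ->].
Qed.

Lemma monotone_subdivision (m : nat) (u : nat -> R) : u 0%N = 0 -> u m = 1 ->
  (forall k : nat, (k < m)%N -> u k <= u k.+1) -> forall k : nat, (k <= m)%N -> u k \in `[0, 1].
Proof.
move=> u0 u1 um k km; rewrite in_itv /=; apply/andP; split.
  elim: k km => [|k IH] km; first by rewrite u0.
  exact: le_trans (IH (ltnW km)) (um k km).
have up (d : nat) : (k + d <= m)%N -> u k <= u (k + d)%N.
  elim: d => [|d IH]; first by rewrite addn0.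
  rewrite addnS => kd; exact: le_trans (IH (ltnW kd)) (um _ kd).
by have := up (m - k)%N; rewrite subnKC // u1; apply.
Qed.

Lemma chain_cat c c' (m m' : nat) (u u' : nat -> R) : c 1 = c' 0 ->
  chain c m u -> chain c' m' u' -> exists w : nat -> R, chain (loop_cat c c') (m + m') w.
Proof.
move=> cc [u0 u1 um us up] [v0 v1 vm vs vp].
have u01 := monotone_subdivision u0 u1 um; have v01 := monotone_subdivision v0 v1 vm.
have [w [wl wr]] : exists w : nat -> R, (forall k : nat, (k <= m)%N -> w k = u k / 2) /\
    forall k : nat, w (m + k)%N = (u' k + 1) / 2.
  (* The junction index [m] fits both formulas, each giving one half there. *)
  exists (fun k : nat => if (k <= m)%N then u k / 2 else (u' (k - m)%N + 1) / 2).
  split=> [k ->//|[|k]]; first by rewrite addn0 leqnn u1 v0 add0r.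
  by rewrite leqNgt -addSnnS leq_addr /= addSnnS addKn.
have catL t : t <= 2^-1 -> loop_cat c c' t = c (2 * t) by rewrite /loop_cat => ->.
have catR t : 2^-1 <= t -> loop_cat c c' t = c' (2 * t - 1).
  rewrite /loop_cat => t2; case: ifP => // t2'.
  have -> : t = 2^-1 by apply/eqP; rewrite eq_le t2'.
  by rewrite divff // subrr cc.
exists w; split.
- by rewrite wl // u0 mul0r.
- by rewrite wr v1; lra.
- move=> k; case: (ltnP k m) => km kmm.
    by rewrite (wl k (ltnW km)) (wl k.+1 km) ler_pM2r ?invr_gt0 //; exact: um.
  have [l kl] : exists l : nat, k = (m + l)%N.
    by exists (k - m)%N; exact: esym (subnKC km).
  subst k.
  move: kmm; rewrite ltn_add2l => lm.
  by rewrite -addnS !wr ler_pM2r ?invr_gt0 // lerD2r; exact: vm.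
- move=> k; case: (leqP k m) => km kmm.
    rewrite wl // catL; last by have := u01 k km; rewrite in_itv /= => /andP[]; lra.
    by rewrite mulrCA divff // mulr1; exact: us.
  have [l kl] : exists l : nat, k = (m + l)%N.
    by exists (k - m)%N; exact: esym (subnKC (ltnW km)).
  subst k.
  move: kmm; rewrite wr leq_add2l => lm.
  rewrite catR; last by have := v01 l lm; rewrite in_itv /= => /andP[]; lra.
  by rewrite mulrCA divff // mulr1 addrK; exact: vs.
- move=> k; case: (ltnP k m) => km kmm.
    apply: (leaf_or_tie_sub (f := fun t => 2 * t)) (up k km) => t.
    rewrite (wl k (ltnW km)) (wl k.+1 km) !in_itv /= => /andP[t0 t1].
    split; first by apply/andP; split; lra.
    by apply: catL; have := u01 k.+1 km; rewrite in_itv /= => /andP[]; lra.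
  have [l kl] : exists l : nat, k = (m + l)%N.
    by exists (k - m)%N; exact: esym (subnKC km).
  subst k.
  move: kmm; rewrite ltn_add2l => lm; rewrite -addnS.
  apply: (leaf_or_tie_sub (f := fun t => 2 * t - 1)) (vp l lm) => t.
  rewrite !wr !in_itv /= => /andP[t0 t1].
  split; first by apply/andP; split; lra.
  by apply: catR; have := v01 l (ltnW lm); rewrite in_itv /= => /andP[]; lra.
Qed.

Lemma lift_cat x y z F F' : leaf_tie_lift x F y -> leaf_tie_lift y F' z ->
  leaf_tie_lift x (loop_cat F F') z.
Proof.
move=> [c [m [u [cc c0 c1 hc hF]]]] [c' [m' [u' [cc' c'0 c'1 hc' hF']]]].
have cE : c 1 = c' 0 by rewrite c1 c'0.
have [w hw] := chain_cat cE hc hc'.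
exists (loop_cat c c'), (m + m')%N, w; split=> //.
- exact: loop_cat_continuous.
- by rewrite /loop_cat ifT ?mulr0 //; lra.
- rewrite /loop_cat ifF; last by apply/negbTE; rewrite -ltNge; lra.
  by rewrite (_ : 2 * 1 - 1 = 1) //; lra.
have -> : (fun t => coll (pr (loop_cat c c' t))) =
    loop_cat (fun t => coll (pr (c t))) (fun t => coll (pr (c' t))).
  by apply/funext => t; rewrite /loop_cat; case: ifP.
apply: path_homotopic_cat => //.
have [_ ->] := path_homotopic_ends hF; have [-> _] := path_homotopic_ends hF'.
by rewrite cE.
Qed.

Lemma leaf_or_tie_nbhd c (a b : R) : leaf_or_tie c a b ->
  forall t, t \in `[a, b] -> Hyp (c t) /\ N (pr (c t)).
Proof.
move=> [[g [Lg h]]|[A [r [tA lr h]]]] t tab.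
  have gc := h t tab; split; first exact: (geod_Hyp gc).
  by apply: (lift_supp_nbhd); exists g.
have [w w01 ->] := h t tab; split; first exact: (lifts_Hyp lr).
have [AN _] := tie_transversal tA; apply: AN.
by case: lr => _ <-; exists w.
Qed.

Lemma lift_one F c : {within `[0, 1], continuous c} -> leaf_or_tie c 0 1 ->
  lift_supp L (c 0) -> lift_supp L (c 1) ->
  (forall t, t \in `[0, 1] -> F t = coll (pr (c t))) -> leaf_tie_lift (c 0) F (c 1).
Proof.
move=> cc lt s0 s1 hF; exists c, 1%N, (fun k : nat => (k%:R : R)); split=> //.
  split=> //; first by move=> [|[]] // _; exact: ler01.
    by move=> [|[]].
  by move=> [|[]].
apply: path_homotopic_eq hF; apply: (coll_path_continuous cc).
exact: leaf_or_tie_nbhd lt.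
Qed.

Lemma lift_const x : lift_supp L x -> leaf_tie_lift x (fun=> coll (pr x)) x.
Proof.
move=> sx; have [g Lg gx] := sx.
apply: (@lift_one _ (fun=> x)) => //; first by apply: continuous_subspaceT; exact: cst_continuous.
by left; exists g.
Qed.

Lemma lift_slide x z : lift_supp L x -> lift_supp L z ->
  coll (pr x) = coll (pr z) ->
  exists2 B, Gamma B & leaf_tie_lift x (fun=> coll (pr x)) (B *m z).
Proof.
move=> sx sz e; have Hx := ((lift_suppP x).1 sx).1; have Hz := ((lift_suppP z).1 sz).1.
have [A [tA Ax Az]] := (coll_tie (lift_supp_nbhd sx) (lift_supp_nbhd sz)).1 e.
have [_ [a la]] := tie_transversal tA; have [_ aE] := la.
have [w w01 aw] : arc_of pr a (pr x) by rewrite aE.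
have [w' w'01 aw'] : arc_of pr a (pr z) by rewrite aE.
have [C gC xE] := (pr_eq hX (lifts_Hyp la w01) Hx).1 aw.
have [D gD aD] := (pr_eq hX Hz (lifts_Hyp la w'01)).1 (esym aw').
exists (C *m D); first exact: GammaM.
pose c t := C *m a (w + t * (w' - w)).
have sg t : t \in `[0, 1] -> w + t * (w' - w) \in `[0, 1] by exact: segment01.
have c0 : c 0 = x by rewrite /c mul0r addr0 xE.
have c1 : c 1 = C *m D *m z by rewrite /c mul1r subrKC aD mulmxA.
have szz : lift_supp L (C *m D *m z).
  by apply: (lift_supp_act) => //; exact: GammaM.
have arcA t : t \in `[0, 1] -> A (pr (a t)) by rewrite -aE; exists t.
rewrite -c1 -{1}c0; apply: lift_one; rewrite ?c0 ?c1 //.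
- apply: (within_comp (E := setT) (u := fun t => a (w + t * (w' - w)))) => //.
    by apply: continuous_subspaceT; exact: continuous_mulmx.
  apply: (within_comp (lifts_continuous la)) => //.
  apply: continuous_subspaceT => t; apply: cvgD; first exact: cvg_cst.
  by apply: cvgM; [exact: cvg_id|exact: cvg_cst].
- right; exists A, (fun t => C *m a t); split=> //; first exact: (lifts_act gC la).
  by move=> t /sg t01; exists (w + t * (w' - w)).
move=> t /sg t01; rewrite /c (pr_Gamma hGamma hX gC (lifts_Hyp la t01)).
exact: (coll_tie_const tA Ax (arcA _ t01)).
Qed.

Lemma lift_segment x i (s s' : R) : lift_supp L x -> s \in `[0, 1] -> s' \in `[0, 1] ->
  coll (pr x) = q i s -> exists y, [/\ lift_supp L y, coll (pr y) = q i s' &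
    leaf_tie_lift x (fun t => q i (s + t * (s' - s))) y].
Proof.
move=> sx s01 s'01 xs.
have [B [t [g [gB t01 Lg gt]]]] := strip_leaf i.
pose g0 := geod_act (invmx B) g; have gB' := GammaV hGamma gB.
have Lg0 : L g0 by exact: (leaf_act).
have gt0 : geod g0 (Q i 2^-1 t).
  have : geod g0 (invmx B *m (B *m Q i 2^-1 t)).
    exact: ((geod_actE _ gB' (leaf_ideal Lg)).2 gt).
  by rewrite mulmxA mulVmx ?mul1mx //; exact: (Gamma_unit hGamma gB).
have cr : crosses i g0 2^-1 by exists t.
have tr := traverse Lg0 (@half_oo R) cr.
have /choice[f hf] (r : R) : exists r' : R, r \in `[0, 1] ->
    r' \in `[0, 1] /\ geod g0 (Q i r r').
  have [r01|r01] := pselect (r \in `[0, 1] : bool); last by exists 0.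
  by have [r' r'01 gr] := tr r r01; exists r'.
have sz r : r \in `[0, 1] -> lift_supp L (Q i r (f r)).
  by move=> r01; exists g0 => //; case: (hf r r01).
have qE r : r \in `[0, 1] -> coll (pr (Q i r (f r))) = q i r.
  by move=> r01; apply: (coll_rect) => //; case: (hf r r01).
have exz : coll (pr x) = coll (pr (Q i s (f s))) by rewrite qE.
have [D gD lD] := lift_slide sx (sz s s01) exz.
have LD : L (geod_act D g0) by exact: (leaf_act).
have qD r : r \in `[0, 1] -> coll (pr (D *m Q i r (f r))) = q i r.
  by move=> r01; apply: (coll_act) => //; case: (hf r r01).
have gE r : r \in `[0, 1] -> geod (geod_act D g0) (D *m Q i r (f r)).
  move=> r01; apply: ((geod_actE _ gD (leaf_ideal Lg0)).2).
  by case: (hf r r01).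
have sg r : r \in `[0, 1] -> s + r * (s' - s) \in `[0, 1] by exact: segment01.
exists (D *m Q i s' (f s')); split.
- by apply: (lift_supp_act gD); exact: sz.
- exact: qD.
pose c (r : R) := D *m Q i (s + r * (s' - s)) (f (s + r * (s' - s))).
have c0 : c 0 = D *m Q i s (f s) by rewrite /c mul0r addr0.
have c1 : c 1 = D *m Q i s' (f s') by rewrite /c mul1r subrKC.
have seg : leaf_tie_lift (c 0) (fun r : R => q i (s + r * (s' - s))) (c 1).
  apply: lift_one.
  - apply: (within_comp (E := setT)
      (f := mulmx D) (u := fun r : R => Q i (s + r * (s' - s)) (f (s + r * (s' - s))))) => //.
      by apply: continuous_subspaceT; exact: continuous_mulmx.
    apply: (within_comp (u := fun r : R => s + r * (s' - s))
      (crossing_continuous Lg0 hf)) => //.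
    apply: continuous_subspaceT => r; apply: cvgD; first exact: cvg_cst.
    by apply: cvgM; [exact: cvg_id|exact: cvg_cst].
  - by left; exists (geod_act D g0); split=> // r /sg/gE.
  - by rewrite c0; exists (geod_act D g0) => //; exact: gE.
  - by rewrite c1; exists (geod_act D g0) => //; exact: gE.
  - by move=> r /sg r01; rewrite /c qD.
rewrite c0 c1 in seg.
have both := lift_cat lD seg.
apply: lift_homotopic both.
(* The slide is stationary in the track, so it is absorbed as a constant first half of the
   segment. *)
have -> : (fun=> coll (pr x)) = (fun r : R => q i (s + (r * 0) * (s' - s))).
  by apply/funext => r; rewrite mulr0 mul0r addr0.
apply: (path_homotopic_split (F := fun r : R => q i (s + r * (s' - s)))
   (a := fun r : R => r * 0) (b := id)).
- apply: (within_comp (u := fun r : R => s + r * (s' - s)) (@edge_continuous i)) => //.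
  apply: continuous_subspaceT => r; apply: cvgD; first exact: cvg_cst.
  by apply: cvgM; [exact: cvg_id|exact: cvg_cst].
- apply: continuous_subspaceT => r; apply: cvgM; [exact: cvg_id|exact: cvg_cst].
- by apply: continuous_subspaceT => r; exact: cvg_id.
- by move=> r _; rewrite mulr0; exact: z01.
- by [].
- by rewrite mulr0.
- by rewrite mulr0.
- by [].
Qed.

Local Notation lift := leaf_tie_lift.

(* A path in a star is pushed radially: to the centre along the radius of its
   origin, then out along the radius of its end. *)
Lemma lift_star p0 d F x : 0 < d -> small_star p0 d ->
  {within `[0, 1], continuous F} ->
  (forall t, t \in `[0, 1] -> star p0 d (F t)) ->
  lift_supp L x -> coll (pr x) = F 0 ->
  exists y, [/\ lift_supp L y, coll (pr y) = F 1 & lift x F y].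
Proof.
move=> d0 sm cF FW sx xF.
have [i [s [e cs]]] := FW 0 (@z01 R); have [j [s' [e' cs']]] := FW 1 (@one01 R).
have [s01 e01 qe se Fs] := cs; have [s'01 e'01 qe' se' Fs'] := cs'.
rewrite Fs in xF.
have [y [sy ye ly]] := lift_segment sx s01 e01 xF.
have ye' : coll (pr y) = q j e' by rewrite ye qe qe'.
have [z [sz ze lz]] := lift_segment sy e'01 s'01 ye'.
exists z; split=> //; first by rewrite ze Fs'.
have ly0 := lift_const sy.
(* The two constant pieces at [y] make four quarters: inwards, two quarters at the centre, outwards.
   This is the shape of [J]. *)
have full := lift_cat (lift_cat ly ly0) (lift_cat ly0 lz).
pose J t := radial p0 d (tent 1 t) (F (slow t)).
have slow01 t : slow t \in `[0, 1] by have [] := slowE t.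
have center u t : u = 1 -> radial p0 d u (F (slow t)) = p0.
  move=> ->; have [k [r [f cr]]] := FW _ (slow01 t).
  by rewrite (radialE 1 sm cr) mul1r subrKC; case: cr.
have start (r : R) : radial p0 d 0 (F (slow r)) = F (slow r).
  have [k [r' [f cr]]] := FW _ (slow01 r).
  by rewrite (radialE 0 sm cr) mul0r addr0; case: cr.
have yp : coll (pr y) = p0 by rewrite ye.
have slow0 : slow (0 : R) = 0 by have [h _ _] := slowE (0 : R); apply: h; rewrite invr_ge0.
have slow1 : slow (1 : R) = 1 by have [_ h _] := slowE (1 : R); apply: h; lra.
have lJ : lift x J z.
  apply: lift_ext full => t t01; have /andP[t0 t1] : 0 <= t <= 1 by move: t01; rewrite in_itv.
  have [tn1 tn2 tn3] := tent1 t; have [sl1 sl2 _] := slowE t.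
  rewrite /J /loop_cat; case: ifPn => h1; case: ifPn => h2.
  - have t4 : t <= 4^-1 by lra.
    by rewrite tn1 // sl1 // (radialE _ sm cs) mulrA; congr (q i (s + _ * _)); lra.
  - by rewrite -ltNge in h2; rewrite center ?tn2 //; lra.
  - by rewrite -ltNge in h1; rewrite center ?tn2 //; lra.
  - rewrite -!ltNge in h1 h2; have t4 : 1 - 4^-1 <= t by lra.
    rewrite tn3 // sl2 // (radialE _ sm cs'); congr (q j _).
    by ring.
apply: lift_homotopic (lift_homotopic _ lJ).
  apply: (path_homotopic_reparam (a := id) (b := slow) cF) => //.
  - by apply: continuous_subspaceT => t; exact: cvg_id.
  - exact: continuous_subspaceT slow_continuous.
exists (fun u t => radial p0 d (tent u t) (F (slow t))); split.
- apply: (within_comp (u := fun w : R * R => (tent w.1 w.2, F (slow w.2)))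
    (radial_continuous d0 sm)).
    apply: within_pair.
      by apply: continuous_subspaceT; exact: tent_continuous.
    apply: (within_comp (u := fun w : R * R => slow w.2) cF); last by move=> w _; exact: slow01.
    by apply: continuous_subspaceT => w'; apply: (continuous_comp (@cvg_snd _ _ _ _ _)); exact: slow_continuous.
  by move=> [u t] [/= u01 t01]; split; [exact: tent01|exact: (FW _ (slow01 t))].
- by move=> u u01; have [-> ->] := tent_end u01; rewrite !start.
- by move=> t t01; rewrite tent0 // start.
- by [].
Qed.

Definition subpath F (a b : R) : R -> tau := fun t => F (a + t * (b - a)).

Lemma subpath01 (a b t : R) : a \in `[0, 1] -> b \in `[0, 1] -> t \in `[0, 1] ->
  a + t * (b - a) \in `[0, 1].
Proof. exact: segment01. Qed.

Lemma subpath_continuous F (a b : R) : {within `[0, 1], continuous F} ->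
  a \in `[0, 1] -> b \in `[0, 1] -> {within `[0, 1], continuous (subpath F a b)}.
Proof.
move=> cF a01 b01; apply: (within_comp (u := fun t : R => a + t * (b - a)) cF).
  exact: affine_within.
by move=> t; exact: subpath01.
Qed.

Lemma lift_path F x : {within `[0, 1], continuous F} -> lift_supp L x ->
  coll (pr x) = F 0 -> exists y, [/\ lift_supp L y, coll (pr y) = F 1 & lift x F y].
Proof.
move=> cF sx xF.
pose P (a b : R) := forall x, lift_supp L x -> coll (pr x) = F a ->
  exists y, [/\ lift_supp L y, coll (pr y) = F b & lift x (subpath F a b) y].
suff P01 : P 0 1.
  have [y [sy yF ly]] := P01 x sx xF; exists y; split=> //.
  by apply: lift_ext ly => t _; rewrite /subpath subr0 mulr1 add0r.
apply: cousin => // [t0 t001|a b d a0 ab bd d1 Pab Pbd].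
  have [d d0 sm] := small_star_exists (F t0).
  have nW : nbhs (F t0) (star (F t0) d).
    apply: open_nbhs_nbhs; split; first exact: (star_open sm d0 (lexx d)).
    exact: (star_center).
  have /nbhs_ballP[r /= r0 hr] := (within_continuousP _ _).1 cF t0 t001 _ nW.
  exists r => // a b a01 b01 ab ar br y sy ya.
  have [z [sz zF lz]] : exists z, [/\ lift_supp L z, coll (pr z) = subpath F a b 1 &
      lift y (subpath F a b) z].
    apply: (lift_star d0 sm) => //; first exact: subpath_continuous.
      move=> t t01; apply: hr; last exact: subpath01.
      rewrite /ball /= distrC.
      move: t01 ar br; rewrite in_itv /= => /andP[h0 h1]; rewrite !ltr_norml.
      by move=> /andP[? ?] /andP[? ?]; apply/andP; split; nra.
    by rewrite /subpath mul0r addr0.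
  by exists z; split=> //; rewrite zF /subpath mul1r subrKC.
move=> y sy ya; have [z [sz zb lz]] := Pab y sy ya; have [w [sw wd lw]] := Pbd z sz zb.
(* The degenerate interval is set apart because the reparametrization below divides by [d - a]. *)
have [ad|ad] := eqVneq a d.
  have ba : b = a by apply/eqP; rewrite eq_le ab ad bd.
  by subst d b; exists z.
exists w; split=> //.
have ad0 : 0 < d - a by rewrite subr_gt0 lt_neqAle ad (le_trans ab bd).
have a01 : a \in `[0, 1] by rewrite in_itv /= a0 (le_trans ab (le_trans bd d1)).
have d01 : d \in `[0, 1] by rewrite in_itv /= d1 (le_trans a0 (le_trans ab bd)).
apply: lift_homotopic (lift_cat lz lw).
have r0 : 0 <= (b - a) / (d - a).
  by apply: divr_ge0; [rewrite subr_ge0|exact: ltW].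
have r1 : (b - a) / (d - a) <= 1.
  by rewrite ler_pdivrMr // mul1r; apply: lerB.
set r := _ / _ in r0 r1.
have rE : r * (d - a) = b - a by rewrite /r divfK // gt_eqF.
have -> : subpath F a b = fun t => subpath F a d (0 + t * r).
  apply/funext => t; rewrite /subpath; congr (F _); rewrite add0r -mulrA rE //.
have -> : subpath F b d = fun t => subpath F a d (r + t * (1 - r)).
  apply/funext => t; rewrite /subpath; congr (F _).
  have bE : b = a + r * (d - a) by rewrite rE subrKC.
  by rewrite {1 2}bE; ring.
apply: (path_homotopic_split (F := subpath F a d)
  (a := fun t => 0 + t * r) (b := fun t => r + t * (1 - r))).
- exact: subpath_continuous.
- exact: affine_within.
- exact: affine_within.
- by move=> t; rewrite !in_itv /= => /andP[t0 t1]; apply/andP; split; nra.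
- by move=> t; rewrite !in_itv /= => /andP[t0 t1]; apply/andP; split; nra.
- by rewrite mul0r addr0.
- by rewrite mul1r mul0r addr0 add0r.
- by rewrite mul1r subrKC.
Qed.

(** The lift of a loop returns to the tie over its base point but not necessarily to a translate of
    its origin; a slide along this tie, stationary in the track, closes it up. *)
Lemma lift_loop b F : loop b F -> exists x B, [/\ Gamma B, lift_supp L x &
  lift x F (B *m x)].
Proof.
move=> [cF F0 F1]; have [i [s [s01 bs]]] := edge_surj b.
have [B [t [g [gB t01 Lg gt]]]] := strip_leaf i.
have [t' t'01 gt'] := traverse_act gB Lg (@half_oo R) t01 gt s01.
pose x := B *m Q i s t'; have sx : lift_supp L x by exists g.
have xb : coll (pr x) = b by rewrite (coll_act).
have [y [sy yb ly]] : exists y, [/\ lift_supp L y, coll (pr y) = F 1 & lift x F y].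
  by apply: lift_path; rewrite ?F0.
have yx : coll (pr y) = coll (pr x) by rewrite yb F1 xb.
have [C gC lC] := lift_slide sy sx yx.
exists x, C; split=> //; apply: lift_homotopic (lift_cat ly lC).
have -> : (fun=> coll (pr y)) = (fun t : R => F (1 + t * 0)).
  by apply/funext => r; rewrite mulr0 addr0.
apply: (path_homotopic_split (F := F) (a := id) (b := fun t => 1 + t * 0)) => //.
- by apply: continuous_subspaceT => r; exact: cvg_id.
- exact: affine_within.
- by move=> r _; rewrite mulr0 addr0; exact: one01.
- by rewrite mulr0 addr0.
- by rewrite mulr0 addr0.
Qed.

(** * Parallel transport along chains and the holonomy character *)

Lemma subdivision_sub (m : nat) (u : nat -> R) (k : nat) : u 0%N = 0 -> u m = 1 ->
  (forall k : nat, (k < m)%N -> u k <= u k.+1) -> (k < m)%N ->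
  {subset `[u k, u k.+1] <= `[0, 1]}.
Proof.
move=> u0 u1 um km; have u01 := monotone_subdivision u0 u1 um.
have := u01 k (ltnW km); have := u01 k.+1 km.
rewrite !in_itv /= => /andP[_ h1] /andP[h0 _] t; rewrite !in_itv /= => /andP[t0 t1].
by rewrite (le_trans h0 t0) (le_trans t1 h1).
Qed.

Lemma primitive_tie c A a (f : R -> R) (s t : R) : s <= t -> tie pr Q A ->
  lifts pr L a A ->
  (forall r, r \in `[s, t] -> exists2 w, w \in `[0, 1] & c r = a w) ->
  primitive_along trans (fun r => coll (pr (c r))) f s t ->
  f s = f t /\ (A (pr (c s)) /\ A (pr (c t))).
Proof.
move=> st tA [_ aE] hc hf.
have cA r : r \in `[s, t] -> A (pr (c r)).
  by move=> /hc[w w01 ->]; rewrite -aE; exists w.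
have ss : s \in `[s, t] by rewrite in_itv /= lexx.
have tt : t \in `[s, t] by rewrite in_itv /= lexx andbT.
split; last by split; exact: cA.
apply: (primitive_const st (transition_refl (coll (pr (c s)))) _ hf) => // r rst.
by apply: (coll_tie_const tA); apply: cA.
Qed.

(** The primitive times the track section is parallel on both kinds of segments: on leaves by
    [transport_along_leaf], and on ties because they collapse to points, so that the primitive and
    the arc factor are both constant. *)
Lemma chain_transport c (m : nat) (u : nat -> R) (f : R -> R) :
  {within `[0, 1], continuous c} -> chain c m u -> (forall t, f t != 0) ->
  primitive_along trans (fun t => coll (pr (c t))) f 0 1 ->
  leaf_tie_transport pr L Q xi nabla c m u (fun k : nat => f (u k) *: ts (c (u k))).
Proof.
move=> cc [u0 u1 um us up] f0 hf; split=> //.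
  by move=> g Lg gc; apply: Dline_scale; rewrite u0; exact: (track_section_Dline Lg gc).
move=> k km; have uk := um k km; have sub := subdivision_sub u0 u1 um km.
have kin : u k \in `[u k, u k.+1] by rewrite in_itv /= lexx.
have kin' : u k.+1 \in `[u k, u k.+1] by rewrite in_itv /= lexx andbT.
have hf' := primitive_sub sub hf.
case: (up k km) => [[g [Lg gc]]|[A [a [tA la ca]]]]; [left|right].
  exists g; split=> //; apply: (transport_along_leaf uk Lg _ gc hf') => //.
  by apply: continuous_subspaceW cc => t; exact: sub.
have [fk [Ak Ak']] := primitive_tie uk tA la ca hf'.
have [fn0 _] := arc_factorP (tie_transversal tA).
exists A, a, (f (u k) / arc_factor A (pr (c (u k)))); split=> //.
  by rewrite /slithering_connection scalerA divfK.
rewrite (factor_tie_const tA Ak Ak') /slithering_connection scalerA divfK //.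
by rewrite fk.
Qed.

(** Since the fiber is a line, the initial vector is a multiple [r] of the track section, and
    transport determines every later vector from it. This makes the holonomy independent of the
    chosen lift. *)
Lemma transport_primitive c (m : nat) (u : nat -> R) (v : nat -> 'rV[R]_3) (f : R -> R) :
  leaf_tie_transport pr L Q xi nabla c m u v -> (forall t, f t != 0) ->
  primitive_along trans (fun t => coll (pr (c t))) f 0 1 ->
  exists r : R, forall k : nat, (k <= m)%N -> v k = (r * f (u k)) *: ts (c (u k)).
Proof.
move=> [cc [u0 u1 um] us v0 hv] f0 hf.
have [g Lg gc] := us 0%N (leq0n m).
have [w [w0 Dw] hw] := DlineP Lg.
have [r1 e1] : exists r, v 0%N = r *: w.
  by apply: hw; apply: v0 => //; rewrite -u0.
have [r2 e2] := hw _ (track_section_Dline Lg gc).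
have r20 : r2 != 0.
  apply/eqP => r2z; have /eqP := track_section_neq0 (us 0%N (leq0n m)).
  by apply; rewrite e2 r2z scale0r.
exists (r1 / r2 / f (u 0%N)) => k; elim: k => [_|k IH km].
  by rewrite divfK // e1 e2 scalerA divfK.
have uk := um k km; have sub := subdivision_sub u0 u1 um km.
have kin : u k \in `[u k, u k.+1] by rewrite in_itv /= lexx.
have kin' : u k.+1 \in `[u k, u k.+1] by rewrite in_itv /= lexx andbT.
have hf' := primitive_sub sub hf; have vk := IH (ltnW km).
case: (hv k km) => [[g' [Lg' gc' ->]]|[A [a [r [tA la ca vA ->]]]]].
  have cc' : {within `[u k, u k.+1], continuous c}.
    by apply: continuous_subspaceW cc => t; exact: sub.
  have tl := transport_along_leaf uk Lg' cc' gc' hf' kin kin'.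
  by rewrite vk -!scalerA tl.
have [fk [Ak Ak']] := primitive_tie uk tA la ca hf'.
have [fn0 _] := arc_factorP (tie_transversal tA).
move: vA; rewrite vk /slithering_connection (factor_tie_const tA Ak Ak') !scalerA.
have tn0 := track_section_neq0 (us k (ltnW km)).
move=> /eqP; rewrite -subr_eq0 -scalerBl scaler_eq0 (negbTE tn0) orbF subr_eq0 => /eqP.
by rewrite fk => ->.
Qed.

Lemma chain_nbhd c (m : nat) (u : nat -> R) : chain c m u ->
  forall t, t \in `[0, 1] -> Hyp (c t) /\ N (pr (c t)).
Proof.
move=> [u0 u1 um us up] t; rewrite in_itv /= => /andP[t0 t1].
have [k km [ut tu]] : exists2 k : nat, (k < m)%N & u k <= t /\ t <= u k.+1.
  have [m0|m0] := posnP m; first by move: u1; rewrite m0 u0 => /eqP; rewrite eq_sym oner_eq0.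
  have ex : exists k : nat, (k < m)%N && (t <= u k.+1).
    by exists m.-1; rewrite prednK // leqnn u1.
  case: (ex_minnP ex) => k /andP[km tu] kmin; exists k => //; split=> //.
  case: k km tu kmin => [|k] km tu kmin; first by rewrite u0.
  rewrite leNgt; apply/negP => tk.
  by have := kmin k; rewrite (ltnW km) (ltW tk) ltnn => /(_ isT).
by apply: (leaf_or_tie_nbhd (up k km)); rewrite in_itv /= ut.
Qed.

Lemma connection_holonomy b :
  records_holonomy Gamma pr L Q rho xi nabla coll b (character_of trans b).
Proof.
have tz := transition_neq0.
have tr := transition_refl; have tc := transition_cocycle.
move=> F lF; have [cF F0 F1] := lF; split.
  have [x [B [gB sx [c [m [u [cc c0 c1 hc hF]]]]]]] := lift_loop lF.
  have [FE0 FE1] := path_homotopic_ends hF.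
  have cn : {within `[0, 1], continuous (fun t => coll (pr (c t)))}.
    apply: (coll_path_continuous cc) => t t01; exact: (chain_nbhd hc t01).
  have [f f0 hf] := primitive_exists tz tc cn.
  exists c, B, m, u, (fun k : nat => f (u k) *: ts (c (u k))); split.
  - exact: chain_transport.
  - have [u0 _ _ us _] := hc; rewrite scaler_eq0 negb_or f0 /=.
    exact: (track_section_neq0 (us 0%N (leq0n m))).
  split=> //; first by rewrite c0 c1.
    by split=> //; rewrite -?FE0 -?FE1.
  have [K [cK eK K0 K1]] := hF; exists K; split=> // t t01.
  by have := eK t t01; rewrite F0 F1.
move=> c B m u v hv v0 [gB cB [cn cn0 cn1] Fc].
have [f f0 hf] := primitive_exists tz tc cn.
have [r hr] := transport_primitive hv f0 hf.
have [_ [u0 u1 _] us _ _] := hv.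
have s0 := us 0%N (leq0n m); rewrite u0 in s0.
rewrite (character_ofE tz tr tc lF) (holonomy_homotopic tz tr tc Fc) (holonomyE tz f0 hf).
rewrite (hr m (leqnn m)) (hr 0%N (leq0n m)) u0 u1 cB -scalemxAl.
rewrite (track_section_act gB s0) scalerA; congr (_ *: _).
by rewrite [RHS]mulrCA divfK.
Qed.

End SlitheringConnection.

Theorem theorem1p6
  (R : realType)
  (Gamma : set 'M[R]_3) (X : topologicalType) (pr : 'cV[R]_3 -> X)
  (hGamma : surface_group Gamma) (hX : universal_cover Gamma pr)
  (rho : 'M[R]_3 -> 'M[R]_3) (Om : set 'cV[R]_3) (xi : 'cV[R]_3 -> 'cV[R]_3)
  (hrho : hitchin Gamma rho Om) (hxi : boundary_homeo Gamma rho Om xi)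
  (L : set ('cV[R]_3 * 'cV[R]_3))
  (hL : geodesic_lamination Gamma pr L) (hLc : connected (supp pr L))
  (n : nat) (Q : 'I_n -> R -> R -> 'cV[R]_3)
  (hN : train_track_nbhd pr L Q) (hsnug : snug pr L Q)
  (tau : topologicalType) (coll : X -> tau) (htau : collapse pr Q coll)
  (Sigma : 'cV[R]_3 * 'cV[R]_3 -> 'cV[R]_3 * 'cV[R]_3 -> 'M[R]_3)
  (hSigma : slithering_map pr L Q Om xi Sigma) :
  exists nabla : set X -> 'cV[R]_3 -> 'rV[R]_3,
    [/\ flat_connection Gamma pr L rho xi (nbhd_of pr Q) nabla,
        hoelder_connection pr L (nbhd_of pr Q) nabla,
        (forall t, tie pr Q t ->
           slithering_section Gamma pr L rho xi Sigma t (nabla t)) &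
        forall b : tau, exists chi : set (R -> tau) -> R,
          pi1_character b chi /\
          records_holonomy Gamma pr L Q rho xi nabla coll b chi].
Proof.
have H := Setup hGamma hX hrho hxi hL hN hSigma.
exists (@slithering_connection R Gamma X pr rho xi L n Q Sigma tau coll); split.
- exact: (connection_flat H htau).
- exact: (connection_hoelder H htau).
- exact: (connection_tie H htau).
move=> b; exists (character_of (@transition R Gamma X pr rho xi L n Q Sigma tau coll) b).
split; last exact: (connection_holonomy H htau).
exact: (character_of_pi1 (transition_neq0 H htau) (transition_refl H htau)
  (transition_cocycle H htau)).
Qed.
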